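(* The following decision problem is coNP-complete: given $n$ and a (rational) point $x\in\mathbb{R}^{n^2\times n^2}$ (i.e. $x\in\mathbb{R}^{n^4}$) with $x\geqslant 0$, decide whether $x$ satisfies every inequality of the form $$\sum_{r=1}^{m}Y_{i_rj_r,i_rj_r}-\sum_{1\leqslant r<s\leqslant m}Y_{i_rj_r,i_sj_s}\leqslant 1,$$ where $m,n\geqslant 7$, $i_1,\dots,i_m\in[n]$ are distinct and $j_1,\dots,j_m\in[n]$ are distinct.
   Context: Points $Y\in\mathbb{R}^{n^2\times n^2}$ have rows and columns indexed by pairs $(ij)$ with $i,j\in[n]$; $Y_{ij,kl}$ is the entry in row $(ij)$ and column $(kl)$. *)

(* Defs.v *)
From HB Require Import structures.
From mathcomp Require Import all_boot all_order all_algebra.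
Set Implicit Arguments.
Unset Strict Implicit.
Unset Printing Implicit Defensive.
Import Order.TTheory GRing.Theory Num.Theory.

(** * Deterministic multitape Turing machines *)

(* A two-way infinite tape as a zipper around the scanned cell: [tleft] lists
   the cells to its left, nearest first, and [tright] those to its right.
   [None] is the blank, and all cells not listed are blank. *)
Record tape (S : Type) := Tape {
  tleft : seq (option S);
  tcur : option S;
  tright : seq (option S)
}.

Definition blank_tape (S : Type) : tape S := Tape [::] None [::].

Definition word_tape (S : Type) (w : seq S) : tape S :=
  if w is a :: w' then Tape [::] (Some a) (map Some w') else blank_tape S.

Inductive direction := MoveLeft | Stay | MoveRight.

Definition tape_write (S : Type) (a : option S) (t : tape S) : tape S :=
  Tape (tleft t) a (tright t).

Definition tape_move (S : Type) (d : direction) (t : tape S) : tape S :=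
  match d with
  | MoveLeft =>
      Tape (behead (tleft t)) (head None (tleft t)) (tcur t :: tright t)
  | Stay => t
  | MoveRight =>
      Tape (tcur t :: tleft t) (head None (tright t)) (behead (tright t))
  end.

(* [I] holds the symbols that may occur in inputs and outputs; [tm_work] holds
   the auxiliary tape symbols.  There are [tm_k.+1] tapes. *)
Record TM (I : finType) := MkTM {
  tm_k : nat;
  tm_work : finType;
  tm_state : finType;
  tm_start : tm_state;
  tm_halt : pred tm_state;
  tm_accept : pred tm_state;
  tm_trans : tm_state -> {ffun 'I_tm_k.+1 -> option (I + tm_work)} ->
    tm_state * {ffun 'I_tm_k.+1 -> option (I + tm_work) * direction}
}.

Section Run.
Variables (I : finType) (M : TM I).

Definition tm_symbol : Type := I + tm_work M.

Record config := Config {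
  cstate : tm_state M;
  ctapes : {ffun 'I_(tm_k M).+1 -> tape tm_symbol}
}.

(* The input is on the first tape, with the head on its first symbol. *)
Definition init_config (w : seq I) : config :=
  Config (tm_start M)
    [ffun t => if t == ord0 then word_tape (map inl w) else blank_tape _].

Definition halted (c : config) : bool := tm_halt (cstate c).
Definition accepting (c : config) : bool := tm_accept (cstate c).

Definition step (c : config) : config :=
  if halted c then c else
  let: (q, act) := tm_trans (cstate c) [ffun t => tcur (ctapes c t)] in
  Config q
    [ffun t => tape_move (act t).2 (tape_write (act t).1 (ctapes c t))].

Definition run (w : seq I) (t : nat) : config := iter t step (init_config w).

Fixpoint nonblank_prefix (S : Type) (s : seq (option S)) : seq S :=
  if s is Some a :: s' then a :: nonblank_prefix s' else [::].

(* The output is the word on the last tape from the head up to the first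
   blank. *)
Definition output (c : config) : seq tm_symbol :=
  let t := ctapes c ord_max in nonblank_prefix (tcur t :: tright t).

End Run.

(** * Polynomial time, NP, coNP *)

Definition language (A : finType) := seq A -> Prop.

Definition decides_in_time (A : finType) (M : TM A) (p : {poly nat})
    (L : language A) : Prop :=
  forall w, exists t,
    [/\ t <= p.[size w]%R, halted (run M w t)
      & L w <-> accepting (run M w t)].

Definition inP (A : finType) (L : language A) : Prop :=
  exists (M : TM A) (p : {poly nat}), decides_in_time M p L.

Definition computes_in_time (A B : finType) (M : TM (A + B)%type)
    (p : {poly nat}) (f : seq A -> seq B) : Prop :=
  forall w, exists t,
    let c := run M (map inl w) t in
    [/\ t <= p.[size w]%R, halted c
      & output c = map (fun b => inl (inr b)) (f w)].

Definition poly_time (A B : finType) (f : seq A -> seq B) : Prop :=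
  exists (M : TM (A + B)%type) (p : {poly nat}), computes_in_time M p f.

(* The input [w] and the certificate [c] are written in disjoint alphabets, so
   their concatenation determines both. *)
Definition inNP (A : finType) (L : language A) : Prop :=
  exists (V : language (A + bool)%type) (p : {poly nat}),
    inP V /\
    forall w, L w <-> exists c : seq bool,
      size c <= p.[size w]%R /\ V (map inl w ++ map inr c).

Definition in_coNP (A : finType) (L : language A) : Prop :=
  inNP (fun w => ~ L w).

Definition reduces (A B : finType) (L : language A) (K : language B) : Prop :=
  exists f : seq A -> seq B, poly_time f /\ forall w, L w <-> K (f w).

Definition coNP_hard (B : finType) (K : language B) : Prop :=
  forall (A : finType) (L : language A), in_coNP L -> reduces L K.

Definition coNP_complete (B : finType) (K : language B) : Prop :=
  in_coNP K /\ coNP_hard K.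

(** * The membership problem *)

Definition point (n : nat) : Type := 'I_n * 'I_n -> 'I_n * 'I_n -> rat.

Definition satisfies_inequalities (n : nat) (Y : point n) : Prop :=
  forall m : nat, 7 <= m -> 7 <= n ->
  forall i j : 'I_m -> 'I_n, injective i -> injective j ->
  (\sum_(r < m) Y (i r, j r) (i r, j r)
   - \sum_(r < m) \sum_(s < m | (r < s)%N) Y (i r, j r) (i s, j s) <= 1)%R.

(* Binary value, most significant bit first; leading zeros are allowed. *)
Definition bits_val (b : seq bool) : nat :=
  foldl (fun a (x : bool) => a.*2 + x) 0 b.

(* Words over {0, 1, #}, with [None] as #, which ends every field. *)
Definition fields_word (fs : seq (seq bool)) : seq (option bool) :=
  flatten [seq rcons (map Some b) None | b <- fs].

Definition index_pairs (n : nat) : seq ('I_n * 'I_n) :=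
  [seq (i, j) | i <- enum 'I_n, j <- enum 'I_n].

(* [w] lists n, then numerator and denominator (not necessarily coprime) of
   each of the n^4 entries of [x] in row-major order, all in binary. Numerators
   carry no sign, since instances have nonnegative entries. *)
Definition encodes (w : seq (option bool)) (n : nat) (x : point n) : Prop :=
  exists (bn : seq bool) (num den : 'I_n * 'I_n -> 'I_n * 'I_n -> seq bool),
    [/\ bits_val bn = n,
        forall a b, 0 < bits_val (den a b),
        forall a b,
          x a b = ((bits_val (num a b))%:R / (bits_val (den a b))%:R)%R
      & w = fields_word
          (bn :: flatten [seq [:: num a b; den a b]
                         | a <- index_pairs n, b <- index_pairs n])].

(* The encodings of the yes-instances. *)
Definition inequalities_problem : language (option bool) :=
  fun w => exists (n : nat) (x : point n),
    [/\ encodes w x, forall a b, (0 <= x a b)%R & satisfies_inequalities x].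

(* Main.v *)
(** Membership.  A violated inequality is certified by the list of the pairs
    (i_r, j_r): both sums are computed exactly as fractions in binary and
    compared, and ill-formed words are accepted at once.

    Hardness.  On the cells (v, v) put 1/T on the diagonal of the point, 1 at
    pairs of incompatible vertices and 0 elsewhere.  As 1 >= 1/T, dropping one
    vertex of an incompatible pair never decreases the left-hand side, so some
    inequality is violated iff there is a clique of more than T vertices.
    For a verifier running in time T, a vertex describes one step: its time, the
    state, the scanned symbols, the head positions, and for every head the time
    of the last earlier visit of its cell.  With these last-visit times the
    correctness of a run involves only pairs of steps, so cliques of size T + 1
    are the accepting runs, with the certificate read off the first visits.

    Polynomial time.  A value is stored as a binary tree, written in prefix order
    on a stack, which makes pairing a single push.  The functions computed on the
    top of this stack in polynomial time are closed under composition, pairing,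
    branching and folds with polynomially bounded intermediate results. *)

Require Import Defs.
From mathcomp Require Import all_boot all_order all_algebra.
From mathcomp Require Import zify ring lra.
From Stdlib Require Import Classical.
Import Order.TTheory GRing.Theory Num.Theory.
Set Implicit Arguments.
Unset Strict Implicit.
Unset Printing Implicit Defensive.

(** * Stack programs and their compilation to Turing machines *)

(** Cliques can only express conditions on two vertices, whereas the usual tableau of tape cells
    constrains several neighbouring cells at once; this is why a step carries last-visit times. Two
    steps with the same time are incompatible, so T + 1 compatible ones use every time 0, ..., T
    exactly once. The certificate length is guessed in each vertex and has to agree along the
    clique. The condition m >= 7 is harmless as soon as T >= 7, which the time bound guarantees: a
    clique with more than T vertices is itself a long enough selection. Conversely, dropping
    vertices from a violating selection has to produce only a clique, never a second admissible
    selection. For polynomial time the obstacle is size. Indices, lengths and loop counters are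
    unary, entries of the point are bit lists, and the dimension, given in binary, is truncated
    before it becomes unary. *)

Inductive reg := RI | RD | RA | RB | RC | RO.

(** [RI] holds the input, [RD] the stack of trees, [RO] the output; [RA], [RB] and [RC] are scratch.
    Tape 5 is the last one, from which outputs are read. *)
Definition tape_of (r : reg) : 'I_6 :=
  match r with
  | RI => @Ordinal 6 0 isT | RD => @Ordinal 6 1 isT | RA => @Ordinal 6 2 isT
  | RB => @Ordinal 6 3 isT | RC => @Ordinal 6 4 isT | RO => @Ordinal 6 5 isT
  end.

Section StackPrograms.
Variable I : finType.
Notation sym := (I + bool)%type.

Record store := St { sI : seq sym; sD : seq sym; sA : seq sym;
                     sB : seq sym; sC : seq sym; sO : seq sym }.

Definition get (s : store) (r : reg) : seq sym :=
  match r with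
  | RI => sI s | RD => sD s | RA => sA s | RB => sB s | RC => sC s | RO => sO s
  end.

Definition upd (s : store) (r : reg) (v : seq sym) : store :=
  let: St a b c d e f := s in
  match r with
  | RI => St v b c d e f | RD => St a v c d e f | RA => St a b v d e f
  | RB => St a b c v e f | RC => St a b c d v f | RO => St a b c d e v
  end.

Lemma get_upd s r v r' :
  get (upd s r v) r' = if tape_of r' == tape_of r then v else get s r'.
Proof. by case: s => *; case: r; case: r'. Qed.

Inductive cmd :=
  | Skip
  | Push of reg & sym
  | Pop of reg
  | Seq of cmd & cmd
  | If of reg & (option sym -> bool) & cmd & cmd
  | While of reg & (option sym -> bool) & cmd.

(* The last argument bounds the number of machine steps from above. *)
Inductive exec : cmd -> store -> store -> nat -> Prop :=
  | ESkip s : exec Skip s s 0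
  | EPush r a s : exec (Push r a) s (upd s r (a :: get s r)) 2
  | EPop r s : exec (Pop r) s (upd s r (behead (get s r))) 1
  | ESeq c1 c2 s1 s2 s3 n1 n2 :
      exec c1 s1 s2 n1 -> exec c2 s2 s3 n2 -> exec (Seq c1 c2) s1 s3 (n1 + n2)
  | EIfT r (P : option sym -> bool) c1 c2 s s' n : P (ohead (get s r)) ->
      exec c1 s s' n -> exec (If r P c1 c2) s s' n.+2
  | EIfF r (P : option sym -> bool) c1 c2 s s' n : ~~ P (ohead (get s r)) ->
      exec c2 s s' n -> exec (If r P c1 c2) s s' n.+1
  | EWhileF r (P : option sym -> bool) c s : ~~ P (ohead (get s r)) ->
      exec (While r P c) s s 1
  | EWhileT r (P : option sym -> bool) c s1 s2 s3 n1 n2 :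
      P (ohead (get s1 r)) -> exec c s1 s2 n1 ->
      exec (While r P c) s2 s3 n2 -> exec (While r P c) s1 s3 (n1 + n2).+2
  | EWeak c s s' n m : exec c s s' n -> n <= m -> exec c s s' m.

Definition reading : Type := {ffun 'I_6 -> option sym}.

Definition instr : Type :=
  reading -> nat * ('I_6 -> option sym * direction).

Definition jump (f : reading -> nat) : instr :=
  fun rd => (f rd, fun t => (rd t, Stay)).

(** Jump targets are absolute, so the address [o] of the first instruction is passed down. A machine
    step writes before it moves; hence a push takes two steps, one to move left and one to write. *)
Fixpoint code (c : cmd) (o : nat) : seq instr :=
  match c with
  | Skip => [::]
  | Push r a =>
      [:: fun rd : reading => (o.+1,
            fun t => (rd t, if t == tape_of r then MoveLeft else Stay));
          fun rd : reading => (o.+2,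
            fun t => (if t == tape_of r then Some a else rd t, Stay))]
  | Pop r =>
      [:: fun rd : reading => (o.+1,
            fun t => (rd t, if t == tape_of r then MoveRight else Stay))]
  | Seq c1 c2 => let k1 := code c1 o in k1 ++ code c2 (o + size k1)
  | If r P c1 c2 =>
      let k1 := code c1 o.+1 in
      let o2 := (o.+1 + size k1).+1 in
      let k2 := code c2 o2 in
      jump (fun rd => if P (rd (tape_of r)) then o.+1 else o2) ::
      k1 ++ jump (fun=> o2 + size k2) :: k2
  | While r P c =>
      let k := code c o.+1 in
      jump (fun rd => if P (rd (tape_of r)) then o.+1
                      else (o.+1 + size k).+1) ::
      k ++ [:: jump (fun=> o)]
  end.

(* The states [size K] and [(size K).+1] reject and accept. *)
Definition machine (K : seq instr) : TM I :=
  @MkTM I 5 bool 'I_(size K).+2 ord0 (fun q => size K <= q)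
    (fun q => val q == (size K).+1)
    (fun q rd => let: (p, act) := nth (jump (fun=> 0)) K q rd in
                 (inord p, [ffun t => act t])).

(** The head stands on the top of the stack. Cells to its left are unconstrained: popped symbols
    stay there until a push overwrites them. *)
Definition represents (t : tape sym) (s : seq sym) : Prop :=
  exists m, tcur t :: tright t = map Some s ++ nseq m None.

Definition tapes := {ffun 'I_6 -> tape sym}.

Definition reprs (tp : tapes) (s : store) : Prop :=
  forall r, represents (tp (tape_of r)) (get s r).

Definition cfg K pc (tp : tapes) : config (machine K) :=
  @Config I (machine K) (inord pc) tp.

Lemma step_cfg K pc (tp : tapes) (ins : instr) : pc < size K ->
  nth (jump (fun=> 0)) K pc = ins ->
  let: (p, act) := ins [ffun t => tcur (tp t)] in
  step (cfg K pc tp) =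
  cfg K p [ffun t => tape_move (act t).2 (tape_write (act t).1 (tp t))].
Proof.
move=> ltK <-; rewrite /step /halted /= inordK; last by lia.
rewrite leqNgt ltK /=.
case: (nth _ _ _ _) => p act /=; congr (Config _ _).
by apply/ffunP=> t; rewrite !ffunE.
Qed.

Lemma represents_top t s : represents t s -> tcur t = ohead s.
Proof.
by case=> m; case: s => [|a s] /=; [case: m => //= m|]; case=> -> _.
Qed.

Lemma represents_pop t s : represents t s ->
  represents (tape_move MoveRight t) (behead s).
Proof.
case=> m; rewrite /represents /=.
case: s => [|a s] /=; first case: m => //= m [_ ->].
  by case: m => [|m]; [exists 1 | exists m.+1].
case=> _ ->; case: s => [|b s] /=; last by exists m.
by case: m => [|m]; [exists 1 | exists m.+1].
Qed.

Lemma represents_push t s a : represents t s ->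
  represents (tape_write (Some a) (tape_move MoveLeft t)) (a :: s).
Proof. by case=> m e; exists m; rewrite /= e. Qed.

Lemma tape_write_cur (t : tape sym) : tape_write (tcur t) t = t.
Proof. by case: t. Qed.

Lemma step_jump K pc (tp : tapes) f : pc < size K ->
  nth (jump (fun=> 0)) K pc = jump f ->
  step (cfg K pc tp) = cfg K (f [ffun t => tcur (tp t)]) tp.
Proof.
move=> lt e; rewrite (step_cfg tp lt e); congr (cfg _ _ _).
by apply/ffunP=> t; rewrite !ffunE tape_write_cur.
Qed.

Lemma nth_mid (T : Type) (x0 x : T) pre post : nth x0 (pre ++ x :: post) (size pre) = x.
Proof. by rewrite nth_cat ltnn subnn. Qed.

Lemma iter_split (T : Type) (f : T -> T) m n x : iter (m + n) f x = iter n f (iter m f x).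
Proof. by rewrite addnC iterD. Qed.

(** Induction on the derivation of [exec]. The block may lie anywhere in [K]: generalising over
    [pre] and [post] lets each sub-command be used with a prefix that contains the instructions
    before it. *)
Lemma code_correct c s s' n : exec c s s' n ->
  forall K pre post, K = pre ++ code c (size pre) ++ post ->
  forall tp, reprs tp s ->
  exists m tp', [/\ m <= n,
    iter m (@step I (machine K)) (cfg K (size pre) tp) =
      cfg K (size pre + size (code c (size pre))) tp'
    & reprs tp' s'].
Proof.
elim=> {c s s' n}.
- move=> s K pre post _ tp rp; exists 0, tp; split=> //=.
  by rewrite addn0.
- move=> r a s K pre post defK tp rp.
  exists 2, [ffun t => if t == tape_of r
    then tape_write (Some a) (tape_move MoveLeft (tp t)) else tp t].
  have lt0 : size pre < size K by rewrite defK !size_cat /=; lia.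
  have lt1 : (size pre).+1 < size K by rewrite defK !size_cat /=; lia.
  split=> // [|r'].
  + have e0 := congr1 (fun k => nth (jump (fun=> 0)) k (size pre)) defK.
    have e1 := congr1 (fun k => nth (jump (fun=> 0)) k (size pre).+1) defK.
    rewrite /= nth_mid in e0; rewrite /= nth_cat ltnNge leqnSn /= subSnn /= in e1.
    rewrite /= (step_cfg _ lt0 e0) /= (step_cfg _ lt1 e1) addn2.
    congr (cfg _ _ _); apply/ffunP=> t; rewrite !ffunE /=.
    by case: eqP => _ //; rewrite !tape_write_cur.
  + rewrite ffunE get_upd; case: eqP => [->|_]; last exact: rp.
    exact/represents_push/rp.
- move=> r s K pre post defK tp rp.
  exists 1, [ffun t => if t == tape_of r then tape_move MoveRight (tp t) else tp t].
  have lt0 : size pre < size K by rewrite defK !size_cat /=; lia.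
  split=> // [|r'].
  + have e0 := congr1 (fun k => nth (jump (fun=> 0)) k (size pre)) defK.
    rewrite /= nth_mid in e0; rewrite /= (step_cfg _ lt0 e0) addn1.
    congr (cfg _ _ _); apply/ffunP=> t; rewrite !ffunE /= tape_write_cur.
    by case: eqP.
  + rewrite ffunE get_upd; case: eqP => [->|_]; last exact: rp.
    exact/represents_pop/rp.
- move=> c1 c2 s1 s2 s3 n1 n2 _ IH1 _ IH2 K pre post defK tp rp.
  rewrite /= in defK *.
  case: (IH1 K pre (code c2 (size pre + size (code c1 (size pre))) ++ post) _ tp rp).
    by rewrite defK -catA.
  move=> m1 [tp1 [le1 e1 rp1]].
  case: (IH2 K (pre ++ code c1 (size pre)) post _ tp1 rp1).
    by rewrite size_cat defK -!catA.
  move=> m2 [tp2 [le2 e2 rp2]]; exists (m1 + m2), tp2; split=> //; first lia.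
  by rewrite iter_split e1 -size_cat e2 !size_cat addnA.
- move=> r P c1 c2 s s' n Ps _ IH K pre post defK tp rp; rewrite /= in defK *.
  set k1 := code c1 _ in defK *; set k2 := code c2 _ in defK *.
  have lt0 : size pre < size K by rewrite defK !size_cat /=; lia.
  pose j := jump (fun rd : reading => if P (rd (tape_of r)) then (size pre).+1
               else ((size pre).+1 + size k1).+1).
  case: (IH K (rcons pre j) (jump (fun=> ((size pre).+1 + size k1).+1 + size k2) :: k2 ++ post) _ tp rp).
    by rewrite defK size_rcons -cats1 /= -!catA.
  rewrite size_rcons -/k1 => m [tp1 [le1 e1 rp1]].
  exists m.+2, tp1; split=> //.
  (* One step for the test, [m] for the branch, one for the jump over the other branch. *)
  have -> : m.+2 = 1 + m + 1 by lia.
  rewrite !iter_split /= (step_jump tp lt0 (f := fun rd => if P (rd (tape_of r)) then (size pre).+1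
               else ((size pre).+1 + size k1).+1)); last by rewrite defK nth_mid.
  rewrite ffunE (represents_top (rp r)) Ps e1.
  have lt1 : (size pre).+1 + size k1 < size K.
    by rewrite defK !size_cat /= !size_cat /=; lia.
  rewrite (step_jump tp1 lt1 (f := fun=> ((size pre).+1 + size k1).+1 + size k2)).
    by congr (cfg _ _ _); rewrite size_cat /=; lia.
  have sz : size (pre ++ j :: k1) = (size pre).+1 + size k1 by rewrite size_cat /=; lia.
  rewrite -{1}sz (_ : K = (pre ++ j :: k1) ++ jump (fun=> ((size pre).+1 + size k1).+1 + size k2) :: k2 ++ post).
    exact: nth_mid.
  by rewrite defK -?catA /= -?catA.
- move=> r P c1 c2 s s' n Ps _ IH K pre post defK tp rp; rewrite /= in defK *.
  set k1 := code c1 _ in defK *; set k2 := code c2 _ in defK *.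
  have lt0 : size pre < size K by rewrite defK !size_cat /=; lia.
  pose j := jump (fun rd : reading => if P (rd (tape_of r)) then (size pre).+1
               else ((size pre).+1 + size k1).+1).
  have sz : size (pre ++ j :: k1 ++ [:: jump (fun=> ((size pre).+1 + size k1).+1 + size k2)])
      = ((size pre).+1 + size k1).+1 by rewrite !size_cat /= size_cat /=; lia.
  case: (IH K (pre ++ j :: k1 ++ [:: jump (fun=> ((size pre).+1 + size k1).+1 + size k2)]) post _ tp rp).
    by rewrite sz -/k2 defK -!catA /= -!catA /=.
  rewrite sz -/k2 => m [tp1 [le1 e1 rp1]].
  exists m.+1, tp1; split=> //.
  rewrite -[m.+1]/(1 + m) !iter_split /= (step_jump tp lt0 (f := fun rd => if P (rd (tape_of r)) then (size pre).+1
               else ((size pre).+1 + size k1).+1)); last by rewrite defK nth_mid.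
  rewrite ffunE (represents_top (rp r)) (negbTE Ps) e1.
  by congr (cfg _ _ _); rewrite size_cat /=; lia.
- move=> r P c s Ps K pre post defK tp rp; rewrite /= in defK *.
  set k := code c _ in defK *.
  have lt0 : size pre < size K by rewrite defK !size_cat /=; lia.
  exists 1, tp; split=> //=.
  rewrite (step_jump tp lt0 (f := fun rd => if P (rd (tape_of r)) then (size pre).+1
               else ((size pre).+1 + size k).+1)); last by rewrite defK nth_mid.
  rewrite ffunE (represents_top (rp r)) (negbTE Ps).
  by congr (cfg _ _ _); rewrite size_cat /=; lia.
- move=> r P c s1 s2 s3 n1 n2 Ps _ IH1 _ IH2 K pre post defK tp rp.
  case: (IH1 K (rcons pre (nth (jump (fun=> 0)) (code (While r P c) (size pre)) 0)) (jump (fun=> size pre) :: post) _ tp rp).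
    by rewrite size_rcons defK /= -cats1 -!catA.
  rewrite size_rcons => m1 [tp1 [le1 e1 rp1]].
  (* The jump back leads to the first address of the loop itself, so [pre] and [post] are unchanged
     here. *)
  case: (IH2 K pre post defK tp1 rp1) => m2 [tp2 [le2 e2 rp2]].
  exists (m1 + m2).+2, tp2; split=> //; first by lia.
  apply: etrans e2; rewrite /= in defK.
  set k := code c _ in defK e1 *.
  have lt0 : size pre < size K by rewrite defK !size_cat /=; lia.
  have -> : (m1 + m2).+2 = 1 + m1 + 1 + m2 by lia.
  rewrite !iter_split /= (step_jump tp lt0 (f := fun rd => if P (rd (tape_of r)) then (size pre).+1
               else ((size pre).+1 + size k).+1)); last by rewrite defK nth_mid.
  rewrite ffunE (represents_top (rp r)) Ps e1.
  have lt1 : (size pre).+1 + size k < size K.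
    by rewrite defK !size_cat /= !size_cat /=; lia.
  rewrite (step_jump tp1 lt1 (f := fun=> size pre)) //.
  move: defK; set j := (X in X :: _) => defK.
  have sz : size (pre ++ j :: k) = (size pre).+1 + size k by rewrite size_cat /=; lia.
  rewrite -{1}sz (_ : K = (pre ++ j :: k) ++ jump (fun=> size pre) :: post).
    exact: nth_mid.
  by rewrite defK -?catA /= -?catA.
- move=> c s s' n m _ IH le K pre post defK tp rp.
  by case: (IH K pre post defK tp rp) => m' [tp' [? ? ?]]; exists m', tp'; split=> //; lia.
Qed.

End StackPrograms.

(** * Binary trees on a stack *)

Inductive tree := Lf | Nd of tree & tree.

Fixpoint bits (x : tree) : seq bool :=
  if x is Nd l r then true :: bits l ++ bits r else [:: false].

Class Enc (T : Type) := enc : T -> tree.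
Arguments enc {T Enc} _ : simpl never.

Definition treesz (x : tree) : nat := size (bits x).
Definition sz {T} {e : Enc T} (x : T) : nat := treesz (enc x).

Lemma treesz_gt0 x : 0 < treesz x. Proof. by case: x. Qed.
Lemma treesz_nd l r : treesz (Nd l r) = (treesz l + treesz r).+1.
Proof. by rewrite /treesz /= size_cat. Qed.

#[global] Instance enc_unit : Enc unit := fun=> Lf.
#[global] Instance enc_bool : Enc bool := fun b => if b then Nd Lf Lf else Lf.
(** Unary, with the same tree as a list of [n] copies of [tt]. *)
#[global] Instance enc_nat : Enc nat := fun n => iter n (Nd Lf) Lf.
#[global] Instance enc_prod A B {eA : Enc A} {eB : Enc B} : Enc (A * B) :=
  fun p => Nd (enc p.1) (enc p.2).
#[global] Instance enc_seq A {eA : Enc A} : Enc (seq A) :=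
  foldr (fun a t => Nd (enc a) t) Lf.
#[global] Instance enc_option A {eA : Enc A} : Enc (option A) :=
  fun x => if x is Some a then Nd Lf (enc a) else Lf.

Section EncodingSize.
Context {A B : Type} {eA : Enc A} {eB : Enc B}.

Lemma enc_pair (a : A) (b : B) : enc (a, b) = Nd (enc a) (enc b). Proof. by []. Qed.
Lemma enc_cons (a : A) l : enc (a :: l) = Nd (enc a) (enc l). Proof. by []. Qed.
Lemma sz_gt0 (a : A) : 0 < sz a. Proof. exact: treesz_gt0. Qed.
Lemma sz_pair (a : A) (b : B) : sz (a, b) = (sz a + sz b).+1.
Proof. exact: treesz_nd. Qed.
Lemma sz_cons (a : A) l : sz (a :: l) = (sz a + sz l).+1.
Proof. exact: treesz_nd. Qed.

End EncodingSize.

(** * Stack programs for the basic tree operations *)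

Section TreePrograms.
Variable I : finType.
Notation sym := (I + bool)%type.
Notation one := (inr true : sym).
Notation zero := (inr false : sym).
Notation St := (@St I).

Definition isone (x : option sym) : bool := if x is Some (inr true) then true else false.
Definition nonempty (x : option sym) : bool := if x is Some _ then true else false.

Definition ser (x : tree) : seq sym := map inr (bits x).

Lemma ser_nd l r : ser (Nd l r) = one :: ser l ++ ser r.
Proof. by rewrite /ser /= map_cat. Qed.

Lemma exec_conv c (s s1 s' : store I) n m :
  exec c s s1 n -> s1 = s' -> n <= m -> exec c s s' m.
Proof. by move=> e <-; apply: EWeak. Qed.

(** [RC] counts the subtrees still to be read: a node replaces one pending subtree by two, a leaf
    settles one. The loop thus stops exactly at the end of the tree, without any separator on the
    stack. *)
Definition unload r := While RC nonempty
  (If RD isone (Seq (Pop I RD) (Seq (Push r one) (Push RC one)))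
               (Seq (Pop I RD) (Seq (Push r zero) (Pop I RC)))).

(** Stated with a continuation, because the loop does not pause between subtrees: the induction
    chains the left subtree, the right one and the rest of the run. The factor 9 is the cost of a
    node: the loop and branch overhead, one pop and two pushes. *)
Lemma unloadA x i d a b c o s' n :
  exec (unload RA) (St i d (catrev (ser x) a) b c o) s' n ->
  exec (unload RA) (St i (ser x ++ d) a b (one :: c) o) s' (n + 9 * treesz x).
Proof.
elim: x d a c s' n => [|l IHl r IHr] d a c s' n H.
  apply: EWeak.
    apply: EWhileT; [by [] | | exact: H].
    apply: EIfF => //; apply: ESeq (EPop _ _) _.
    by apply: ESeq (EPush _ _ _) (EPop _ _).
  by rewrite /treesz /=; lia.
rewrite ser_nd in H *; apply: EWeak.
  apply: EWhileT; [by [] | |].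
    apply: EIfT => //; apply: ESeq (EPop _ _) _.
    by apply: ESeq (EPush _ _ _) (EPush _ _ _).
  rewrite /= -catA; apply: (IHl); apply: (IHr).
  have -> : catrev (ser r) (catrev (ser l) (one :: a)) = catrev (one :: ser l ++ ser r) a.
    by rewrite /= catrev_catl.
  exact: H.
by rewrite treesz_nd; lia.
Qed.

Lemma unloadB x i d a b c o s' n :
  exec (unload RB) (St i d a (catrev (ser x) b) c o) s' n ->
  exec (unload RB) (St i (ser x ++ d) a b (one :: c) o) s' (n + 9 * treesz x).
Proof.
elim: x d b c s' n => [|l IHl r IHr] d b c s' n H.
  apply: EWeak.
    apply: EWhileT; [by [] | | exact: H].
    apply: EIfF => //; apply: ESeq (EPop _ _) _.
    by apply: ESeq (EPush _ _ _) (EPop _ _).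
  by rewrite /treesz /=; lia.
rewrite ser_nd in H *; apply: EWeak.
  apply: EWhileT; [by [] | |].
    apply: EIfT => //; apply: ESeq (EPop _ _) _.
    by apply: ESeq (EPush _ _ _) (EPush _ _ _).
  rewrite /= -catA; apply: (IHl); apply: (IHr).
  have -> : catrev (ser r) (catrev (ser l) (one :: b)) = catrev (one :: ser l ++ ser r) b.
    by rewrite /= catrev_catl.
  exact: H.
by rewrite treesz_nd; lia.
Qed.

Definition move_tree r := Seq (Push RC one) (unload r).

Lemma move_treeA x i d b o :
  exec (move_tree RA) (St i (ser x ++ d) [::] b [::] o)
    (St i d (rev (ser x)) b [::] o) (9 * treesz x + 3).
Proof.
apply: EWeak.
  by apply: ESeq (EPush _ _ _) _; apply: unloadA; apply: EWhileF.
by lia.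
Qed.

Lemma move_treeB x i d a o :
  exec (move_tree RB) (St i (ser x ++ d) a [::] [::] o)
    (St i d a (rev (ser x)) [::] o) (9 * treesz x + 3).
Proof.
apply: EWeak.
  by apply: ESeq (EPush _ _ _) _; apply: unloadB; apply: EWhileF.
by lia.
Qed.

Fixpoint push_all (rs : seq reg) (x : sym) : cmd I :=
  if rs is r :: rs' then Seq (Push r x) (push_all rs' x) else Skip I.

Definition drain r rs := While r nonempty
  (If r isone (Seq (Pop I r) (push_all rs one)) (Seq (Pop I r) (push_all rs zero))).

Lemma drainAD u i d b c o :
  exec (drain RA [:: RD]) (St i d (map inr u) b c o)
    (St i (catrev (map inr u) d) [::] b c o) (7 * size u + 1).
Proof.
elim: u d => [|[] u IH] d; first by apply: EWhileF.
  apply: EWeak.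
    apply: EWhileT; [by [] | | exact: IH].
    by apply: EIfT => //; apply: ESeq (EPop _ _) (ESeq (EPush _ _ _) (ESkip _)).
  by rewrite /=; lia.
apply: EWeak.
  apply: EWhileT; [by [] | | exact: IH].
  by apply: EIfF => //; apply: ESeq (EPop _ _) (ESeq (EPush _ _ _) (ESkip _)).
by rewrite /=; lia.
Qed.

Lemma drainBD u i d a c o :
  exec (drain RB [:: RD]) (St i d a (map inr u) c o)
    (St i (catrev (map inr u) d) a [::] c o) (7 * size u + 1).
Proof.
elim: u d => [|[] u IH] d; first by apply: EWhileF.
  apply: EWeak.
    apply: EWhileT; [by [] | | exact: IH].
    by apply: EIfT => //; apply: ESeq (EPop _ _) (ESeq (EPush _ _ _) (ESkip _)).
  by rewrite /=; lia.
apply: EWeak.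
  apply: EWhileT; [by [] | | exact: IH].
  by apply: EIfF => //; apply: ESeq (EPop _ _) (ESeq (EPush _ _ _) (ESkip _)).
by rewrite /=; lia.
Qed.

Lemma drainBA u i d a c o :
  exec (drain RB [:: RA]) (St i d a (map inr u) c o)
    (St i d (catrev (map inr u) a) [::] c o) (7 * size u + 1).
Proof.
elim: u a => [|[] u IH] a; first by apply: EWhileF.
  apply: EWeak.
    apply: EWhileT; [by [] | | exact: IH].
    by apply: EIfT => //; apply: ESeq (EPop _ _) (ESeq (EPush _ _ _) (ESkip _)).
  by rewrite /=; lia.
apply: EWeak.
  apply: EWhileT; [by [] | | exact: IH].
  by apply: EIfF => //; apply: ESeq (EPop _ _) (ESeq (EPush _ _ _) (ESkip _)).
by rewrite /=; lia.
Qed.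

Lemma drainADB u i d b c o :
  exec (drain RA [:: RD; RB]) (St i d (map inr u) b c o)
    (St i (catrev (map inr u) d) [::] (catrev (map inr u) b) c o) (9 * size u + 1).
Proof.
elim: u d b => [|[] u IH] d b; first by apply: EWhileF.
  apply: EWeak.
    apply: EWhileT; [by [] | | exact: IH].
    by apply: EIfT => //; apply: ESeq (EPop _ _) (ESeq (EPush _ _ _) (ESeq (EPush _ _ _) (ESkip _))).
  by rewrite /=; lia.
apply: EWeak.
  apply: EWhileT; [by [] | | exact: IH].
  by apply: EIfF => //; apply: ESeq (EPop _ _) (ESeq (EPush _ _ _) (ESeq (EPush _ _ _) (ESkip _))).
by rewrite /=; lia.
Qed.

Lemma drainA u i d b c o :
  exec (drain RA [::]) (St i d (map inr u) b c o) (St i d [::] b c o) (5 * size u + 1).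
Proof.
elim: u => [|[] u IH]; first by apply: EWhileF.
  apply: EWeak.
    apply: EWhileT; [by [] | | exact: IH].
    by apply: EIfT => //; apply: ESeq (EPop _ _) (ESkip _).
  by rewrite /=; lia.
apply: EWeak.
  apply: EWhileT; [by [] | | exact: IH].
  by apply: EIfF => //; apply: ESeq (EPop _ _) (ESkip _).
by rewrite /=; lia.
Qed.

Lemma rev_ser x : rev (ser x) = map inr (rev (bits x)).
Proof. by rewrite map_rev. Qed.

Lemma catrev_rev_ser x d : catrev (map inr (rev (bits x))) d = ser x ++ d.
Proof. by rewrite catrevE map_rev revK. Qed.

Lemma leq_exp2rW d m n : m <= n -> m ^ d <= n ^ d.
Proof. by case: d => // d le; rewrite leq_exp2r. Qed.

Definition drop_top := Seq (move_tree RA) (drain RA [::]).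

Lemma exec_drop x i d o :
  exec drop_top (St i (ser x ++ d) [::] [::] [::] o)
    (St i d [::] [::] [::] o) (20 * treesz x).
Proof.
apply: EWeak.
  by apply: ESeq (move_treeA _ _ _ _ _) _; rewrite rev_ser; apply: drainA.
by rewrite size_rev; have := treesz_gt0 x; rewrite /treesz; lia.
Qed.

Definition swap := Seq (move_tree RA) (Seq (move_tree RB)
  (Seq (drain RA [:: RD]) (drain RB [:: RD]))).

Lemma exec_swap x y i d o :
  exec swap (St i (ser x ++ ser y ++ d) [::] [::] [::] o)
    (St i (ser y ++ ser x ++ d) [::] [::] [::] o) (24 * (treesz x + treesz y)).
Proof.
apply: exec_conv.
  apply: ESeq (move_treeA _ _ _ _ _) _; apply: ESeq (move_treeB _ _ _ _ _) _.
  by rewrite !rev_ser; apply: ESeq (drainAD _ _ _ _ _ _) (drainBD _ _ _ _ _ _).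
  by rewrite !catrev_rev_ser.
by rewrite !size_rev; have := treesz_gt0 x; have := treesz_gt0 y; rewrite /treesz; lia.
Qed.

(** Pouring one stack onto another reverses it. The copy in [RB] is already in forward order, so it
    is turned once more through [RA] before it is poured onto [RD]. *)
Definition dup := Seq (move_tree RA) (Seq (drain RA [:: RD; RB])
  (Seq (drain RB [:: RA]) (drain RA [:: RD]))).

Lemma exec_dup x i d o :
  exec dup (St i (ser x ++ d) [::] [::] [::] o)
    (St i (ser x ++ ser x ++ d) [::] [::] [::] o) (40 * treesz x).
Proof.
have e : catrev (ser x) [::] = map inr (rev (bits x)) by rewrite catrevE cats0 rev_ser.
apply: exec_conv.
  apply: ESeq (move_treeA _ _ _ _ _) _; rewrite rev_ser.
  apply: ESeq (drainADB _ _ _ _ _ _) _; rewrite !catrev_rev_ser cats0.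
  apply: ESeq (drainBA _ _ _ _ _ _) _; rewrite [catrev _ _]e; exact: drainAD.
  by rewrite !catrev_rev_ser.
by rewrite !size_rev; have := treesz_gt0 x; rewrite /treesz; lia.
Qed.

Fixpoint push_word (u : seq bool) : cmd I :=
  if u is b :: u' then Seq (push_word u') (Push RD (inr b)) else Skip I.

Lemma exec_push_word u i d a b c o :
  exec (push_word u) (St i d a b c o) (St i (map inr u ++ d) a b c o) (2 * size u).
Proof.
elim: u => [|v u IH]; first exact: ESkip.
apply: EWeak.
  by apply: ESeq IH (EPush _ _ _).
by rewrite /=; lia.
Qed.

(** The rest [s] of the stack is arbitrary and untouched, and the scratch tapes are empty before and
    after; this is what makes programs composable. *)
Definition texec (P : cmd I) (t u : tree) (n : nat) := forall i s o,
  exec P (St i (ser t ++ s) [::] [::] [::] o) (St i (ser u ++ s) [::] [::] [::] o) n.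

Lemma texec_le P t u n m : texec P t u n -> n <= m -> texec P t u m.
Proof. by move=> e le i s o; apply: EWeak (e i s o) le. Qed.

Lemma texec_seq P Q t u v n m : texec P t u n -> texec Q u v m ->
  texec (Seq P Q) t v (n + m).
Proof. by move=> e f i s o; apply: ESeq (e i s o) (f i s o). Qed.

Lemma texec_skip t : texec (Skip I) t t 0.
Proof. by move=> i s o; apply: ESkip. Qed.

Definition constP t := Seq drop_top (push_word (bits t)).

Lemma texec_const t u : texec (constP u) t u (20 * treesz t + 2 * treesz u).
Proof.
by move=> i s o; apply: ESeq (exec_drop _ _ _ _) (exec_push_word _ _ _ _ _ _ _).
Qed.

Definition pairP P Q := Seq dup (Seq P (Seq swap (Seq Q (Seq swap (Push RD one))))).

Lemma texec_pair P Q t u v n m : texec P t u n -> texec Q t v m ->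
  texec (pairP P Q) t (Nd u v) (n + m + 100 * (treesz t + treesz u + treesz v)).
Proof.
move=> eP eQ i s o; apply: exec_conv.
  apply: ESeq (exec_dup _ _ _ _) _; apply: ESeq (eP _ _ _) _.
  apply: ESeq (exec_swap _ _ _ _ _) _; apply: ESeq (eQ _ _ _) _.
  by apply: ESeq (exec_swap _ _ _ _ _) (EPush _ _ _).
  by rewrite ser_nd /= -catA.
by have := treesz_gt0 t; lia.
Qed.

Definition fstP := Seq (Pop I RD) (Seq swap drop_top).
Definition sndP := Seq (Pop I RD) drop_top.

Lemma texec_fst t u : texec fstP (Nd t u) t (100 * treesz (Nd t u)).
Proof.
move=> i s o; rewrite ser_nd /= -catA; apply: EWeak.
  by apply: ESeq (EPop _ _) _; apply: ESeq (exec_swap _ _ _ _ _) (exec_drop _ _ _ _).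
by rewrite treesz_nd; lia.
Qed.

Lemma texec_snd t u : texec sndP (Nd t u) u (100 * treesz (Nd t u)).
Proof.
move=> i s o; rewrite ser_nd /= -catA; apply: EWeak.
  by apply: ESeq (EPop _ _) _; apply: exec_drop.
by rewrite treesz_nd; lia.
Qed.

Definition branchP b P Q :=
  Seq dup (Seq b (If RD isone (Seq drop_top P) (Seq drop_top Q))).

Lemma texec_if bP (b : bool) P Q t u n m : texec bP t (enc b) n ->
  texec (if b then P else Q) t u m ->
  texec (branchP bP P Q) t u (n + m + 200 * treesz t).
Proof.
move=> eb eP i s o; have t0 := treesz_gt0 t.
case: b eb eP => eb eP; apply: EWeak.
- apply: ESeq (exec_dup _ _ _ _) _; apply: ESeq (eb _ _ _) _.
  apply: EIfT; first by [].
  by apply: ESeq (exec_drop _ _ _ _) (eP _ _ _).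
- by rewrite /treesz /=; rewrite /treesz in t0 *; lia.
- apply: ESeq (exec_dup _ _ _ _) _; apply: ESeq (eb _ _ _) _.
  apply: EIfF; first by [].
  by apply: ESeq (exec_drop _ _ _ _) (eP _ _ _).
- by rewrite /treesz /=; rewrite /treesz in t0 *; lia.
Qed.

Definition caseP P Q := If RD isone P Q.

Lemma texec_caseN P Q t u v n : texec P (Nd t u) v n ->
  texec (caseP P Q) (Nd t u) v n.+2.
Proof. by move=> e i s o; apply: EIfT (e i s o). Qed.

Lemma texec_caseL P Q v n : texec Q Lf v n -> texec (caseP P Q) Lf v n.+2.
Proof. by move=> e i s o; apply: EWeak (EIfF _ _ (e i s o)) _. Qed.

(** During the loop the remaining list lies on top of the state, unpaired; a node symbol on top
    means that the list is nonempty. A round pushes a node symbol to see both as one pair, computes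
    the pair of the tail and the new state, and removes its node symbol. *)
Definition foldP P := Seq (Pop I RD) (Seq
  (While RD isone (Seq (Push RD one) (Seq
     (pairP (Seq fstP sndP) (Seq (pairP (Seq fstP fstP) sndP) P)) (Pop I RD))))
  (Pop I RD)).

(** [m] bounds the state after every prefix of the list, because each round pays for the state that
    it copies and rewrites. *)
Lemma texec_foldl A S {eA : Enc A} {eS : Enc S} (G : S -> A -> S) P d m N l s :
  (forall a s', texec P (enc (a, s')) (enc (G s' a)) ((sz (a, s')).+2 ^ d)) ->
  (forall k, sz (foldl G s (take k l)) <= m) -> sz l <= N ->
  texec (foldP P) (enc (l, s)) (enc (foldl G s l))
    ((sz l) * ((N + m).+4 ^ d + 1000 * (N + m).+1) + 3).
Proof.
move=> eP bm leN i r o; rewrite enc_pair ser_nd /foldP.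
set W := While _ _ _.
have H : exec W (St i (ser (enc l) ++ ser (enc s) ++ r) [::] [::] [::] o)
  (St i (zero :: ser (enc (foldl G s l)) ++ r) [::] [::] [::] o)
  ((sz l) * ((N + m).+4 ^ d + 1000 * (N + m).+1) + 1); last first.
  apply: exec_conv.
  - apply: ESeq (EPop _ _) _; apply: ESeq (EPop _ _); rewrite /= -catA; exact: H.
  - by [].
  - by rewrite /=; lia.
elim: l s bm leN => [|a l IH] s bm leN.
  by apply: EWeak; [exact: EWhileF | lia].
have szl := sz_cons a l.
have bs : sz s <= m by have := bm 0.
have bs' : sz (G s a) <= m by have := bm 1; rewrite /= take0.
have a0 : 0 < sz a by exact: treesz_gt0.
have l0 : 0 < sz l by exact: treesz_gt0.
rewrite szl in leN *; apply: EWeak.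
  apply: EWhileT; [by [] | | apply: IH; [by move=> k; have := bm k.+1 | lia]].
  apply: ESeq (EPush _ _ _) _.
  have e1 : texec (Seq fstP sndP) (Nd (Nd (enc a) (enc l)) (enc s)) (enc l) (200 * (N + m).+1).
    apply: texec_le; first by apply: texec_seq (texec_fst _ _) (texec_snd _ _).
    rewrite !treesz_nd -/(sz a) -/(sz l) -/(sz s); lia.
  have e2 : texec (Seq (pairP (Seq fstP fstP) sndP) P) (Nd (Nd (enc a) (enc l)) (enc s))
     (enc (G s a)) ((N + m).+4 ^ d + 500 * (N + m).+1).
    apply: texec_le.
      apply: texec_seq; last exact: eP.
      apply: texec_pair (texec_snd _ _).
      apply: texec_seq (texec_fst _ _) (texec_fst _ _).
    have le1 : (sz (a, s)).+2 ^ d <= (N + m).+4 ^ d.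
      apply: leq_exp2rW.
      by rewrite sz_pair; lia.
    rewrite !treesz_nd -/(sz a) -/(sz l) -/(sz s); lia.
  have e3 := texec_pair e1 e2.
  have e4 := e3 i r o; rewrite !ser_nd /= -!catA /= in e4.
  by rewrite enc_cons ser_nd /= -!catA; apply: ESeq e4 _; apply: EPop.
rewrite /= !treesz_nd -/(sz a) -/(sz l) -/(sz s) -/(sz (G s a)).
set Z := _ ^ d; nia.
Qed.

End TreePrograms.

(** * Polynomial-time functions on encoded data *)

(** With a base of at least 2 a single exponent suffices: a constant [c] is below [2 ^ c], and the
    factor two of a sum is absorbed by one more power. *)
Definition pb (g : nat -> nat) : Prop := exists d, forall n, g n <= n.+2 ^ d.

Lemma pb_le g h : (forall n, g n <= h n) -> pb h -> pb g.
Proof. by move=> le [d hd]; exists d => n; apply: leq_trans (hd n). Qed.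

Lemma pb_const c : pb (fun=> c).
Proof.
exists c => n; apply: (@leq_trans (2 ^ c)); first exact/ltnW/ltn_expl.
exact: leq_exp2rW.
Qed.

Lemma pb_id : pb id.
Proof. by exists 1 => n; rewrite expn1; lia. Qed.

Lemma pb_add g h : pb g -> pb h -> pb (fun n => g n + h n).
Proof.
move=> [d hd] [e he]; exists (d + e).+1 => n.
apply: leq_trans (leq_add (hd n) (he n)) _.
rewrite expnS; apply: (@leq_trans (2 * n.+2 ^ (d + e))); last exact: leq_mul.
by rewrite mul2n -addnn leq_add // leq_pexp2l //; lia.
Qed.

Lemma pb_mul g h : pb g -> pb h -> pb (fun n => g n * h n).
Proof.
by move=> [d hd] [e he]; exists (d + e) => n; rewrite expnD leq_mul.
Qed.

Lemma pb_S g : pb g -> pb (fun n => (g n).+1).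
Proof.
move=> pg; apply: pb_le (pb_add pg (pb_const 1)) => n; lia.
Qed.

Lemma pb_exp g k : pb g -> pb (fun n => g n ^ k).
Proof.
move=> pg; elim: k => [|k IH]; first exact: pb_const.
by apply: pb_le (pb_mul pg IH) => n; rewrite expnS.
Qed.

Lemma pb_comp g h : pb g -> pb h -> pb (fun n => g (h n)).
Proof.
move=> [d hd] ph; apply: (@pb_le _ (fun n => (h n).+2 ^ d)) => [n|]; first exact: hd.
exact/pb_exp/pb_S/pb_S.
Qed.

Lemma pb_succ : pb S.
Proof. exact/pb_S/pb_id. Qed.

Create HintDb pb.
#[export] Hint Resolve pb_const pb_id pb_succ pb_add pb_mul pb_S pb_exp : pb.
Ltac pb := solve [auto 40 with pb].

Section PolyTime.
Variable I : finType.
Notation texec := (@texec I).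

(** The bound on the size of the result is carried along because, in a composition, the outer
    program is timed at the size of the intermediate value. *)
Definition pf {X Y} {eX : Enc X} {eY : Enc Y} (f : X -> Y) : Prop :=
  exists P d, forall x, texec P (enc x) (enc (f x)) ((sz x).+2 ^ d)
    /\ sz (f x) <= (sz x).+2 ^ d.

Section Intro.
Context {X Y : Type} {eX : Enc X} {eY : Enc Y}.

Lemma pf_intro (f : X -> Y) P g h : pb g -> pb h ->
  (forall x, texec P (enc x) (enc (f x)) (g (sz x))) ->
  (forall x, sz (f x) <= h (sz x)) -> pf f.
Proof.
move=> pg ph; case: (pb_add pg ph) => d hd eP le; exists P, d => x; split.
  by apply: texec_le (eP x) _; apply: leq_trans (hd _); lia.
by apply: leq_trans (le x) _; apply: leq_trans (hd _); lia.
Qed.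

Lemma pf_bound (f : X -> Y) : pf f -> exists2 h, pb h & forall x, sz (f x) <= h (sz x).
Proof.
case=> P [d H]; exists (fun n => n.+2 ^ d); first by pb.
by move=> x; case: (H x).
Qed.

End Intro.

Section Core.
Context {X Y Z : Type} {eX : Enc X} {eY : Enc Y} {eZ : Enc Z}.

(** Changes of type that keep the tree are free: a pair becomes a [cons], a pair with [tt] a
    successor, a number a list of units. *)
Lemma pf_cast (f : X -> Y) : (forall x, enc (f x) = enc x) -> pf f.
Proof.
move=> e; apply: (@pf_intro _ _ _ _ f (Skip I) id id); try pb; last by move=> x; rewrite /sz e.
by move=> x; rewrite e; apply: texec_le; first exact: texec_skip.
Qed.

Lemma pf_ext (f g : X -> Y) : f =1 g -> pf f -> pf g.
Proof.
by move=> e [P [d H]]; exists P, d => x; have := H x; rewrite e.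
Qed.

Lemma pf_const (c : Y) : pf (fun _ : X => c).
Proof.
apply: (@pf_intro _ _ _ _ _ (constP I (enc c)) (fun n => 20 * n + 2 * sz c) (fun=> sz c)); try pb.
by move=> x; apply: texec_const.
Qed.

Lemma pf_comp (g : Y -> Z) (f : X -> Y) : pf g -> pf f -> pf (fun x => g (f x)).
Proof.
case=> Pg [d Hg] [Pf [e Hf]].
apply: (@pf_intro _ _ _ _ _ (Seq Pf Pg) (fun n => n.+2 ^ e + (n.+2 ^ e).+2 ^ d)
          (fun n => (n.+2 ^ e).+2 ^ d)); try pb.
- move=> x; case: (Hf x) => e1 l1; case: (Hg (f x)) => e2 l2.
  apply: texec_seq e1 _; apply: texec_le e2 _; apply: leq_exp2rW; lia.
- move=> x; case: (Hf x) => e1 l1; case: (Hg (f x)) => e2 l2.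
  by apply: leq_trans l2 _; apply: leq_exp2rW; lia.
Qed.

Lemma pf_pair (f : X -> Y) (g : X -> Z) : pf f -> pf g -> pf (fun x => (f x, g x)).
Proof.
case=> Pf [d Hf] [Pg [e Hg]].
apply: (@pf_intro _ _ _ _ _ (pairP Pf Pg) (fun n => n.+2 ^ d + n.+2 ^ e + 100 * (n + n.+2 ^ d + n.+2 ^ e))
          (fun n => (n.+2 ^ d + n.+2 ^ e).+1)); try pb.
- move=> x; case: (Hf x) => e1 l1; case: (Hg x) => e2 l2.
  apply: texec_le; first exact: texec_pair e1 e2.
  rewrite -/(sz x) -/(sz (f x)) -/(sz (g x)); lia.
- by move=> x; case: (Hf x) => e1 l1; case: (Hg x) => e2 l2; rewrite sz_pair; lia.
Qed.

Lemma pf_if (b : X -> bool) (f g : X -> Y) : pf b -> pf f -> pf g ->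
  pf (fun x => if b x then f x else g x).
Proof.
case=> Pb [c Hb] [Pf [d Hf]] [Pg [e Hg]].
apply: (@pf_intro _ _ _ _ _ (branchP Pb Pf Pg)
   (fun n => n.+2 ^ c + (n.+2 ^ d + n.+2 ^ e) + 200 * n)
   (fun n => n.+2 ^ d + n.+2 ^ e)); try pb.
- move=> x; case: (Hb x) => e0 l0; case: (Hf x) => e1 l1; case: (Hg x) => e2 l2.
  apply: texec_if e0 _; case: (b x).
    by apply: texec_le e1 _; lia.
  by apply: texec_le e2 _; lia.
- by move=> x; case: (Hf x) => e1 l1; case: (Hg x) => e2 l2; case: (b x); lia.
Qed.

(** Common core of predecessor, [behead] and [odflt]: all return the right subtree, and [c] is the
    tree of the value on a leaf. *)
Lemma pf_right (f : X -> Y) c :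
  (forall x t u, enc x = Nd t u -> enc (f x) = u) ->
  (forall x, enc x = Lf -> enc (f x) = c) -> pf f.
Proof.
move=> hN hL.
apply: (@pf_intro _ _ _ _ _ (caseP (sndP I) (constP I c)) (fun n => (100 * n + 2 * treesz c).+2) (fun n => n + treesz c)); try pb.
  move=> x; rewrite /sz; case e: (enc x) => [|t u].
    rewrite (hL x) //; apply: texec_le; first by apply: texec_caseL; apply: texec_const.
    by lia.
  rewrite (hN x t u) //; apply: texec_le; first by apply: texec_caseN; apply: texec_snd.
  by rewrite !ltnS leq_addr.
move=> x; rewrite /sz; case e: (enc x) => [|t u]; first by rewrite hL //; lia.
by rewrite (hN x t u) // treesz_nd; lia.
Qed.

Lemma pf_left (f : X -> Y) c :
  (forall x t u, enc x = Nd t u -> enc (f x) = t) ->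
  (forall x, enc x = Lf -> enc (f x) = c) -> pf f.
Proof.
move=> hN hL.
apply: (@pf_intro _ _ _ _ _ (caseP (fstP I) (constP I c)) (fun n => (100 * n + 2 * treesz c).+2) (fun n => n + treesz c)); try pb.
  move=> x; rewrite /sz; case e: (enc x) => [|t u].
    rewrite (hL x) //; apply: texec_le; first by apply: texec_caseL; apply: texec_const.
    by lia.
  rewrite (hN x t u) //; apply: texec_le; first by apply: texec_caseN; apply: texec_fst.
  by rewrite !ltnS leq_addr.
move=> x; rewrite /sz; case e: (enc x) => [|t u]; first by rewrite hL //; lia.
by rewrite (hN x t u) // treesz_nd; lia.
Qed.

Lemma pf_node (f : X -> bool) :
  (forall x t u, enc x = Nd t u -> f x) ->
  (forall x, enc x = Lf -> f x = false) -> pf f.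
Proof.
move=> hN hL.
apply: (@pf_intro _ _ _ _ _ (caseP (constP I (enc true)) (constP I (enc false))) (fun n => (20 * n + 6).+2) (fun n => 3)); try pb.
  move=> x; rewrite /sz; case e: (enc x) => [|t u].
    rewrite (hL x) //; apply: texec_le; first by apply: texec_caseL; apply: texec_const.
    by [].
  by rewrite (hN x t u) //; apply: texec_caseN; apply: texec_const.
by move=> x; case: (f x).
Qed.

End Core.

Section Foldl.
Context {X A S : Type} {eX : Enc X} {eA : Enc A} {eS : Enc S}.

Lemma pf_id : pf (fun x : X => x).
Proof. exact: pf_cast. Qed.

Lemma pf_fst0 : pf (@fst A S).
Proof.
apply: (@pf_intro _ _ _ _ _ (fstP I) (fun n => 100 * n) id); try pb.
  by case=> a b; apply: texec_fst.
by case=> a b; rewrite sz_pair /=; lia.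
Qed.

Lemma pf_snd0 : pf (@snd A S).
Proof.
apply: (@pf_intro _ _ _ _ _ (sndP I) (fun n => 100 * n) id); try pb.
  by case=> a b; apply: texec_snd.
by case=> a b; rewrite sz_pair /=; lia.
Qed.

Lemma pf_fst (f : X -> A * S) : pf f -> pf (fun x => (f x).1).
Proof. exact: (pf_comp pf_fst0). Qed.

Lemma pf_snd (f : X -> A * S) : pf f -> pf (fun x => (f x).2).
Proof. exact: (pf_comp pf_snd0). Qed.

End Foldl.

Lemma size_le_sz {A} {eA : Enc A} (l : seq A) : size l <= sz l.
Proof. by elim: l => //= a l IH; rewrite sz_cons; lia. Qed.

Section Foldl2.
Context {X A S : Type} {eX : Enc X} {eA : Enc A} {eS : Enc S}.
Variables (F : X -> S -> A -> S) (s0 : X -> S) (l : X -> seq A).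
Hypotheses (pF : pf (fun p : X * S * A => F p.1.1 p.1.2 p.2)) (ps : pf s0) (pl : pf l).

Lemma pf_foldl B : pb B ->
  (forall x k, sz (foldl (F x) (s0 x) (take k (l x))) <= B (sz x)) ->
  pf (fun x => foldl (F x) (s0 x) (l x)).
Proof.
move=> pB hB.
(* The body of [foldP] sees only the element and the state, so the parameter [x] travels inside the
   state and is projected away at the end. *)
have pG : pf (fun q : A * (X * S) => (q.2.1, F q.2.1 q.2.2 q.1)).
  apply: pf_pair.
    exact/pf_fst/pf_snd/pf_id.
  refine (@pf_comp _ _ _ _ _ _ _ (fun q : A * (X * S) => (q.2, q.1)) pF _).
  apply: pf_pair; last exact/pf_fst/pf_id.
  exact/pf_snd/pf_id.
have p0 : pf (fun x => (l x, (x, s0 x))).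
  by apply: pf_pair => //; apply: pf_pair => //; apply: pf_id.
case: pG => P [d HP]; case: p0 => Q [e HQ].
apply: (@pf_intro _ _ _ _ _ (Seq Q (Seq (foldP P) (sndP I)))
  (fun n => n.+2 ^ e + (n.+2 ^ e * ((n.+2 ^ e + (n + B n).+1).+4 ^ d + 1000 * (n.+2 ^ e + (n + B n).+1).+1) + 3
     + 100 * (n + B n).+1)) B) => //; try pb.
  move=> x; case: (HQ x) => e0 l0.
  rewrite sz_pair in l0.
  pose G (s : X * S) (a : A) := (s.1, F s.1 s.2 a).
  have defG k : foldl G (x, s0 x) (take k (l x)) = (x, foldl (F x) (s0 x) (take k (l x))).
    by elim: (take k (l x)) (s0 x) => //= a t IH s; rewrite IH.
  apply: texec_seq e0 _.
  have e1 := @texec_foldl I A (X * S) _ _ G P d (sz x + B (sz x)).+1 ((sz x).+2 ^ e) (l x) (x, s0 x) _ _ _.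
  apply: texec_seq.
    apply: texec_le; first apply: e1.
    - by move=> a s'; case: (HP (a, s')) => /=.
    - by move=> k; rewrite defG sz_pair; have := hB x k; lia.
    - lia.
    by rewrite leq_add2r leq_mul2r; apply/orP; right; lia.
  have := defG (size (l x)); rewrite take_size => ->.
  rewrite enc_pair; apply: texec_le; first exact: texec_snd.
  by rewrite -enc_pair -/(sz _) sz_pair; have := hB x (size (l x)); rewrite take_size; lia.
by move=> x; have := hB x (size (l x)); rewrite take_size.
Qed.

(** If the growth in a round depends on the parameter and the element but not on the state, the
    total growth is at most the number of rounds times a polynomial. This excludes repeated doubling
    and settles most folds below. *)
Lemma pf_foldl_grow C : pb C ->
  (forall x s a, sz (F x s a) <= sz s + C (sz x + sz a)) ->
  pf (fun x => foldl (F x) (s0 x) (l x)).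
Proof.
case=> d hC hF.
case: (pf_bound ps) => h0 ph0 hs0; case: (pf_bound pl) => hl phl hhl.
apply: (@pf_foldl (fun n => h0 n + hl n * (n + hl n).+2 ^ d)); first by pb.
move=> x k; apply: (@leq_trans (sz (s0 x) + sz (l x) * (sz x + hl (sz x)).+2 ^ d)); last first.
  by rewrite leq_add // leq_mul.
have leT : sz (take k (l x)) <= sz (l x).
  by elim: (l x) k => [|a t IH] [|k] //=; rewrite !sz_cons; have := IH k; lia.
apply: (@leq_trans (sz (s0 x) + size (take k (l x)) * (sz x + hl (sz x)).+2 ^ d)); last first.
  by rewrite leq_add2l leq_mul2r (leq_trans (size_le_sz _) leT) orbT.
move: leT (hhl x); elim: (take k (l x)) (s0 x) => [|a t IH] s le1 le2 /=; first lia.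
rewrite sz_cons in le1; apply: leq_trans (IH (F x s a) _ le2) _; first lia.
have := hF x s a.
have : C (sz x + sz a) <= (sz x + hl (sz x)).+2 ^ d.
  by apply: leq_trans (hC _) _; apply: leq_exp2rW; lia.
by set Z := _ ^ d => h1 h2; rewrite mulSn; lia.
Qed.

End Foldl2.
End PolyTime.

Lemma sz_nat (n : nat) : sz n = n.*2.+1.
Proof.
elim: n => // n IH; have -> : sz n.+1 = (1 + sz n).+1 by exact: treesz_nd.
by rewrite IH; lia.
Qed.

Lemma sz_bool (b : bool) : sz b <= 3.
Proof. by case: b. Qed.

Lemma sz_nil {A} {eA : Enc A} : sz ([::] : seq A) = 1.
Proof. by []. Qed.

Lemma sz_cat {A} {eA : Enc A} (l m : seq A) : (sz (l ++ m)).+1 = sz l + sz m.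
Proof. by elim: l => [|a l IH] //; rewrite cat_cons !sz_cons; lia. Qed.

Lemma sz_rcons {A} {eA : Enc A} (l : seq A) a : sz (rcons l a) = sz l + (sz a).+1.
Proof. by pose proof (sz_cat l [:: a]) as h; rewrite cats1 sz_cons sz_nil in h; lia. Qed.

Create HintDb pf.

(** * Closure of [pf] under list and arithmetic operations *)

Section Library.
Variable I : finType.
Notation pf := (@pf I _ _ _ _).

Lemma pf_app2 {X A B C} {eX : Enc X} {eA : Enc A} {eB : Enc B} {eC : Enc C} (F : A -> B -> C) (a : X -> A) (b : X -> B) :
  pf (fun p : A * B => F p.1 p.2) -> pf a -> pf b -> pf (fun x => F (a x) (b x)).
Proof.
by move=> pF pa pb; apply: (@pf_comp _ _ _ _ _ _ _ _ (fun x => (a x, b x)) pF); apply: pf_pair.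
Qed.

Section Basic.
Context {X A : Type} {eX : Enc X} {eA : Enc A}.

Lemma pf_succ (a : X -> nat) : pf a -> pf (fun x => (a x).+1).
Proof.
move=> pa; apply: (@pf_comp _ _ _ _ _ _ _ (fun p : unit * nat => p.2.+1) (fun x => (tt, a x))).
  exact: pf_cast.
by apply: pf_pair => //; apply: pf_const.
Qed.

Lemma pf_pred (a : X -> nat) : pf a -> pf (fun x => (a x).-1).
Proof. by apply: pf_comp; apply: (@pf_right _ _ _ _ _ _ Lf) => [[|n] t u|[|n]] //= [_ <-]. Qed.

Lemma pf_eq0 (a : X -> nat) : pf a -> pf (fun x => a x == 0).
Proof.
move=> pa; apply: (@pf_ext _ _ _ _ _ (fun x => if a x != 0 then false else true)).
  by move=> x; case: eqP.
apply: pf_if; [|exact: pf_const|exact: pf_const].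
by apply: (@pf_comp _ _ _ _ _ _ _ (fun n => n != 0) a) => //; apply: pf_node => [[]|[]].
Qed.

Lemma pf_cons (a : X -> A) (l : X -> seq A) : pf a -> pf l -> pf (fun x => a x :: l x).
Proof. by apply: pf_app2; apply: pf_cast. Qed.

Lemma pf_behead (l : X -> seq A) : pf l -> pf (fun x => behead (l x)).
Proof. by apply: pf_comp; apply: (@pf_right _ _ _ _ _ _ Lf) => [[|n l'] t u|[|n l']] //= [_ <-]. Qed.

Lemma pf_head c (l : X -> seq A) : pf l -> pf (fun x => head c (l x)).
Proof.
apply: pf_comp; apply: (@pf_left _ _ _ _ _ _ (enc c)) => [[|n l'] t u|[|n l']] //=.
by rewrite enc_cons => -[<-].
Qed.

Lemma pf_nilp (l : X -> seq A) : pf l -> pf (fun x => nilp (l x)).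
Proof.
move=> pl; apply: (@pf_ext _ _ _ _ _ (fun x => if ~~ nilp (l x) then false else true)).
  by move=> x; case: nilp.
apply: pf_if; [|exact: pf_const|exact: pf_const].
by apply: (@pf_comp _ _ _ _ _ _ _ (fun l => ~~ nilp l) l) => //; apply: pf_node => [[]|[]].
Qed.

Lemma pf_some (a : X -> A) : pf a -> pf (fun x => Some (a x)).
Proof.
move=> pa; apply: (@pf_comp _ _ _ _ _ _ _ (fun p : unit * A => Some p.2) (fun x => (tt, a x))).
  exact: pf_cast.
by apply: pf_pair => //; apply: pf_const.
Qed.

Lemma pf_isSome (a : X -> option A) : pf a -> pf (fun x => isSome (a x)).
Proof. by apply: pf_comp; apply: pf_node => [[]|[]]. Qed.

Lemma pf_odflt c (a : X -> option A) : pf a -> pf (fun x => odflt c (a x)).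
Proof.
apply: pf_comp; apply: (@pf_right _ _ _ _ _ _ (enc c)) => [[b|] t u|[b|]] //=.
by case=> _ <-.
Qed.

Lemma pf_negb (a : X -> bool) : pf a -> pf (fun x => ~~ a x).
Proof. by move=> pa; apply: pf_if => //; apply: pf_const. Qed.

Lemma pf_andb (a b : X -> bool) : pf a -> pf b -> pf (fun x => a x && b x).
Proof. by move=> pa pb; apply: pf_if => //; apply: pf_const. Qed.

Lemma pf_orb (a b : X -> bool) : pf a -> pf b -> pf (fun x => a x || b x).
Proof. by move=> pa pb; apply: pf_if => //; apply: pf_const. Qed.

Lemma pf_implyb (a b : X -> bool) : pf a -> pf b -> pf (fun x => a x ==> b x).
Proof. by move=> pa pb; apply: pf_if => //; apply: pf_const. Qed.

Lemma pf_eqb (a b : X -> bool) : pf a -> pf b -> pf (fun x => a x == b x).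
Proof.
move=> pa pb; apply: (@pf_ext _ _ _ _ _ (fun x => if a x then b x else ~~ b x)).
  by move=> x; case: (a x); case: (b x).
by apply: pf_if => //; apply: pf_negb.
Qed.

Lemma pf_nseqtt (n : X -> nat) : pf n -> pf (fun x => nseq (n x) tt).
Proof. by apply: pf_comp; apply: pf_cast; elim => //= k; rewrite enc_cons => ->. Qed.

Lemma pf_addb (a b : X -> bool) : pf a -> pf b -> pf (fun x => a x (+) b x).
Proof.
move=> pa pb; apply: (@pf_ext _ _ _ _ _ (fun x => if a x then ~~ b x else b x)).
  by move=> x; case: (a x); case: (b x).
by apply: pf_if => //; apply: pf_negb.
Qed.

End Basic.

(** Dispatch on the outermost operation of the body; the second-order patterns [@?a x] return each
    argument as a function of the environment. *)
Ltac pf_basic :=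
  lazymatch goal with
  | H : pf ?f |- pf ?f => exact H
  | |- pf (fun x => x) => refine (pf_id _)
  | |- pf (fun _ => ?c) => refine (pf_const _ c)
  | |- pf (fun x => (@?a x, @?b x)) => refine (pf_pair (f := a) (g := b) _ _)
  | |- pf (fun x => (@?a x).1) => refine (pf_fst (f := a) _)
  | |- pf (fun x => (@?a x).2) => refine (pf_snd (f := a) _)
  | |- pf (fun x => match @?b x with true => @?f x | false => @?g x end) =>
      refine (pf_if (b := b) (f := f) (g := g) _ _ _)
  | |- pf (fun x => (@?a x).+1) => refine (pf_succ (a := a) _)
  | |- pf (fun x => (@?a x).-1) => refine (pf_pred (a := a) _)
  | |- pf (fun x => @?a x == 0) => refine (pf_eq0 (a := a) _)
  | |- pf (fun x => @?a x :: @?l x) => refine (pf_cons (a := a) (l := l) _ _)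
  | |- pf (fun x => behead (@?l x)) => refine (pf_behead (l := l) _)
  | |- pf (fun x => head ?c (@?l x)) => refine (pf_head c (l := l) _)
  | |- pf (fun x => nilp (@?l x)) => refine (pf_nilp (l := l) _)
  | |- pf (fun x => Some (@?a x)) => refine (pf_some (a := a) _)
  | |- pf (fun x => isSome (@?a x)) => refine (pf_isSome (a := a) _)
  | |- pf (fun x => odflt ?c (@?a x)) => refine (pf_odflt c (a := a) _)
  | |- pf (fun x => ~~ @?a x) => refine (pf_negb (a := a) _)
  | |- pf (fun x => @?a x && @?b x) => refine (pf_andb (a := a) (b := b) _ _)
  | |- pf (fun x => @?a x || @?b x) => refine (pf_orb (a := a) (b := b) _ _)
  | |- pf (fun x => @?a x ==> @?b x) => refine (pf_implyb (a := a) (b := b) _ _)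
  | |- pf (fun x => @?a x == @?b x :> bool) => refine (pf_eqb (a := a) (b := b) _ _)
  | |- pf (fun x => @?a x (+) @?b x) => refine (pf_addb (a := a) (b := b) _ _)
  | |- pf (fun x => nseq (@?a x) tt) => refine (pf_nseqtt (n := a) _)
  | |- pf (fun x => _) => first
     [ match goal with |- pf (fun x => ?h (@?a x)) =>
         refine (pf_comp (g := h) (f := a) _ _); [assumption|] end
     ]
  | |- pf ?f => change (pf (fun x => f x))
  end.
Ltac pf := solve [repeat (cbv beta; pf_basic)].

Lemma pf_rev {X} {eX : Enc X} {A} {eA : Enc A} (l : X -> seq A) : pf l -> pf (fun x => rev (l x)).
Proof.
move=> pl; apply: (@pf_ext _ _ _ _ _ (fun x => foldl (fun s a => a :: s) [::] (l x))).
  by move=> x; rewrite -[RHS]cats0 -catrevE; elim: (l x) [::] => //= a t IH s.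
apply: (@pf_foldl_grow _ _ _ _ _ _ _ _ _ _ _ _ _ S) => //; try pf; first by pb.
by move=> x s a; rewrite sz_cons; lia.
Qed.

Lemma foldl_cons {A} (l m : seq A) : foldl (fun s a => a :: s) m l = catrev l m.
Proof. by elim: l m => //= a l IH m. Qed.

Lemma pf_cat {X} {eX : Enc X} {A} {eA : Enc A} (l m : X -> seq A) : pf l -> pf m -> pf (fun x => l x ++ m x).
Proof.
move=> pl pm; apply: (@pf_ext _ _ _ _ _ (fun x => foldl (fun s a => a :: s) (m x) (rev (l x)))).
  by move=> x; rewrite foldl_cons catrevE revK.
apply: (@pf_foldl_grow _ _ _ _ _ _ _ _ _ _ _ _ _ S) => //; try pf; first exact: pf_rev; first by pb.
by move=> x s a; rewrite sz_cons; lia.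
Qed.

Lemma pf_map {X} {eX : Enc X} {A} {eA : Enc A} {B} {eB : Enc B} (f : X -> A -> B) (l : X -> seq A) :
  pf (fun p : X * A => f p.1 p.2) -> pf l -> pf (fun x => map (f x) (l x)).
Proof.
move=> pF pl.
case: (pf_bound pF) => h ph hh.
apply: (@pf_ext _ _ _ _ _ (fun x => rev (foldl (fun s a => f x a :: s) [::] (l x)))).
  move=> x; rewrite -[RHS]revK; congr rev.
  rewrite -[RHS]cats0 -catrevE; elim: (l x) [::] => //= a t IH s.
apply: pf_rev.
apply: (@pf_foldl_grow _ _ _ _ _ _ _ _ _ _ _ _ _ (fun n => (h n.+1).+1)) => //; try pf.
- apply: pf_cons; last by pf.
  by apply: (@pf_comp _ _ _ _ _ _ _ _ (fun p : X * seq B * A => (p.1.1, p.2)) pF); pf.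
- by apply: pb_S; apply: pb_comp => //; pb.
by move=> x s a; rewrite sz_cons; have := hh (x, a); rewrite sz_pair /=; lia.
Qed.

Lemma pf_filter {X} {eX : Enc X} {A} {eA : Enc A} (f : X -> A -> bool) (l : X -> seq A) :
  pf (fun p : X * A => f p.1 p.2) -> pf l -> pf (fun x => filter (f x) (l x)).
Proof.
move=> pF pl.
apply: (@pf_ext _ _ _ _ _ (fun x => rev (foldl (fun s a => if f x a then a :: s else s) [::] (l x)))).
  move=> x; rewrite -[RHS]revK; congr rev.
  rewrite -[RHS]cats0 -catrevE; elim: (l x) [::] => //= a t IH s.
  by rewrite IH; case: (f x a).
apply: pf_rev.
apply: (@pf_foldl_grow _ _ _ _ _ _ _ _ _ _ _ _ _ S) => //; try pf; last first.
- by move=> x s a; case: (f x a); rewrite ?sz_cons; lia.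
- by pb.
apply: pf_if; try pf.
by apply: (@pf_comp _ _ _ _ _ _ _ _ (fun p : X * seq A * A => (p.1.1, p.2)) pF); pf.
Qed.

Lemma pf_has {X} {eX : Enc X} {A} {eA : Enc A} (f : X -> A -> bool) (l : X -> seq A) :
  pf (fun p : X * A => f p.1 p.2) -> pf l -> pf (fun x => has (f x) (l x)).
Proof.
move=> pF pl; apply: (@pf_ext _ _ _ _ _ (fun x => ~~ nilp (filter (f x) (l x)))).
  by move=> x; rewrite /nilp size_filter has_count lt0n.
by apply/pf_negb/pf_nilp/pf_filter.
Qed.

Lemma pf_all {X} {eX : Enc X} {A} {eA : Enc A} (f : X -> A -> bool) (l : X -> seq A) :
  pf (fun p : X * A => f p.1 p.2) -> pf l -> pf (fun x => all (f x) (l x)).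
Proof.
move=> pF pl; apply: (@pf_ext _ _ _ _ _ (fun x => ~~ has (fun a => ~~ f x a) (l x))).
  by move=> x; rewrite -all_predC; apply: eq_all => a /=; rewrite negbK.
by apply/pf_negb/pf_has => //; apply: pf_negb.
Qed.

Lemma pf_rcons {X} {eX : Enc X} {A} {eA : Enc A} (l : X -> seq A) (a : X -> A) : pf l -> pf a -> pf (fun x => rcons (l x) (a x)).
Proof.
move=> pl pa; apply: (@pf_ext _ _ _ _ _ (fun x => l x ++ [:: a x])).
  by move=> x; rewrite cats1.
by apply: pf_cat => //; pf.
Qed.

Lemma pf_size {X} {eX : Enc X} {A} {eA : Enc A} (l : X -> seq A) : pf l -> pf (fun x => size (l x)).
Proof.
move=> pl; apply: (@pf_ext _ _ _ _ _ (fun x => foldl (fun s a => s.+1) 0 (l x))).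
  by move=> x; rewrite -[RHS]addn0; elim: (l x) 0 => //= a t IH s; rewrite IH addnS.
apply: (@pf_foldl_grow _ _ _ _ _ _ _ _ _ _ _ _ _ (fun=> 2)) => //; try pf; try pb.
by move=> x s a; rewrite !sz_nat; lia.
Qed.

Lemma pf_flatten {X} {eX : Enc X} {A} {eA : Enc A} (l : X -> seq (seq A)) : pf l -> pf (fun x => flatten (l x)).
Proof.
move=> pl; apply: (@pf_ext _ _ _ _ _ (fun x => foldl cat [::] (l x))).
  by move=> x; rewrite -[RHS]/([::] ++ _); elim: (l x) [::] => [|a t IH] s /=; rewrite ?cats0 // IH catA.
apply: (@pf_foldl_grow _ _ _ _ _ _ _ _ _ _ _ _ _ id) => //; try pf; try pb.
  by apply: pf_cat; pf.
by move=> x s a; pose proof (sz_cat s a); lia.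
Qed.

Lemma pf_addn {X} {eX : Enc X} (a b : X -> nat) : pf a -> pf b -> pf (fun x => a x + b x).
Proof.
move=> pa pb; apply: (@pf_ext _ _ _ _ _ (fun x => foldl (fun s _ => s.+1) (a x) (nseq (b x) tt))).
  by move=> x; elim: (b x) (a x) => //= [|n IH] s; rewrite ?IH ?addSnnS ?addn0.
apply: (@pf_foldl_grow _ _ _ _ _ _ _ _ _ _ _ _ _ (fun=> 2)) => //; try pf; try pb.
by move=> x s u; rewrite !sz_nat; lia.
Qed.

Lemma pf_subn {X} {eX : Enc X} (a b : X -> nat) : pf a -> pf b -> pf (fun x => a x - b x).
Proof.
move=> pa pb; apply: (@pf_ext _ _ _ _ _ (fun x => foldl (fun s _ => s.-1) (a x) (nseq (b x) tt))).
  by move=> x; elim: (b x) (a x) => //= [|n IH] s; rewrite ?IH ?subn0 //; lia.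
apply: (@pf_foldl_grow _ _ _ _ _ _ _ _ _ _ _ _ _ (fun=> 0)) => //; try pf; try pb.
by move=> x s u; rewrite !sz_nat; lia.
Qed.

Lemma pf_muln {X} {eX : Enc X} (a b : X -> nat) : pf a -> pf b -> pf (fun x => a x * b x).
Proof.
move=> pa pb; case: (pf_bound pa) => h ph hh.
apply: (@pf_ext _ _ _ _ _ (fun x => foldl (fun s _ => s + a x) 0 (nseq (b x) tt))).
  move=> x; rewrite -[RHS]add0n; elim: (b x) 0 => //= [|n IH] s; rewrite ?IH; lia.
(* The bound is evaluated at the size of [x] plus that of [tt], which is 1; the predecessor takes
   this 1 away. *)
apply: (@pf_foldl_grow _ _ _ _ _ _ _ (fun x s _ => s + a x) _ _ _ _ _ (fun n => h n.-1)) => //; try pf; try pb.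
- by apply: pf_addn; try pf; apply: pf_comp; pf.
- apply: pb_comp => //; apply: pb_le pb_id => n; lia.
by move=> x s []; have := hh x; rewrite !sz_nat (_ : sz tt = 1) // addn1 /=; lia.
Qed.

Lemma pf_nth {X} {eX : Enc X} {A} {eA : Enc A} c (l : X -> seq A) (k : X -> nat) : pf l -> pf k -> pf (fun x => nth c (l x) (k x)).
Proof.
move=> pl pk; apply: (@pf_ext _ _ _ _ _ (fun x => head c (foldl (fun s _ => behead s) (l x) (nseq (k x) tt)))).
  by move=> x; elim: (k x) (l x) => [|n IH] [|a s] //=; rewrite IH ?nth_nil.
apply: pf_head.
apply: (@pf_foldl_grow _ _ _ _ _ _ _ _ _ _ _ _ _ (fun=> 0)) => //; try pf; try pb.
by move=> x [|b s] u //=; rewrite sz_cons; lia.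
Qed.

Lemma pf_leq {X} {eX : Enc X} (a b : X -> nat) : pf a -> pf b -> pf (fun x => a x <= b x).
Proof. by move=> pa pb; apply/pf_eq0/pf_subn. Qed.

Lemma pf_eqn {X} {eX : Enc X} (a b : X -> nat) : pf a -> pf b -> pf (fun x => a x == b x).
Proof.
move=> pa pb; apply: (@pf_ext _ _ _ _ _ (fun x => (a x <= b x) && (b x <= a x))).
  by move=> x; rewrite eqn_leq.
by apply/pf_andb; apply: pf_leq.
Qed.

(** The element added in a round is the length of the state, so the growth criterion does not apply;
    instead each intermediate state is recognised as some [iota 0 k] and measured directly. *)
Lemma pf_iota0 {X} {eX : Enc X} (n : X -> nat) : pf n -> pf (fun x => iota 0 (n x)).
Proof.
move=> pn; case: (pf_bound pn) => h ph hh.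
have E k : foldl (fun s _ => rcons s (size s)) [::] (nseq k tt) = iota 0 k.
  elim: k => // k IH; rewrite -addn1 nseqD foldl_cat IH /= size_iota iotaD cats1 //.
apply: (@pf_ext _ _ _ _ _ (fun x => foldl (fun s _ => rcons s (size s)) [::] (nseq (n x) tt))).
  by move=> x; rewrite E.
apply: (@pf_foldl _ _ _ _ _ _ _ _ _ _ _ _ _ (fun m => (h m * (h m).*2.+2).+1)) => //; try pf.
- by apply: pf_rcons; try pf; apply: pf_size; pf.
- apply: pb_S; apply: pb_mul => //; apply: pb_le (pb_add (pb_add ph ph) (pb_const 2)) => m; lia.
have takeE k m : take k (nseq m tt) = nseq (minn k m) tt.
  by elim: k m => [|k IH] [|m] //=; rewrite IH minnSS.
move=> x k; rewrite takeE E.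
have le : minn k (n x) <= h (sz x) by have := hh x; rewrite sz_nat; lia.
apply: (@leq_trans (minn k (n x) * (h (sz x)).*2.+2).+1); last by rewrite ltnS leq_mul2r le orbT.
elim: (minn _ _) le => // m IH lem.
by rewrite -addn1 iotaD cats1 sz_rcons sz_nat mulnDl; have := IH (ltnW lem); lia.
Qed.

Lemma pf_iota {X} {eX : Enc X} (m n : X -> nat) : pf m -> pf n -> pf (fun x => iota (m x) (n x)).
Proof.
move=> pm pn; apply: (@pf_ext _ _ _ _ _ (fun x => map (addn (m x)) (iota 0 (n x)))).
  by move=> x; rewrite -iotaDl addn0.
apply: pf_map; last exact: pf_iota0.
by apply: pf_addn; try pf; apply: pf_comp; pf.
Qed.

Lemma pf_memn {X} {eX : Enc X} (a : X -> nat) (l : X -> seq nat) : pf a -> pf l -> pf (fun x => a x \in l x).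
Proof.
move=> pa pl; apply: (@pf_ext _ _ _ _ _ (fun x => has (fun b => b == a x) (l x))).
  by move=> x; rewrite -has_pred1.
apply: pf_has => //; apply: pf_eqn; first by pf.
by apply: pf_comp; pf.
Qed.


Lemma pf_uniqn {X} {eX : Enc X} (l : X -> seq nat) : pf l -> pf (fun x => uniq (l x)).
Proof.
move=> pl.
apply: (@pf_ext _ _ _ _ _ (fun x => (foldl (fun s a => (s.1 && (a \notin s.2), a :: s.2)) (true, [::]) (l x)).1)).
  move=> x; rewrite -rev_uniq; suff -> : foldl (fun s a => (s.1 && (a \notin s.2), a :: s.2)) (true, [::]) (l x)
     = (uniq (rev (l x)), rev (l x)) by [].
  elim/last_ind: (l x) => // s a IH; rewrite foldl_rcons IH rev_rcons /=.
  by rewrite andbC.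
apply: pf_fst.
apply: (@pf_foldl_grow _ _ _ _ _ _ _ _ _ _ _ _ _ (fun n => n + 4)) => //; try pf; try pb.
  apply: pf_pair; last by pf.
  by apply: pf_andb; first pf; apply: pf_negb; apply: pf_memn; pf.
by move=> x [b s] a; rewrite !sz_pair sz_cons /=; move: (b && _) => c; pose proof (sz_bool c); pose proof (sz_gt0 b); lia.
Qed.

End Library.

Ltac pf_leaf := solve [auto 2 with pf nocore].

(** The same dispatch with the whole library. Other functions are looked up in the hint base [pf],
    as functions of one argument or curried ones of two. *)
Ltac pf_step :=
  lazymatch goal with
  | H : pf _ ?f |- pf _ ?f => exact H
  | |- pf _ (fun x => x) => refine (pf_id _)
  | |- pf _ (fun _ => ?c) => refine (pf_const _ c)
  | |- pf _ (fun x => (@?a x, @?b x)) => refine (pf_pair (f := a) (g := b) _ _)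
  | |- pf _ (fun x => (@?a x).1) => refine (pf_fst (f := a) _)
  | |- pf _ (fun x => (@?a x).2) => refine (pf_snd (f := a) _)
  | |- pf _ (fun x => match @?b x with true => @?f x | false => @?g x end) =>
      refine (pf_if (b := b) (f := f) (g := g) _ _ _)
  | |- pf _ (fun x => (@?a x).+1) => refine (pf_succ (a := a) _)
  | |- pf _ (fun x => (@?a x).-1) => refine (pf_pred (a := a) _)
  | |- pf _ (fun x => @?a x :: @?l x) => refine (pf_cons (a := a) (l := l) _ _)
  | |- pf _ (fun x => behead (@?l x)) => refine (pf_behead (l := l) _)
  | |- pf _ (fun x => head ?c (@?l x)) => refine (pf_head c (l := l) _)
  | |- pf _ (fun x => nilp (@?l x)) => refine (pf_nilp (l := l) _)
  | |- pf _ (fun x => Some (@?a x)) => refine (pf_some (a := a) _)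
  | |- pf _ (fun x => isSome (@?a x)) => refine (pf_isSome (a := a) _)
  | |- pf _ (fun x => odflt ?c (@?a x)) => refine (pf_odflt c (a := a) _)
  | |- pf _ (fun x => ~~ @?a x) => refine (pf_negb (a := a) _)
  | |- pf _ (fun x => @?a x && @?b x) => refine (pf_andb (a := a) (b := b) _ _)
  | |- pf _ (fun x => @?a x || @?b x) => refine (pf_orb (a := a) (b := b) _ _)
  | |- pf _ (fun x => @?a x ==> @?b x) => refine (pf_implyb (a := a) (b := b) _ _)
  | |- pf _ (fun x => @eq_op _ (@?a x) (@?b x)) =>
      first [refine (pf_eqn (a := a) (b := b) _ _) | refine (pf_eqb (a := a) (b := b) _ _)]
  | |- pf _ (fun x => @?a x (+) @?b x) => refine (pf_addb (a := a) (b := b) _ _)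
  | |- pf _ (fun x => nseq (@?a x) tt) => refine (pf_nseqtt (n := a) _)
  | |- pf _ (fun x => rev (@?l x)) => refine (pf_rev (l := l) _)
  | |- pf _ (fun x => @?a x ++ @?b x) => refine (pf_cat (l := a) (m := b) _ _)
  | |- pf _ (fun x => rcons (@?a x) (@?b x)) => refine (pf_rcons (l := a) (a := b) _ _)
  | |- pf _ (fun x => map (@?f x) (@?l x)) => refine (pf_map (f := f) (l := l) _ _)
  | |- pf _ (fun x => filter (@?f x) (@?l x)) => refine (pf_filter (f := f) (l := l) _ _)
  | |- pf _ (fun x => has (@?f x) (@?l x)) => refine (pf_has (f := f) (l := l) _ _)
  | |- pf _ (fun x => all (@?f x) (@?l x)) => refine (pf_all (f := f) (l := l) _ _)
  | |- pf _ (fun x => size (@?l x)) => refine (pf_size (l := l) _)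
  | |- pf _ (fun x => flatten (@?l x)) => refine (pf_flatten (l := l) _)
  | |- pf _ (fun x => @?a x + @?b x) => refine (pf_addn (a := a) (b := b) _ _)
  | |- pf _ (fun x => @?a x - @?b x) => refine (pf_subn (a := a) (b := b) _ _)
  | |- pf _ (fun x => @?a x * @?b x) => refine (pf_muln (a := a) (b := b) _ _)
  | |- pf _ (fun x => nth ?c (@?a x) (@?b x)) => refine (pf_nth c (l := a) (k := b) _ _)
  | |- pf _ (fun x => @?a x <= @?b x) => refine (pf_leq (a := a) (b := b) _ _)
  | |- pf _ (fun x => iota (@?a x) (@?b x)) => refine (pf_iota (m := a) (n := b) _ _)
  | |- pf _ (fun x => uniq (@?l x)) => refine (pf_uniqn (l := l) _)
  | |- pf _ (fun x => @?a x \in @?l x) => refine (pf_memn (a := a) (l := l) _ _)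
  | |- pf _ (fun x => _) => first
     [ match goal with |- pf _ (fun x => ?h (@?a x)) =>
         refine (pf_comp (g := h) (f := a) _ _); [pf_leaf|] end
     | match goal with |- pf _ (fun x => ?h (@?a x) (@?b x)) =>
         refine (pf_app2 (F := h) (a := a) (b := b) _ _ _); [pf_leaf| |] end
     ]
  | |- pf ?I ?f => change (pf I (fun x => f x))
  end.
Ltac pf := solve [repeat (cbv beta; pf_step)].

(** * Input, output, and membership in P *)

Lemma natrX (a k : nat) : (a ^+ k)%R = a ^ k.
Proof. by elim: k => // k IH; rewrite exprS expnS -IH. Qed.

Lemma pb_poly g : pb g -> exists p : {poly nat}, forall n, g n <= p.[n]%R.
Proof.
case=> d hd; exists (('X + 2%:P) ^+ d)%R => n; rewrite !hornerE natrX.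
by apply: leq_trans (hd n) _; apply: leq_exp2rW; change (n.+2 <= n + 1 + 1); lia.
Qed.

Definition rk {A : finType} (a : A) : nat := enum_rank a.

Lemma rk_lt (A : finType) (a : A) : rk a < #|A|.
Proof. exact: ltn_ord. Qed.

Section InputOutput.
Variable I : finType.
Notation sym := (I + bool)%type.
Notation St := (@St I).
Notation one := (inr true : sym).
Notation zero := (inr false : sym).

Definition is_sym (a : I) (x : option sym) : bool := x == Some (inl a).

(** A branch tests one predicate of the scanned symbol, so a command that depends on the letter
    becomes a chain of tests, one for each letter. *)
Fixpoint dispatch r (s : seq I) (K : I -> cmd I) : cmd I :=
  if s is a :: s' then If r (is_sym a) (K a) (dispatch r s' K) else Skip I.

Lemma exec_dispatch r s K a (s1 s2 : store I) n :
  ohead (get s1 r) = Some (inl a) -> a \in s -> exec (K a) s1 s2 n ->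
  exec (dispatch r s K) s1 s2 (n + size s + 2).
Proof.
move=> top; elim: s => //= b s IH; rewrite inE => /predU1P[<-|ins] e.
  by apply: EWeak; [apply: EIfT e; rewrite /is_sym top | lia].
have [eab|neq] := eqVneq a b.
  by rewrite -eab; apply: EWeak; [apply: EIfT e; rewrite /is_sym top | lia].
apply: EWeak; first apply: EIfF (IH ins e); last lia.
by rewrite /is_sym top; apply: contra_neqN neq => /eqP[].
Qed.

(** The word is first reversed onto [RA], so that it is consumed from its last letter. Pushing the
    leaf of the empty list and then, for each letter, its rank and a node symbol yields the list of
    ranks in prefix order. *)
Definition load : cmd I := Seq
  (While RI (@nonempty I) (dispatch RI (enum I) (fun a => Seq (Push RA (inl a)) (Pop I RI))))
  (Seq (Push RD zero)
  (While RA (@nonempty I) (dispatch RA (enum I) (fun a =>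
     Seq (Pop I RA) (Seq (push_word I (bits (enc (rk a)))) (Push RD one)))))).

Definition nsym : nat := #|I|.

Lemma rk_nsym (a : I) : rk a < nsym.
Proof. exact: rk_lt. Qed.

Lemma size_enum_nsym : size (enum I) = nsym.
Proof. by rewrite -cardE. Qed.

Lemma exec_load w : exec load (St (map inl w) [::] [::] [::] [::] [::])
  (St [::] (ser I (enc (map rk w))) [::] [::] [::] [::]) (size w * (10 * nsym + 30) + 10).
Proof.
have e1 u v : exec (While RI (@nonempty I) (dispatch RI (enum I) (fun a => Seq (Push RA (inl a)) (Pop I RI))))
   (St (map inl u) [::] (map inl v) [::] [::] [::])
   (St [::] [::] (map inl (catrev u v)) [::] [::] [::]) (size u * (nsym + 10) + 1).
  elim: u v => [|a u IH] v; first by apply: EWeak; [exact: EWhileF|].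
  apply: EWeak.
    apply: EWhileT; [by [] | | exact: (IH (a :: v))].
    apply: exec_dispatch; [by [] | by rewrite mem_enum |].
    by apply: ESeq (EPush _ _ _) (EPop _ _).
  by rewrite size_enum_nsym /= [_.+1 * _]mulSn; lia.
have e2 u v : exec (While RA (@nonempty I) (dispatch RA (enum I) (fun a =>
     Seq (Pop I RA) (Seq (push_word I (bits (enc (rk a)))) (Push RD one)))))
   (St [::] (ser I (enc (map rk v))) (map inl u) [::] [::] [::])
   (St [::] (ser I (enc (map rk (catrev u v)))) [::] [::] [::] [::]) (size u * (5 * nsym + 20) + 1).
  elim: u v => [|a u IH] v; first by apply: EWeak; [exact: EWhileF|].
  apply: EWeak.
    apply: EWhileT; [by [] | | exact: (IH (a :: v))].
    apply: exec_dispatch; [by [] | by rewrite mem_enum |].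
    apply: ESeq (EPop _ _) _; apply: ESeq; first exact: exec_push_word.
    by rewrite [map _ (_ :: _)]/= enc_cons ser_nd; apply: EPush.
  have hb : size (bits (enc (rk a))) <= 2 * nsym.
    by rewrite -[size _]/(sz (rk a)) sz_nat; have := rk_nsym a; lia.
  by rewrite size_enum_nsym /= [_.+1 * _]mulSn; lia.
have e3 := e2 (rev w) [::]; rewrite catrevE revK cats0 in e3.
have e4 := e1 w [::]; rewrite catrevE cats0 in e4.
apply: EWeak; first by apply: ESeq e4 _; apply: ESeq (EPush _ _ _) _; exact: e3.
by rewrite size_rev; lia.
Qed.

Lemma sz_ranks (w : seq I) : sz (map rk w) <= size w * (2 * nsym + 2) + 1.
Proof.
by elim: w => // a w IH; rewrite [map _ _]/= sz_cons sz_nat; have := rk_nsym a; rewrite /=; lia.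
Qed.

Section Run.
Variables (P : cmd I) (F : {ffun 'I_6 -> option sym} -> bool).

Definition final (N : nat) : instr I := jump (fun rd => if F rd then N.+1 else N).
Definition prog : seq (instr I) := rcons (code P 0) (final (size (code P 0)).+1).

Lemma run_prog w s' n : exec P (St (map inl w) [::] [::] [::] [::] [::]) s' n ->
  exists m (tp : tapes I), [/\ m <= n.+1, reprs tp s',
    run (machine prog) w m = cfg prog (if F [ffun t => tcur (tp t)] then (size prog).+1 else size prog) tp
    & halted (run (machine prog) w m)].
Proof.
move=> e; pose tp0 : tapes I := ctapes (init_config (machine prog) w).
have r0 : reprs tp0 (St (map inl w) [::] [::] [::] [::] [::]).
  have blank : represents (blank_tape sym) [::] by exists 1.
  rewrite /tp0 /=; case; rewrite ffunE //=.
  by case: w {e tp0} => [|a w] //=; exists 0; rewrite cats0.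
have := code_correct e (K := prog) (pre := [::]) (post := [:: final (size (code P 0)).+1]) _ r0.
case; first by rewrite /prog -cats1.
move=> m [tp [lem em rp]].
have szp : size prog = (size (code P 0)).+1 by rewrite size_rcons.
have st : step (cfg prog (size (code P 0)) tp) =
  cfg prog (if F [ffun t => tcur (tp t)] then (size prog).+1 else size prog) tp.
  rewrite (step_jump tp (f := fun rd => if F rd then (size prog).+1 else size prog)) //; first by rewrite szp.
  by rewrite szp /prog -cats1 nth_mid.
have rn : run (machine prog) w m.+1 = cfg prog (if F [ffun t => tcur (tp t)] then (size prog).+1 else size prog) tp.
  rewrite /run iterS -st; congr step; rewrite -[RHS]em; congr iter.
  by rewrite /cfg /init_config /tp0; congr Config; apply: val_inj; rewrite /= inordK.
exists m.+1, tp; split=> //; rewrite rn /halted /=.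
by case: (F _); rewrite inordK //; lia.
Qed.

End Run.

Definition top_true (rd : {ffun 'I_6 -> option sym}) : bool := isone (rd (tape_of RD)).

Lemma inP_pf (L : language I) (f : seq nat -> bool) :
  pf I f -> (forall w, L w <-> f (map rk w)) -> inP L.
Proof.
case=> P [d HP] HL.
pose g n := (n * (10 * nsym + 30) + 10 + (n * (2 * nsym + 2) + 1).+2 ^ d).+1.
have [p hp] : exists p : {poly nat}, forall n, g n <= p.[n]%R by apply: pb_poly; rewrite /g; pb.
exists (machine (prog (Seq load P) top_true)), p => w.
case: (HP (map rk w)) => e _.
have e1 := e [::] [::] [::]; rewrite !cats0 in e1.
have [m [tp [lem rp rn ha]]] := run_prog top_true (ESeq (exec_load w) e1).
exists m; split=> //.
  apply: leq_trans lem _; apply: leq_trans (hp _); rewrite /g ltnS leq_add2l.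
  by apply: leq_exp2rW; rewrite !ltnS; apply: sz_ranks.
rewrite HL rn /accepting /= /top_true ffunE (represents_top (rp RD)) /=.
case: (f (map rk w)); rewrite /= inordK ?eqxx //.
by split=> // /eqP; lia.
Qed.

(** A unary unit is a node symbol followed by a leaf, hence two pops for each letter of [os] that is
    skipped. *)
Fixpoint decode (os : seq I) : cmd I :=
  if os is a :: os' then
    If RD (@isone I) (Seq (Pop I RD) (Seq (Pop I RD) (decode os')))
                     (Seq (Pop I RD) (Push RA (inl a)))
  else Skip I.

Lemma exec_decode os a0 k i d a b c o : k < size os ->
  exec (decode os) (St i (ser I (enc k) ++ d) a b c o)
    (St i d (inl (nth a0 os k) :: a) b c o) (5 * k + 5).
Proof.
elim: os k => // x os IH [|k] ltk.
  apply: (EWeak (n := 4)) => //; apply: EIfF => //.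
  by apply: ESeq (EPop _ _) _; apply: EPush.
rewrite (_ : enc k.+1 = Nd Lf (enc k)) // ser_nd; apply: EWeak.
  apply: EIfT => //; apply: ESeq (EPop _ _) _; apply: ESeq (EPop _ _) _.
  exact: (IH k).
by lia.
Qed.

Definition print (os : seq I) : cmd I := Seq
  (While RD (@isone I) (Seq (Pop I RD) (decode os)))
  (While RA (@nonempty I)
     (dispatch RA (enum I) (fun a => Seq (Push RO (inl a)) (Pop I RA)))).

Lemma exec_print os a0 l : all (fun k => k < size os) l ->
  exec (print os) (St [::] (ser I (enc l)) [::] [::] [::] [::])
    (St [::] [:: zero] [::] [::] [::] (map inl (map (nth a0 os) l)))
    (size l * (5 * size os + nsym + 30) + 2).
Proof.
have e1 u (v : seq I) : all (fun k => k < size os) u ->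
  exec (While RD (@isone I) (Seq (Pop I RD) (decode os)))
   (St [::] (ser I (enc u)) (map inl v) [::] [::] [::])
   (St [::] [:: zero] (map inl (catrev (map (nth a0 os) u) v)) [::] [::] [::])
     (size u * (5 * size os + 10) + 1).
  elim: u v => [|k u IH] v /=; first by move=> _; apply: EWeak; [exact: EWhileF|].
  case/andP=> ltk lts; rewrite enc_cons ser_nd; apply: EWeak.
    apply: EWhileT; [by [] | | exact: (IH (nth a0 os k :: v))].
    by apply: ESeq (EPop _ _) _; apply: exec_decode.
  by rewrite [_.+1 * _]mulSn; lia.
have e2 u v : exec (While RA (@nonempty I)
     (dispatch RA (enum I) (fun a => Seq (Push RO (inl a)) (Pop I RA))))
   (St [::] [:: zero] (map inl u) [::] [::] (map inl v))
   (St [::] [:: zero] [::] [::] [::] (map inl (catrev u v))) (size u * (nsym + 10) + 1).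
  elim: u v => [|a u IH] v; first by apply: EWeak; [exact: EWhileF|].
  apply: EWeak.
    apply: EWhileT; [by [] | | exact: (IH (a :: v))].
    apply: exec_dispatch; [by [] | by rewrite mem_enum |].
    by apply: ESeq (EPush _ _ _) (EPop _ _).
  by rewrite size_enum_nsym /= [_.+1 * _]mulSn; lia.
move=> lts; have e3 := e1 l [::] lts.
have e4 := e2 (catrev (map (nth a0 os) l) [::]) [::].
rewrite catrevE cats0 in e3 e4; rewrite catrevE revK cats0 size_rev size_map in e4.
apply: EWeak; first exact: ESeq e3 e4.
by nia.
Qed.

Definition no_test (rd : {ffun 'I_6 -> option sym}) : bool := false.

End InputOutput.

Lemma nonblank_prefix_map (S : Type) (s : seq S) m :
  nonblank_prefix (map Some s ++ nseq m None) = s.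
Proof. by elim: s => [|a s IH] /=; [case: m | rewrite IH]. Qed.

Lemma poly_time_pf (A B : finType) (f : seq A -> seq B) (F : seq nat -> seq nat) :
  pf (A + B)%type F ->
  (forall w : seq A, F (map (fun a : A => rk (inl a : A + B)) w) = map rk (f w)) -> poly_time f.
Proof.
case=> P [d HP] HF.
pose os : seq (A + B) := map inr (enum B).
pose N := nsym (A + B)%type.
pose g n := (n * (10 * N + 30) + 10 + ((n * (2 * N + 2) + 1).+2 ^ d +
   ((n * (2 * N + 2) + 1).+2 ^ d * (5 * size os + N + 30) + 2))).+1.
have [p hp] : exists p : {poly nat}, forall n, g n <= p.[n]%R by apply: pb_poly; rewrite /g; pb.
exists (machine (prog (Seq (load _) (Seq P (print os))) (@no_test _))), p => w.
pose v : seq (A + B) := map inl w.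
have HFv : F (map rk v) = map rk (f w) by rewrite -HF /v -map_comp.
case: (HP (map rk v)) => e le; rewrite HFv in e le.
have e1 := e [::] [::] [::]; rewrite !cats0 in e1.
have allos : all (fun k => k < size os) (map rk (f w)).
  by apply/allP=> _ /mapP[b _ ->]; rewrite size_map -cardE rk_lt.
have outE (a0 : A + B) : map (nth a0 os) (map rk (f w)) = map inr (f w).
  rewrite -map_comp; apply: eq_map => b /=.
  rewrite (nth_map b) -?cardE ?rk_lt //.
  by rewrite -[X in nth b X _]/(enum B) (nth_enum_rank b).
have [m [tp [lem rp rn ha]]] : exists m (tp : tapes (A + B)%type), [/\
    m <= (size v * (10 * N + 30) + 10 + ((sz (map rk v)).+2 ^ d +
          (size (map rk (f w)) * (5 * size os + N + 30) + 2))).+1,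
    reprs tp (@St _ [::] [:: inr false] [::] [::] [::] (map inl (map inr (f w)))),
    run (machine (prog (Seq (load _) (Seq P (print os))) (@no_test _))) v m = cfg _ (size (prog (Seq (load _) (Seq P (print os))) (@no_test _))) tp &
    halted (run (machine (prog (Seq (load _) (Seq P (print os))) (@no_test _))) v m)].
  (* [nth] needs a default letter and the alphabets may be empty: the empty output is treated apart,
     and otherwise its first letter is the default. *)
  case: (f w) allos outE e1 => [|b0 t] allos outE e1.
    have ex : exec (print os) (@St _ [::] (ser (A + B)%type (enc (map (@rk B) [::]))) [::] [::] [::] [::])
      (@St _ [::] [:: inr false] [::] [::] [::] [::]) 2.
      by apply: (ESeq (n1 := 1) (n2 := 1)); apply: EWhileF.
    exact: (run_prog (@no_test _) (ESeq (exec_load v) (ESeq e1 ex))).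
  have ex := exec_print (inr b0 : A + B) allos; rewrite outE in ex.
  exact: (run_prog (@no_test _) (ESeq (exec_load v) (ESeq e1 ex))).
exists m => /=; split=> //.
  apply: leq_trans lem _; apply: leq_trans (hp _); rewrite /g ltnS.
  have -> : size v = size w by rewrite size_map.
  have lev : sz (map rk v) <= size w * (2 * N + 2) + 1.
    by have := sz_ranks v; rewrite size_map.
  rewrite leq_add2l leq_add //; first by apply: leq_exp2rW; lia.
  rewrite leq_add2r leq_mul2r; apply/orP; right.
  apply: leq_trans (size_le_sz _) _; apply: leq_trans le _; apply: leq_exp2rW; lia.
rewrite rn /output /=.
have -> : ord_max = tape_of RO by apply: val_inj.
have [k ek] := rp RO; rewrite -[X in X = _]/(nonblank_prefix (tcur (tp (tape_of RO)) :: tright (tp (tape_of RO)))).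
by rewrite ek nonblank_prefix_map /= -map_comp.
Qed.

(** * Words and points *)

(** The second component is the field being read. After the whole word it holds what follows the
    last separator, which [wf] requires to be empty. *)
Definition field_step (s : seq (seq bool) * seq bool) (a : option bool) :=
  if isSome a then (s.1, rcons s.2 (odflt false a)) else (rcons s.1 s.2, [::]).

Definition fields (w : seq (option bool)) : seq (seq bool) * seq bool :=
  foldl field_step ([::], [::]) w.

Lemma fields_word_cat f g : fields_word (f ++ g) = fields_word f ++ fields_word g.
Proof. by rewrite /fields_word map_cat flatten_cat. Qed.

Lemma fieldsE w : w = fields_word (fields w).1 ++ map Some (fields w).2.
Proof.
elim/last_ind: w => // w a {1}->; rewrite /fields foldl_rcons -/(fields w).
case: (fields w) => f r; rewrite /field_step /=; case: a => [b|] /=.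
  by rewrite map_rcons -!cats1 catA.
by rewrite -!cats1 fields_word_cat /fields_word /= !cats0 -cats1 !catA.
Qed.

Lemma fields_wordK f : fields (fields_word f) = (f, [::]).
Proof.
rewrite /fields -[f in RHS]cat0s; elim: f [::] => [|b f IH] g /=; first by rewrite cats0.
rewrite {1}/fields_word /= foldl_cat -/(fields_word f) -cats1 foldl_cat.
have -> : foldl field_step (g, [::]) (map Some b) = (g, b).
  rewrite -[b in RHS]cat0s; elim: b [::] => [|x b IHb] r /=; first by rewrite cats0.
  by rewrite IHb cat_rcons.
by rewrite /= IH cat_rcons.
Qed.

Definition bin (w : seq (option bool)) : seq bool := head [::] (fields w).1.
Definition nof w : nat := bits_val (bin w).
Definition entry (r : seq (seq bool)) (k : nat) := (nth [::] r (2 * k), nth [::] r (2 * k).+1).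
Definition ents w : seq (seq bool * seq bool) :=
  [seq entry (behead (fields w).1) k | k <- iota 0 (nof w ^ 4)].
Definition wf w : bool :=
  [&& nilp (fields w).2, ~~ nilp (fields w).1,
      size (behead (fields w).1) == 2 * nof w ^ 4
    & all (fun e => has id e.2) (ents w)].

Definition bfrac (e : seq bool * seq bool) : rat := ((bits_val e.1)%:R / (bits_val e.2)%:R)%R.

Definition code4 (n : nat) (a b : nat * nat) : nat :=
  (a.1 * n + a.2) * n ^ 2 + (b.1 * n + b.2).

Definition yof w (a b : nat * nat) : rat := bfrac (nth ([::], [::]) (ents w) (code4 (nof w) a b)).

Definition nn n (a : 'I_n * 'I_n) : nat * nat := (a.1 : nat, a.2 : nat).

Lemma bits_val_rcons b x : bits_val (rcons b x) = (bits_val b).*2 + x.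
Proof. by rewrite /bits_val foldl_rcons. Qed.

Lemma bits_val_gt0 b : (0 < bits_val b) = has id b.
Proof.
elim/last_ind: b => // b x IH; rewrite bits_val_rcons has_rcons /= -IH.
by case: x; lia.
Qed.

Lemma nth_allpairs (S T R : Type) (f : S -> T -> R) s t x0 y0 z0 i j :
  i < size s -> j < size t ->
  nth z0 [seq f x y | x <- s, y <- t] (i * size t + j) = f (nth x0 s i) (nth y0 t j).
Proof.
elim: s i => // x s IH [|i] lti ltj /=; rewrite nth_cat size_map.
  by rewrite ltj (nth_map y0).
by rewrite mulSn -addnA ltnNge leq_addr /= addKn IH.
Qed.

Section Flat2.
Variable T : Type.
Definition flat2 (L : seq (T * T)) : seq T := flatten [seq [:: e.1; e.2] | e <- L].

Lemma size_flat2 L : size (flat2 L) = 2 * size L.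
Proof. by elim: L => //= e L IH; rewrite IH; lia. Qed.

Lemma nth_flat2 x0 L k : nth x0 (flat2 L) (2 * k) = (nth (x0, x0) L k).1.
Proof.
elim: L k => [|e L IH] k; first by rewrite /flat2 /= !nth_nil.
case: k => // k; have -> : 2 * k.+1 = (2 * k).+2 by lia.
exact: IH.
Qed.

Lemma nth_flat2S x0 L k : nth x0 (flat2 L) (2 * k).+1 = (nth (x0, x0) L k).2.
Proof.
elim: L k => [|e L IH] k; first by rewrite /flat2 /= !nth_nil.
case: k => // k; have -> : 2 * k.+1 = (2 * k).+2 by lia.
exact: IH.
Qed.
End Flat2.

Lemma entries_flat2 L : [seq entry (flat2 L) k | k <- iota 0 (size L)] = L.
Proof.
apply: (@eq_from_nth _ ([::], [::])) => [|k]; rewrite size_map size_iota // => lt.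
rewrite (nth_map 0) ?size_iota // nth_iota // add0n /entry nth_flat2 nth_flat2S.
by case: (nth _ _ _).
Qed.

Lemma flat2_entries r n : size r = 2 * n -> flat2 [seq entry r k | k <- iota 0 n] = r.
Proof.
elim: n r => [|n IH] r; first by case: r.
case: r => [|a [|b r]] //; try by rewrite /=; lia.
move=> e; have er : size r = 2 * n by move: e; rewrite /=; lia.
have E : [seq entry [:: a, b & r] k | k <- iota 1 n] = [seq entry r k | k <- iota 0 n].
  rewrite (iotaDl 1 0) -map_comp; apply: eq_map => k /=.
  by rewrite /entry; have -> : 2 * (1 + k) = (2 * k).+2 by lia.
by rewrite -[in RHS](IH r er) -E.
Qed.

Lemma size_index_pairs n : size (index_pairs n) = n ^ 2.
Proof. by rewrite size_allpairs size_enum_ord. Qed.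

Lemma nth_index_pairs n x0 (a : 'I_n * 'I_n) : nth x0 (index_pairs n) (a.1 * n + a.2) = a.
Proof.
have := @nth_allpairs _ _ _ (@pair 'I_n 'I_n) (enum 'I_n) (enum 'I_n) a.1 a.2 x0 a.1 a.2.
by rewrite !size_enum_ord !nth_ord_enum -surjective_pairing; apply.
Qed.

Lemma code4_lt n (a b : 'I_n * 'I_n) : a.1 * n + a.2 < n ^ 2 /\
   code4 n (nn a) (nn b) < n ^ 4.
Proof.
have lt (c : 'I_n * 'I_n) : c.1 * n + c.2 < n ^ 2.
  by have := ltn_ord c.1; have := ltn_ord c.2; nia.
split=> //; rewrite /code4 /= -[4]/(2 + 2) expnD.
by have := lt a; have := lt b; nia.
Qed.

Lemma nth_pairs_table n (R : Type) z0 (f : 'I_n * 'I_n -> 'I_n * 'I_n -> R) a b :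
  nth z0 [seq f a b | a <- index_pairs n, b <- index_pairs n]
    (code4 n (nn a) (nn b)) = f a b.
Proof.
have [la _] := code4_lt a b; have [lb _] := code4_lt b a.
rewrite /code4 -{1}(size_index_pairs n) (@nth_allpairs _ _ _ _ _ _ a b) ?size_index_pairs //.
by rewrite !nth_index_pairs.
Qed.

(** Quotients and remainders invert [code4]: every position below [n ^ 4] is the index of some pair
    of index pairs. *)
Lemma eq_pairs_table n (R : Type) z0 (f : 'I_n * 'I_n -> 'I_n * 'I_n -> R) L :
  size L = n ^ 4 ->
  (forall a b, nth z0 L (code4 n (nn a) (nn b)) = f a b) ->
  L = [seq f a b | a <- index_pairs n, b <- index_pairs n].
Proof.
move=> szL H; apply: (@eq_from_nth _ z0).
  by rewrite szL size_allpairs size_index_pairs -expnD.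
rewrite szL => k ltk.
have n0 : 0 < n by case: n ltk {szL H f L} => //.
have l1 : k %/ n ^ 2 < n ^ 2 by rewrite ltn_divLR ?expn_gt0 ?n0 // -expnD.
have l2 : k %% n ^ 2 < n ^ 2 by rewrite ltn_mod expn_gt0 n0.
pose mk u (lt : u < n ^ 2) : 'I_n * 'I_n :=
  (Ordinal (etrans (ltn_divLR _ _ n0) lt), Ordinal (etrans (ltn_mod u n) n0)).
have mkE u lt : (@mk u lt).1 * n + (@mk u lt).2 = u by rewrite /= -divn_eq.
have kE : k = code4 n (nn (mk _ l1)) (nn (mk _ l2)).
  by rewrite /code4 !mkE -divn_eq.
by rewrite kE H nth_pairs_table.
Qed.

(** Decoding is deterministic: the dimension and the point, if any, are the ones read off the word.
    The existential definition of the problem thereby becomes a statement about the word alone. *)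
Lemma encodesP w n (x : point n) : encodes w x <->
  [/\ wf w, nof w = n & forall a b, x a b = yof w (nn a) (nn b)].
Proof.
split.
  case=> bn [num [den [hn hden hx hw]]].
  set fs := flatten _ in hw.
  have fE : fields w = (bn :: fs, [::]) by rewrite hw fields_wordK.
  have nE : nof w = n by rewrite /nof /bin fE.
  pose L := [seq (num a b, den a b) | a <- index_pairs n, b <- index_pairs n].
  have fsE : fs = flat2 L by rewrite /fs /flat2 /L map_allpairs.
  have szL : size L = n ^ 4 by rewrite size_allpairs size_index_pairs -expnD.
  have eE : ents w = L by rewrite /ents fE nE /= fsE -szL entries_flat2.
  split=> //; last by move=> a b; rewrite /yof eE nE nth_pairs_table hx.
  rewrite /wf eE fE /= nE fsE size_flat2 szL eqxx /=.
  by apply/allP => _ /allpairsP[[a b] [_ _ ->]] /=; rewrite -bits_val_gt0.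
case=> /and4P[] /nilP r0 fn0 /eqP szf /allP dok nE hx.
have szE : size (ents w) = n ^ 4 by rewrite size_map size_iota nE.
pose c4 (a b : 'I_n * 'I_n) := code4 n (nn a) (nn b).
pose e a b := nth ([::], [::]) (ents w) (c4 a b).
exists (bin w), (fun a b => (e a b).1), (fun a b => (e a b).2); split=> //.
- move=> a b; rewrite bits_val_gt0; apply: (dok (e a b)); apply: mem_nth.
  by rewrite szE; have [] := code4_lt a b.
- by move=> a b; rewrite hx /yof nE.
have bE : behead (fields w).1 = flatten [seq [:: (e a b).1; (e a b).2] | a <- index_pairs n, b <- index_pairs n].
  rewrite -[LHS](flat2_entries szf) -/(ents w).
  rewrite {1}(eq_pairs_table (z0 := ([::], [::])) (f := e) szE) // /flat2.
  by rewrite map_allpairs.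
rewrite -bE {1}[w]fieldsE r0 cats0 /bin; congr fields_word.
by case: (fields w).1 fn0.
Qed.

(** * The inequalities as conditions on lists of index pairs *)

Fixpoint pairs (T : Type) (l : seq T) : seq (T * T) :=
  if l is a :: l' then [seq (a, b) | b <- l'] ++ pairs l' else [::].

Lemma map_pairs (S T : Type) (f : S -> T) l : pairs (map f l) = [seq (f p.1, f p.2) | p <- pairs l].
Proof. by elim: l => //= a l ->; rewrite map_cat -!map_comp. Qed.

Local Open Scope ring_scope.

Lemma sum_pairs (T : Type) (m : nat) (f : 'I_m -> T) (F : T -> T -> rat) :
  \sum_(r < m) \sum_(s < m | (r < s)%N) F (f r) (f s)
  = \sum_(p <- pairs (map f (enum 'I_m))) F p.1 p.2.
Proof.
elim: m f => [|m IH] f.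
  by rewrite big_ord0 (size0nil (size_enum_ord 0)) big_nil.
rewrite enum_ordSl /= big_cat /= big_map big_ord_recl; congr (_ + _).
  rewrite -map_comp big_map big_enum /= big_mkcond big_ord_recl /= add0r.
  by apply: eq_bigr.
rewrite -map_comp -(IH (f \o lift ord0)); apply: eq_bigr => r _.
by rewrite big_mkcond big_ord_recl /= add0r -big_mkcond.
Qed.

(** The list [sel] merges the two families of indices, and its length is m. Its order matters, since
    the point need not be symmetric. *)
Definition satn (n : nat) (y : nat * nat -> nat * nat -> rat) : Prop :=
  forall sel : seq (nat * nat), (7 <= size sel)%N ->
  all (fun a => (a.1 < n)%N && (a.2 < n)%N) sel -> uniq (unzip1 sel) -> uniq (unzip2 sel) ->
  \sum_(a <- sel) y a a - \sum_(p <- pairs sel) y p.1 p.2 <= 1.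

Lemma satE n (x : point n) y :
  (forall a b, x a b = y (nn a) (nn b)) ->
  satisfies_inequalities x <-> satn n y.
Proof.
move=> xy; split=> [H sel m7 /allP lt u1 u2|H m m7 n7 i j ii ij].
  (* Distinct first coordinates below [n] force [size sel <= n]. *)
  have n7 : (7 <= n)%N.
    apply: leq_trans m7 _; rewrite -(size_map fst) -(size_iota 0 n).
    apply: uniq_leq_size => // _ /mapP[a /lt/andP[la _] ->].
    by rewrite mem_iota.
  case: n x xy H n7 lt => // n x xy H n7 lt.
  have lts (r : 'I_(size sel)) := lt _ (mem_nth (0, 0)%N (ltn_ord r)).
  pose i (r : 'I_(size sel)) : 'I_n.+1 := inord (nth (0, 0)%N sel r).1.
  pose j (r : 'I_(size sel)) : 'I_n.+1 := inord (nth (0, 0)%N sel r).2.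
  have iE r : i r = (nth (0, 0)%N sel r).1 :> nat by rewrite inordK //; case/andP: (lts r).
  have jE r : j r = (nth (0, 0)%N sel r).2 :> nat by rewrite inordK //; case/andP: (lts r).
  have ii : injective i.
    move=> r s /(congr1 val) /=; rewrite !iE -!(nth_map (0, 0)%N 0%N fst) //.
    by move/eqP; rewrite nth_uniq ?size_map // => /eqP/val_inj.
  have ij : injective j.
    move=> r s /(congr1 val) /=; rewrite !jE -!(nth_map (0, 0)%N 0%N snd) //.
    by move/eqP; rewrite nth_uniq ?size_map // => /eqP/val_inj.
  have := H _ m7 n7 i j ii ij.
  have nnE r : nn (i r, j r) = nth (0, 0)%N sel r.
    by rewrite /nn /= iE jE -surjective_pairing.
  have -> : \sum_(a <- sel) y a a = \sum_r x (i r, j r) (i r, j r).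
    by rewrite (big_nth (0, 0)%N) big_mkord; apply: eq_bigr => r _; rewrite xy nnE.
  suff -> : \sum_(p <- pairs sel) y p.1 p.2 =
     \sum_(r < size sel) \sum_(s < size sel | (r < s)%N) x (i r, j r) (i s, j s) by [].
  have -> : pairs sel = pairs (map (fun r => nn (i r, j r)) (enum 'I_(size sel))).
    congr pairs; rewrite -{1}(mkseq_nth (0, 0)%N sel) /mkseq -val_enum_ord -map_comp.
    by apply: eq_map => r; rewrite nnE.
  rewrite -sum_pairs; apply: eq_bigr => r _; apply: eq_bigr => s _.
  by rewrite xy.
pose sel := map (fun r => nn (i r, j r)) (enum 'I_m).
have szs : size sel = m by rewrite size_map size_enum_ord.
have := H sel; rewrite szs => /(_ m7).
have -> : \sum_(a <- sel) y a a = \sum_r x (i r, j r) (i r, j r).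
  by rewrite big_map big_enum; apply: eq_bigr => r _; rewrite xy.
have -> : \sum_(p <- pairs sel) y p.1 p.2 =
     \sum_(r < m) \sum_(s < m | (r < s)%N) x (i r, j r) (i s, j s).
  by rewrite -sum_pairs; apply: eq_bigr => r _; apply: eq_bigr => s _; rewrite xy.
apply.
- by apply/allP=> _ /mapP[r _ ->]; rewrite /nn /= !ltn_ord.
- rewrite /unzip1 -map_comp map_inj_uniq ?enum_uniq // => r s /= /val_inj; exact: ii.
- rewrite /unzip2 -map_comp map_inj_uniq ?enum_uniq // => r s /= /val_inj; exact: ij.
Qed.

Lemma bfrac_ge0 e : 0 <= bfrac e.
Proof. by rewrite divr_ge0 ?ler0n. Qed.

Lemma problemE w : inequalities_problem w <-> wf w /\ satn (nof w) (yof w).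
Proof.
split=> [[n [x [/encodesP[ww nE xE] _ /(satE xE)]]]|[ww H]]; first by rewrite nE.
exists (nof w), (fun a b => yof w (nn a) (nn b)); split=> [|a b|].
- exact/encodesP.
- exact: bfrac_ge0.
- by apply/(satE (y := yof w)).
Qed.

Local Close Scope ring_scope.

(** * Binary arithmetic *)

(* Least significant bit first. *)
Definition lval (l : seq bool) : nat := foldr (fun (b : bool) v => b + 2 * v) 0 l.

Lemma lval_rcons l (b : bool) : lval (rcons l b) = lval l + 2 ^ size l * b.
Proof. by elim: l => [|x l IH] /=; rewrite ?expnS ?IH; lia. Qed.

Lemma lval_rev b : lval (rev b) = bits_val b.
Proof.
elim/last_ind: b => // b x IH; rewrite rev_rcons /= IH bits_val_rcons; lia.
Qed.

Definition pad (k : nat) : seq bool := [seq false | _ <- nseq k tt].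

Lemma size_pad k : size (pad k) = k. Proof. by rewrite size_map size_nseq. Qed.

Lemma lval_pad l k : lval (l ++ pad k) = lval l.
Proof. by elim: l => [|x l IH] /=; [elim: k => //= k ->|rewrite IH]. Qed.

(** A full adder with state (carry, rest of the second summand, output); [head false] extends the
    second summand by zeros. *)
Definition add_step (s : bool * seq bool * seq bool) (x : bool) :=
  ((x && head false s.1.2) || (s.1.1 && (x (+) head false s.1.2)), behead s.1.2,
   rcons s.2 (x (+) head false s.1.2 (+) s.1.1)).

Definition badd (a b : seq bool) : seq bool :=
  let s := foldl add_step (false, b, [::]) (a ++ pad (size b - size a)) in rcons s.2 s.1.1.

Lemma lval_add_step a c b o : size b <= size a ->
  let s := foldl add_step (c, b, o) a in
  lval (rcons s.2 s.1.1) = lval o + 2 ^ size o * (c + lval a + lval b)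
  /\ size s.2 = size o + size a.
Proof.
elim: a c b o => [|x a IH] c b o.
  by case: b => //= _; rewrite lval_rcons addn0 !addn0.
move=> le; have le' : size (behead b) <= size a by case: b le.
have lb : lval b = head false b + 2 * lval (behead b) by case: (b).
have [e1 e2] := IH ((x && head false b) || (c && (x (+) head false b))) (behead b)
   (rcons o (x (+) head false b (+) c)) le'.
split; last by apply: etrans e2 _; rewrite size_rcons /=; lia.
apply: etrans e1 _; rewrite size_rcons lval_rcons expnS lb /=; move: (head false b) => y.
by case: x {le IH e2}; case: y; case: c => /=; nia.
Qed.

Lemma lval_badd a b : lval (badd a b) = lval a + lval b.
Proof.
have le : size b <= size (a ++ pad (size b - size a)) by rewrite size_cat size_pad; lia.
by have [e _] := lval_add_step false [::] le; rewrite /badd e /= lval_pad; lia.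
Qed.

Lemma size_badd a b : size (badd a b) = (maxn (size a) (size b)).+1.
Proof.
have le : size b <= size (a ++ pad (size b - size a)) by rewrite size_cat size_pad; lia.
have [_ e] := lval_add_step false [::] le.
by rewrite /badd size_rcons e /= size_cat size_pad; lia.
Qed.

(** Horner's scheme from the most significant bit of the second factor: double, then add [a] if the
    bit is set. *)
Definition mul_step (a acc : seq bool) (x : bool) :=
  if x then badd (false :: acc) a else false :: acc.

Definition bmul (a b : seq bool) : seq bool := foldl (mul_step a) [::] (rev b).

Lemma lval_bmul a b : lval (bmul a b) = lval a * lval b.
Proof.
rewrite /bmul; elim: b => [|x b IH]; first by rewrite muln0.
rewrite rev_cons foldl_rcons; move: (foldl _ _ _) IH => acc IH.
by rewrite /mul_step; case: x; rewrite ?lval_badd /= IH; lia.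
Qed.

Lemma size_mul_steps a l : size (foldl (mul_step a) [::] l) <= size a + 2 * size l.
Proof.
elim/last_ind: l => // l x IH; rewrite foldl_rcons size_rcons.
move: (foldl _ _ l) IH => acc IH; rewrite /mul_step.
by case: x; rewrite ?size_badd /=; lia.
Qed.

Lemma size_bmul a b : size (bmul a b) <= size a + 2 * size b.
Proof. by apply: leq_trans (size_mul_steps _ _) _; rewrite size_rev. Qed.

(** The scan starts at the least significant bit, so each position where the numbers differ
    overrides the verdict of the lower ones. *)
Definition gt_step (s : bool * seq bool) (x : bool) :=
  (if x == head false s.2 then s.1 else x, behead s.2).

Definition bgt (a b : seq bool) : bool :=
  (foldl gt_step (false, b) (a ++ pad (size b - size a))).1.

Lemma bgtE a b : bgt a b = (lval b < lval a).
Proof.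
have H a' b' (r : bool) : size b' <= size a' -> (foldl gt_step (r, b') a').1 =
   if lval a' == lval b' then r else lval b' < lval a'.
  elim: a' b' r => [|x a' IH] b' r le; first by case: b' le.
  have lb : lval b' = head false b' + 2 * lval (behead b') by case: (b').
  rewrite /= IH; last by case: b' le {lb}.
  rewrite lb; move: (head false b') (behead b') => y b2.
  by case: x {le}; case: y => /=; case: (ltngtP (lval a') (lval b2)) => ?; case: eqP; lia.
rewrite /bgt H; last by rewrite size_cat size_pad; lia.
by rewrite lval_pad; case: ltngtP.
Qed.

Definition sum_step (s e : seq bool * seq bool) :=
  (badd (bmul s.1 e.2) (bmul s.2 e.1), bmul s.2 e.2).

Definition fsum (l : seq (seq bool * seq bool)) := foldl sum_step ([::], [:: true]) l.

(** For sums a/b and c/d, the inequality a/b - c/d > 1 is tested as a d > (c + d) b, free of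
    subtraction and division. *)
Definition gt1 (l m : seq (seq bool * seq bool)) : bool :=
  bgt (bmul (fsum l).1 (fsum m).2) (bmul (badd (fsum m).1 (fsum m).2) (fsum l).2).

Section Fractions.
Local Open Scope ring_scope.

Definition lfrac (e : seq bool * seq bool) : rat := (lval e.1)%:R / (lval e.2)%:R.

Lemma fsumE l : all (fun e => (0 < lval e.2)%N) l ->
  (0 < lval (fsum l).2)%N /\ lfrac (fsum l) = \sum_(e <- l) lfrac e.
Proof.
elim/last_ind: l => [|l e IH]; first by rewrite big_nil /lfrac mul0r.
rewrite all_rcons => /andP[e0 /IH[d0 sE]].
rewrite -cats1 big_cat big_seq1 /= -sE cats1 /fsum foldl_rcons -/(fsum l).
rewrite /lfrac /sum_step /= lval_badd !lval_bmul muln_gt0 d0 e0; split=> //.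
rewrite natrD !natrM; field.
by rewrite !pnatr_eq0 -!lt0n d0 e0.
Qed.

Lemma gt1E l m : all (fun e => (0 < lval e.2)%N) l -> all (fun e => (0 < lval e.2)%N) m ->
  gt1 l m = (1 < \sum_(e <- l) lfrac e - \sum_(e <- m) lfrac e).
Proof.
move=> /fsumE[dl <-] /fsumE[dm <-]; rewrite /gt1 bgtE !lval_bmul lval_badd.
rewrite ltrBrDr /lfrac.
move: dl dm; move: (lval (fsum l).1) (lval (fsum l).2) (lval (fsum m).1) (lval (fsum m).2).
move=> a b c d b0 d0.
have -> : 1 + c%:R / d%:R = (c + d)%:R / d%:R :> rat.
  by rewrite natrD; field; rewrite pnatr_eq0 -lt0n.
rewrite ltr_pdivrMr ?ltr0n // mulrAC ltr_pdivlMr ?ltr0n //.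
by rewrite -!natrM ltr_nat.
Qed.

End Fractions.

Lemma sz_bits (l : seq bool) : sz l <= 4 * size l + 1.
Proof. by elim: l => // b l IH; rewrite sz_cons; pose proof (sz_bool b); rewrite /=; lia. Qed.

Section PolyArith.
Variable I : finType.

Lemma pf_badd : pf I (fun p : seq bool * seq bool => badd p.1 p.2).
Proof.
have pstep : pf I (fun p : (seq bool * seq bool) * (bool * seq bool * seq bool) * bool => add_step p.1.2 p.2).
  rewrite /add_step; pf.
have pfold : pf I (fun p : seq bool * seq bool =>
   foldl add_step (false, p.2, [::]) (p.1 ++ pad (size p.2 - size p.1))).
  apply: (@pf_foldl_grow _ _ _ _ _ _ _ (fun _ => add_step) _ _ pstep _ _ (fun=> 10)).
  - pf.
  - rewrite /pad; pf.
  - pb.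
  move=> x [[c b] o] z; rewrite /add_step !sz_pair sz_rcons /=.
  move: (_ || _) (_ (+) _ (+) _) => u v; pose proof (sz_bool u); pose proof (sz_bool v).
  have : sz (behead b) <= sz b by case: b => // y b; rewrite sz_cons /=; lia.
  pose proof (sz_gt0 c); lia.
rewrite /badd; apply: pf_rcons; [apply: pf_snd | apply: pf_fst; apply: pf_fst]; exact: pfold.
Qed.

Lemma pf_bgt : pf I (fun p : seq bool * seq bool => bgt p.1 p.2).
Proof.
apply: pf_fst.
apply: (@pf_foldl_grow _ _ _ _ _ _ _ (fun _ => gt_step) _ _ _ _ _ (fun=> 10)).
- rewrite /gt_step; pf.
- pf.
- rewrite /pad; pf.
- pb.
move=> x [r b] z; rewrite !sz_pair /gt_step; move: (if _ then _ else _) => u /=.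
pose proof (sz_bool u).
have : sz (behead b) <= sz b by case: b => // y b; rewrite sz_cons /=; lia.
pose proof (sz_gt0 r); lia.
Qed.

Hint Resolve pf_badd pf_bgt : pf.

Lemma pf_bmul : pf I (fun p : seq bool * seq bool => bmul p.1 p.2).
Proof.
apply: (@pf_foldl _ _ _ _ _ _ _ (fun p => mul_step p.1) _ _ _ _ _ (fun n => 12 * n + 1)).
- rewrite /mul_step; pf.
- pf.
- pf.
- pb.
move=> [a b] k /=; apply: leq_trans (sz_bits _) _.
rewrite leq_add2r (_ : 12 = 4 * 3) // -mulnA leq_mul2l; apply: leq_trans (size_mul_steps _ _) _.
have : size (take k (rev b)) <= size b by rewrite size_take_min size_rev; lia.
pose proof (size_le_sz a); pose proof (size_le_sz b); rewrite sz_pair; lia.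
Qed.

Hint Resolve pf_bmul : pf.

(** Fractions are never reduced, but under multiplication the lengths only add up: a product exceeds
    its first factor by at most twice the length of the second, and the encoded size of the new
    summand pays for this. *)
Lemma size_sum_steps l : size (fsum l).1 <= 1 + 2 * sz l /\ size (fsum l).2 <= 1 + 2 * sz l.
Proof.
elim/last_ind: l => // l [p q] [IH1 IH2]; rewrite /fsum foldl_rcons -/(fsum l) /sum_step.
rewrite sz_rcons sz_pair size_badd /=.
pose proof (size_bmul (fsum l).1 q); pose proof (size_bmul (fsum l).2 q).
pose proof (size_bmul (fsum l).2 p).
pose proof (size_le_sz p); pose proof (size_le_sz q); lia.
Qed.

Lemma sz_take {A} {eA : Enc A} (l : seq A) k : sz (take k l) <= sz l.
Proof. by elim: l k => [|a t IH] [|k] //=; rewrite !sz_cons; have := IH k; lia. Qed.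

Lemma pf_fsum : pf I fsum.
Proof.
apply: (@pf_foldl _ _ _ _ _ _ _ (fun _ => sum_step) _ _ _ _ _ (fun n => 16 * n + 20)).
- rewrite /sum_step; pf.
- pf.
- pf.
- pb.
move=> l k; rewrite -/(fsum (take k l)); have [h1 h2] := size_sum_steps (take k l).
case: (fsum _) h1 h2 => [N D] /= h1 h2; rewrite sz_pair.
pose proof (sz_bits N); pose proof (sz_bits D); pose proof (sz_take l k); lia.
Qed.

Hint Resolve pf_fsum : pf.

Lemma pf_gt1 : pf I (fun p : seq (seq bool * seq bool) * seq (seq bool * seq bool) => gt1 p.1 p.2).
Proof. rewrite /gt1; pf. Qed.

End PolyArith.

#[export] Hint Resolve pf_badd pf_bgt pf_bmul pf_fsum pf_gt1 : pf.

(** * The verifier *)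

Definition cap_step (w : seq (option bool)) (a : nat) (x : bool) : nat :=
  let b := a + a + (if x then 1 else 0) in if b <= (size w).+1 then b else (size w).+1.

(* The dimension read from [w], truncated so that its unary form stays short. *)
Definition capn w : nat := foldl (cap_step w) 0 (bin w).

Definition entn n w := [seq entry (behead (fields w).1) k | k <- iota 0 (n * n * (n * n))].

Definition checkwf n w : bool :=
  [&& nilp (fields w).2, ~~ nilp (fields w).1,
      size (behead (fields w).1) == 2 * (n * n * (n * n))
    & all (fun e => has (fun b : bool => b) e.2) (entn n w)].

(** A cell (i, j) is written as i ones, a zero, j ones, a zero. The state holds the finished cells,
    a flag together with i once it is read, and the length of the current run of ones. Every bit
    string decodes to some selection. *)
Definition sel_step (s : (seq (nat * nat) * (bool * nat)) * nat) (b : bool) :=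
  if b then (s.1, s.2.+1)
  else if s.1.2.1 then ((rcons s.1.1 (s.1.2.2, s.2), (false, 0)), 0)
  else ((s.1.1, (true, s.2)), 0).

Definition selof (c : seq bool) : seq (nat * nat) :=
  (foldl sel_step (([::], (false, 0)), 0) c).1.1.

Definition certof (sel : seq (nat * nat)) : seq bool :=
  flatten [seq nseq a.1 true ++ false :: nseq a.2 true ++ [:: false] | a <- sel].

(** The list [pairs l], written with maps, [iota] and folds so that the closure properties of [pf]
    cover it. *)
Definition pairsd (l : seq (nat * nat)) : seq ((nat * nat) * (nat * nat)) :=
  flatten [seq [seq (nth (0, 0) l r, b) | b <- foldl (fun s _ => behead s) l (nseq r.+1 tt)]
          | r <- iota 0 (size l)].

Definition lentry n es (a b : nat * nat) : seq bool * seq bool :=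
  let e := nth ([::], [::]) es ((a.1 * n + a.2) * (n * n) + (b.1 * n + b.2)) in
  (rev e.1, rev e.2).

Definition viol n es (sel : seq (nat * nat)) : bool :=
  [&& 7 <= size sel, all (fun a => (a.1 < n) && (a.2 < n)) sel,
      uniq (map fst sel), uniq (map snd sel)
    & gt1 [seq lentry n es a a | a <- sel] [seq lentry n es p.1 p.2 | p <- pairsd sel]].

Definition check (w : seq (option bool)) (c : seq bool) : bool :=
  ~~ checkwf (capn w) w || viol (capn w) (entn (capn w) w) (selof c).

Section VerifierTime.
Variable I : finType.

Lemma pf_fields : pf I fields.
Proof.
apply: (@pf_foldl_grow _ _ _ _ _ _ _ (fun _ => field_step) _ _ _ _ _ (fun=> 10)).
- rewrite /field_step; pf.
- pf.
- pf.
- pb.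
move=> x [d r] [b|]; rewrite /field_step !sz_pair sz_rcons /=.
  pose proof (sz_bool b); lia.
rewrite sz_nil; lia.
Qed.

Lemma pf_entry : pf I (fun p : seq (seq bool) * nat => entry p.1 p.2).
Proof. rewrite /entry; pf. Qed.

Lemma pf_selof : pf I selof.
Proof.
apply: pf_fst; apply: pf_fst.
apply: (@pf_foldl_grow _ _ _ _ _ _ _ (fun _ => sel_step) _ _ _ _ _ (fun=> 20)).
- rewrite /sel_step; pf.
- pf.
- pf.
- pb.
move=> x [[s [f i]] k] []; rewrite /sel_step; last case: f => /=;
  rewrite ?sz_pair ?sz_rcons ?sz_pair ?sz_nat /=; last by pose proof (sz_bool true); pose proof (sz_gt0 false); lia.
- lia.
- pose proof (sz_bool true); pose proof (sz_bool false); lia.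
Qed.

Lemma pf_pairsd : pf I pairsd.
Proof.
have pd : pf I (fun p : seq (nat * nat) * nat => foldl (fun s _ => behead s) p.1 (nseq p.2.+1 tt)).
  apply: (@pf_foldl_grow _ _ _ _ _ _ _ (fun _ s _ => behead s) _ _ _ _ _ (fun=> 0)).
  - pf.
  - pf.
  - pf.
  - pb.
  by move=> x [|b s] u //=; rewrite sz_cons; lia.
rewrite /pairsd; apply: pf_flatten; apply: pf_map; last by pf.
by apply: pf_map; [pf | exact: pd].
Qed.

Hint Resolve pf_fields pf_entry pf_selof pf_pairsd : pf.

Lemma pf_capn : pf I capn.
Proof.
have pb1 : pf I bin by rewrite /bin; pf.
apply: (@pf_foldl _ _ _ _ _ _ _ cap_step _ _ _ _ _ (fun n => 2 * n + 3)).
- rewrite /cap_step; pf.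
- pf.
- exact: pb1.
- pb.
move=> w k; rewrite sz_nat.
have : foldl (cap_step w) 0 (take k (bin w)) <= (size w).+1.
  elim/last_ind: (take _ _) => // l x _; rewrite foldl_rcons /cap_step.
  by case: ifP.
pose proof (size_le_sz w); lia.
Qed.

Lemma pf_entn : pf I (fun p : nat * seq (option bool) => entn p.1 p.2).
Proof. rewrite /entn; pf. Qed.

Hint Resolve pf_capn pf_entn : pf.

Lemma pf_checkwf : pf I (fun p : nat * seq (option bool) => checkwf p.1 p.2).
Proof. rewrite /checkwf; pf. Qed.

Lemma pf_viol : pf I (fun p : nat * seq (seq bool * seq bool) * seq (nat * nat) => viol p.1.1 p.1.2 p.2).
Proof. rewrite /viol /lentry; pf. Qed.

Hint Resolve pf_checkwf : pf.

Lemma pf_check : pf I (fun p : seq (option bool) * seq bool => check p.1 p.2).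
Proof.
rewrite /check; apply: pf_orb; first by pf.
apply: (@pf_comp _ _ _ _ _ _ _ _
  (fun p : seq (option bool) * seq bool => ((capn p.1, entn (capn p.1) p.1), selof p.2)) pf_viol).
pf.
Qed.
End VerifierTime.

(** * Correctness of the verifier *)

Lemma capnE w : capn w = minn (size w).+1 (nof w).
Proof.
rewrite /capn /nof; elim/last_ind: (bin w) => [|b x IH]; first by rewrite minn0.
rewrite foldl_rcons bits_val_rcons IH /cap_step; move: (bits_val b) => v.
by case: x; case: ifP => /=; lia.
Qed.

Lemma expn4 n : n * n * (n * n) = n ^ 4.
Proof. by rewrite !mulnn -expnM. Qed.

Lemma size_fields w : size (fields w).1 <= size w.
Proof.
rewrite {2}[w]fieldsE size_cat; apply: leq_trans (leq_addr _ _).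
elim: (fields w).1 => //= b f IH; rewrite /fields_word /= size_cat size_rcons.
by rewrite -/(fields_word f); lia.
Qed.

Lemma size_entries w : size (behead (fields w).1) <= size w.
Proof. by rewrite size_behead; have := size_fields w; lia. Qed.

Lemma leq_expn4 n : n <= n ^ 4.
Proof. by case: n => // n; rewrite -{1}(expn1 n.+1) leq_pexp2l. Qed.

(** If the dimension exceeds [size w], both [wf] and the truncated test reject the word, because at
    least that many fields do not fit into it. Otherwise the truncation changes nothing. *)
Lemma checkE w c : check w c = ~~ wf w || viol (nof w) (ents w) (selof c).
Proof.
have [le|lt] := leqP (nof w) (size w).
  have -> : check w c = ~~ checkwf (nof w) w || viol (nof w) (entn (nof w) w) (selof c).
    by rewrite /check capnE (minn_idPr _) //; lia.
  by rewrite /checkwf /entn expn4.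
have hw : wf w = false.
  apply/negP=> /and4P[_ _ /eqP e _].
  by have := size_entries w; have := leq_expn4 (nof w); lia.
rewrite hw /check capnE (minn_idPl _) //.
suff -> : checkwf (size w).+1 w = false by [].
apply/negP=> /and4P[_ _ /eqP e _]; rewrite expn4 in e.
by have := size_entries w; have := leq_expn4 (size w).+1; lia.
Qed.

Lemma pairsdE l : pairsd l = pairs l.
Proof.
rewrite /pairsd; elim: l => //= a l IH; congr (_ ++ _).
rewrite -{}IH (iotaDl 1 0) -map_comp; by congr flatten; apply: eq_map.
Qed.

Lemma code4_lt_nat n (a b : nat * nat) : (a.1 < n) && (a.2 < n) -> (b.1 < n) && (b.2 < n) ->
  code4 n a b < n ^ 4.
Proof.
case: a b => [a1 a2] [b1 b2] /= /andP[h1 h2] /andP[h3 h4].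
exact: (code4_lt (Ordinal h1, Ordinal h2) (Ordinal h3, Ordinal h4)).2.
Qed.

Lemma mem_pairs (T : eqType) (l : seq T) p : p \in pairs l -> (p.1 \in l) && (p.2 \in l).
Proof.
elim: l => //= a l IH; rewrite mem_cat => /orP[/mapP[b bl ->]|/IH/andP[h1 h2]] /=.
  by rewrite !inE eqxx bl orbT.
by rewrite !inE h1 h2 !orbT.
Qed.

Local Open Scope ring_scope.

Lemma violE w sel : wf w -> viol (nof w) (ents w) sel =
  [&& (7 <= size sel)%N, all (fun a => (a.1 < nof w)%N && (a.2 < nof w)%N) sel,
      uniq (unzip1 sel), uniq (unzip2 sel)
    & 1 < \sum_(a <- sel) yof w a a - \sum_(p <- pairs sel) yof w p.1 p.2].
Proof.
case/and4P=> _ _ _ /allP dok; rewrite /viol.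
case: (7 <= size sel)%N => //=; case: allP => //= lts; case: uniq => //=; case: uniq => //=.
have szE : size (ents w) = (nof w ^ 4)%N by rewrite size_map size_iota.
have E a b : lfrac (lentry (nof w) (ents w) a b) = yof w a b.
  by rewrite /lfrac /= !lval_rev.
have ok a b : a \in sel -> b \in sel -> (0 < lval (lentry (nof w) (ents w) a b).2)%N.
  move=> /lts ha /lts hb; rewrite /= lval_rev bits_val_gt0; apply: dok; apply: mem_nth.
  by rewrite szE; apply: code4_lt_nat.
rewrite gt1E.
- by rewrite !big_map pairsdE; congr (_ < _ - _); apply: eq_bigr => a _.
- by rewrite all_map; apply/allP => a ha /=; apply: ok.
- by rewrite all_map pairsdE; apply/allP => p /mem_pairs/andP[h1 h2] /=; apply: ok.
Qed.

(** Classical logic extracts a violated selection from the failure of the universal statement; this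
    is the object that a certificate spells out. *)
Lemma not_problemE w : ~ inequalities_problem w <->
  ~~ wf w \/ exists2 sel, wf w & viol (nof w) (ents w) sel.
Proof.
rewrite problemE; split=> [H|[/negP nw [] //|[sel ww]]].
  case ww: (wf w); last by left.
  right; have : ~ satn (nof w) (yof w) by move=> h; apply: H.
  rewrite /satn => /not_all_ex_not[sel] ns; exists sel => //.
  rewrite violE //; apply: contra_notT ns => nv h1 h2 h3 h4.
  by move: nv; rewrite h1 h2 h3 h4 /= -leNgt.
rewrite violE // => /and5P[h1 h2 h3 h4 h5] [_ /(_ sel h1 h2 h3 h4)].
by rewrite leNgt h5.
Qed.

Local Close Scope ring_scope.

Lemma selof_certof sel : selof (certof sel) = sel.
Proof.
have run_true n s : foldl sel_step s (nseq n true) = (s.1, s.2 + n).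
  by elim: n s => [|n IH] [s k] /=; rewrite ?addn0 ?IH ?addnS ?addSn.
rewrite /selof /certof -[RHS]cat0s; elim: sel [::] => [|[i j] sel IH] l /=; first by rewrite cats0.
rewrite -catA foldl_cat run_true /= -catA foldl_cat run_true /= -cat_rcons.
exact: IH.
Qed.

Lemma size_certof n sel : all (fun a => (a.1 < n) && (a.2 < n)) sel ->
  size (certof sel) <= size sel * (2 * n).
Proof.
elim: sel => //= a sel IH /andP[/andP[h1 h2] /IH]; rewrite /certof /= !size_cat /= !size_cat !size_nseq /=.
lia.
Qed.

(** Mapping a joint word through such a table and flattening extracts one of its two parts, as
    letters of the other kind become empty lists. *)
Definition in_tab : seq (seq (option bool)) :=
  [seq (if s is inl a then [:: a] else [::]) | s <- enum {: option bool + bool}].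
Definition cert_tab : seq (seq bool) :=
  [seq (if s is inr a then [:: a] else [::]) | s <- enum {: option bool + bool}].

Lemma nth_rk (A : finType) (T : Type) x0 (f : A -> T) a : nth x0 (map f (enum A)) (rk a) = f a.
Proof.
by rewrite (nth_map a) ?nth_enum_rank // -cardE rk_lt.
Qed.

Theorem inequalities_in_coNP : in_coNP inequalities_problem.
Proof.
pose wp (z : seq nat) := flatten [seq nth [::] in_tab k | k <- z].
pose cp (z : seq nat) := flatten [seq nth [::] cert_tab k | k <- z].
(* A selection has at most [nof w] cells, each taking at most [2 * nof w] bits, and a well-formed
   word has [nof w <= size w]. *)
have [p hp] : exists p : {poly nat}, forall n, n.+1 * (2 * n.+1) <= p.[n]%R by apply: pb_poly; pb.
exists (fun z => check (wp (map rk z)) (cp (map rk z))), p; split.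
  apply: (@inP_pf _ _ (fun z => check (wp z) (cp z))) => //.
  apply: (@pf_comp _ _ _ _ _ _ _ _ (fun z => (wp z, cp z)) (pf_check _)).
  by rewrite /wp /cp; pf.
have wpE w c : wp (map rk (map inl w ++ map inr c : seq (option bool + bool))) = w.
  rewrite /wp map_cat map_cat flatten_cat -!map_comp.
  rewrite (_ : flatten [seq _ | i <- w] = w); last first.
    by elim: w => //= a w {2}<-; rewrite nth_rk.
  by rewrite (_ : flatten _ = [::]) ?cats0 //; elim: c => //= a c ->; rewrite nth_rk.
have cpE w c : cp (map rk (map inl w ++ map inr c : seq (option bool + bool))) = c.
  rewrite /cp map_cat map_cat flatten_cat -!map_comp.
  rewrite (_ : flatten [seq _ | i <- w] = [::]); last first.
    by elim: w => //= a w ->; rewrite nth_rk.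
  by elim: c => //= a c {2}<-; rewrite nth_rk.
move=> w; rewrite not_problemE; split=> [[nw|[sel ww v]]|[c [_]]].
- by exists [::]; rewrite wpE checkE nw.
- exists (certof sel); rewrite wpE cpE checkE selof_certof v orbT; split=> //.
  apply: leq_trans (hp _).
  move: (v); rewrite violE // => /and5P[_ lts u1 _ _].
  apply: leq_trans (size_certof lts) _.
  have nw : nof w <= size w.
    have /and4P[_ _ /eqP e _] := ww.
    apply: leq_trans (leq_expn4 _) _; apply: leq_trans (size_entries w).
    by rewrite e leq_pmull.
  have : size sel <= nof w.
    rewrite -(size_map fst) -(size_iota 0 (nof w)); apply: uniq_leq_size => // _ /mapP[a ha ->].
    by rewrite mem_iota; have /andP[] := allP lts _ ha.
  by nia.
rewrite wpE cpE checkE => /orP[nw|v]; first by left.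
by case ww: (wf w); [right; exists (selof c) | left].
Qed.

(** * From cliques to points *)

(** Counting up is polynomial because [n] is unary. The result has leading zeros, which the encoding
    allows. *)
Definition lbin (n : nat) : seq bool := foldl (fun s _ => badd s [:: true]) [::] (nseq n tt).
Definition binb (n : nat) : seq bool := rev (lbin n).

Lemma lbinS n : lbin n.+1 = badd (lbin n) [:: true].
Proof. by rewrite /lbin -addn1 nseqD foldl_cat. Qed.

Lemma binbE n : bits_val (binb n) = n.
Proof.
rewrite -lval_rev revK; elim: n => // n IH; rewrite lbinS lval_badd IH /=; lia.
Qed.

Lemma size_lbin n : size (lbin n) <= n.+1.
Proof. by elim: n => // n IH; rewrite lbinS size_badd /=; lia. Qed.

Definition ipn (n : nat) : seq (nat * nat) := [seq (i, j) | i <- iota 0 n, j <- iota 0 n].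

Lemma size_ipn n : size (ipn n) = n ^ 2.
Proof. by rewrite size_allpairs size_iota. Qed.

Lemma nth_ipn n i j : i < n -> j < n -> nth (0, 0) (ipn n) (i * n + j) = (i, j).
Proof.
move=> li lj; have := @nth_allpairs _ _ _ (@pair nat nat) (iota 0 n) (iota 0 n) 0 0 (0, 0) i j.
by rewrite !size_iota !nth_iota // => ->.
Qed.

Section CliqueInstance.
Variables (V : eqType) (eV : Enc V) (v0 : V) (cmp : V -> V -> bool).

Definition cell_entry (bt : seq bool) (vs : seq V) (p q : nat * nat) : seq bool * seq bool :=
  if (p.1 == p.2) && (q.1 == q.2) then
    if p.1 == q.1 then ([:: true], bt)
    else if cmp (nth v0 vs p.1) (nth v0 vs q.1) then ([::], [:: true])
    else ([:: true], [:: true])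
  else ([::], [:: true]).

Definition instance (T : nat) (vs : seq V) : seq (option bool) :=
  fields_word (binb (size vs) :: flat2 [seq cell_entry (binb T) vs p q
     | p <- ipn (size vs), q <- ipn (size vs)]).

Lemma pf_instance (I : finType) : pf I (fun p : V * V => cmp p.1 p.2) ->
  pf I (fun p : nat * seq V => instance p.1 p.2).
Proof.
move=> pc.
have pb1 : pf I binb.
  rewrite /binb; apply: pf_rev.
  apply: (@pf_foldl _ _ _ _ _ _ _ (fun _ s _ => badd s [:: true]) _ _ _ _ _ (fun n => 4 * n + 5)).
  - pf.
  - pf.
  - pf.
  - pb.
  move=> n k; apply: leq_trans (sz_bits _) _.
  have -> : take k (nseq n tt) = nseq (minn k n) tt.
    by elim: k n => [|k IH] [|n] //=; rewrite IH minnSS.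
  by rewrite -/(lbin _) sz_nat; have := size_lbin (minn k n); lia.
have pip : pf I ipn by rewrite /ipn; pf.
have pce : pf I (fun p : (seq bool * seq V) * (nat * nat) * (nat * nat) =>
    cell_entry p.1.1.1 p.1.1.2 p.1.2 p.2).
  rewrite /cell_entry.
  have pcc : pf I (fun p : (seq bool * seq V) * (nat * nat) * (nat * nat) =>
     cmp (nth v0 p.1.1.2 p.1.2.1) (nth v0 p.1.1.2 p.2.1)).
    apply: (@pf_comp _ _ _ _ _ _ _ _ (fun p : (seq bool * seq V) * (nat * nat) * (nat * nat) =>
     (nth v0 p.1.1.2 p.1.2.1, nth v0 p.1.1.2 p.2.1)) pc); pf.
  apply: pf_if; [pf| |pf]; apply: pf_if; [pf|pf|].
  by apply: pf_if; [exact: pcc|pf|pf].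
have pcells : pf I (fun p : nat * seq V => [seq cell_entry (binb p.1) p.2 a b
     | a <- ipn (size p.2), b <- ipn (size p.2)]).
  apply: pf_flatten; apply: pf_map; last first.
    by apply: (@pf_comp _ _ _ _ _ _ _ ipn (fun p : nat * seq V => size p.2) pip); pf.
  apply: pf_map; last first.
    by apply: (@pf_comp _ _ _ _ _ _ _ ipn (fun p : nat * seq V * (nat * nat) => size p.1.2) pip); pf.
  apply: (@pf_comp _ _ _ _ _ _ _ _ (fun p : nat * seq V * (nat * nat) * (nat * nat) =>
     (binb p.1.1.1, p.1.1.2, p.1.2, p.2)) pce).
  apply: pf_pair; last by pf.
  apply: pf_pair; last by pf.
  apply: pf_pair; last by pf.
  by apply: (@pf_comp _ _ _ _ _ _ _ binb (fun p : nat * seq V * (nat * nat) * (nat * nat) => p.1.1.1) pb1); pf.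
rewrite /instance /fields_word /flat2; apply: pf_flatten; apply: pf_map; first by pf.
apply: pf_cons.
  by apply: (@pf_comp _ _ _ _ _ _ _ binb (fun p : nat * seq V => size p.2) pb1); pf.
by apply: pf_flatten; apply: pf_map; [pf | exact: pcells].
Qed.

Section Correct.
Variables (T : nat) (vs : seq V).
Hypotheses (T7 : 7 <= T).
Let n := size vs.
Let w := instance T vs.
Let adj i k := cmp (nth v0 vs i) (nth v0 vs k).

Lemma instance_wf : [/\ wf w, nof w = n & forall p q, (p.1 < n) && (p.2 < n) ->
   (q.1 < n) && (q.2 < n) -> yof w p q = bfrac (cell_entry (binb T) vs p q)].
Proof.
pose L := [seq cell_entry (binb T) vs p q | p <- ipn n, q <- ipn n].
have fE : fields w = (binb n :: flat2 L, [::]) by rewrite fields_wordK.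
have nE : nof w = n by rewrite /nof /bin fE /= binbE.
have szL : size L = n ^ 4 by rewrite size_allpairs size_ipn -expnD.
have eE : ents w = L by rewrite /ents fE nE /= -szL entries_flat2.
split=> //.
  rewrite /wf eE fE /= nE size_flat2 szL eqxx /=.
  apply/allP => _ /allpairsP[[p q] [_ _ ->]]; rewrite -bits_val_gt0 /cell_entry.
  case: ifP => // _; case: ifP => // _; first by rewrite /= binbE; lia.
  by case: ifP.
case=> [p1 p2] [q1 q2] /= /andP[h1 h2] /andP[h3 h4].
rewrite /yof eE nE /code4 /= -(size_ipn n) (@nth_allpairs _ _ _ _ _ _ (0, 0) (0, 0)) ?size_ipn; try nia.
by rewrite !nth_ipn.
Qed.

Local Open Scope ring_scope.

Definition yw (p q : nat * nat) : rat :=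
  if (p.1 == p.2) && (q.1 == q.2) then
    if p.1 == q.1 then 1 / T%:R else if adj p.1 q.1 then 0 else 1
  else 0.

Lemma cell_entryE p q : bfrac (cell_entry (binb T) vs p q) = yw p q.
Proof.
rewrite /cell_entry /yw; case: ifP => _; last by rewrite /bfrac mul0r.
case: ifP => _; first by rewrite /bfrac /= binbE.
by rewrite /adj; case: ifP => _; rewrite /bfrac ?mul0r //= divr1.
Qed.

Lemma yw_ge0 p q : 0 <= yw p q.
Proof. by rewrite /yw; case: ifP => // _; case: ifP => // _; [rewrite divr_ge0 | case: ifP]. Qed.

(** Induction from the end of the list, keeping a clique [C]. A cell off the diagonal contributes at
    most 0. A vertex compatible with all of [C] joins it and adds at most 1/T. Any other vertex
    meets a kept cell with pair entry 1, which outweighs its 1/T. The remaining pair entries are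
    nonnegative, so they only lower the left-hand side. *)
Lemma greedy_clique sel : uniq (unzip1 sel) -> exists C : seq nat,
  [/\ subseq C (unzip1 sel), {in C, forall c, (c, c) \in sel}, pairwise adj C
    & \sum_(a <- sel) yw a a - \sum_(p <- pairs sel) yw p.1 p.2 <= (size C)%:R / T%:R].
Proof.
elim: sel => [|[a1 a2] sel IH] /=; first by move=> _; exists [::]; rewrite !big_nil mul0r subrr; split.
case/andP=> na u; have [C [sC inC pC le]] := IH u.
rewrite big_cons big_cat /= big_map /=.
set S := \sum_(b <- sel) yw b b in le *; set S2 := \sum_(p <- pairs sel) _ in le *.
have S1ge : 0 <= \sum_(b <- sel) yw (a1, a2) b by apply: sumr_ge0 => b _; apply: yw_ge0.
have [e12|ne12] := eqVneq a1 a2; last first.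
  exists C; split=> //.
  - exact: subseq_trans sC (subseq_cons _ _).
  - by move=> c /inC h; rewrite inE h orbT.
  have : yw (a1, a2) (a1, a2) = 0 by rewrite /yw /= (negbTE ne12).
  by move: S1ge le; lra.
have yaa : yw (a1, a2) (a1, a2) = 1 / T%:R by rewrite /yw /= e12 !eqxx.
have [ok|/allPn[c cC nadj]] := boolP (all (adj a1) C).
  exists (a1 :: C); split.
  - by rewrite /= eqxx.
  - move=> c; rewrite inE => /predU1P[->|/inC h]; rewrite inE ?h ?orbT //.
    by rewrite {2}e12 eqxx.
  - by rewrite /= ok.
  - rewrite yaa /= -natr1 mulrDl; move: S1ge le; lra.
exists C; split=> //.
- exact: subseq_trans sC (subseq_cons _ _).
- by move=> x /inC h; rewrite inE h orbT.
have cs := inC c cC.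
have ne : a1 != c by apply: contra na => /eqP->; apply: (mem_subseq sC).
have : 1 <= \sum_(b <- sel) yw (a1, a2) b.
  rewrite (big_rem _ cs) /= {1}/yw /= e12 -e12 !eqxx (negbTE ne) (negbTE nadj) /=.
  by rewrite lerDl; apply: sumr_ge0 => b _; apply: yw_ge0.
have : 1 / T%:R <= 1 :> rat.
  rewrite ler_pdivrMr ?ltr0n; last by lia.
  by rewrite mul1r ler1n; lia.
by rewrite yaa; move: le; lra.
Qed.

Lemma satn_instance : irreflexive cmp ->
  (satn (nof w) (yof w) <-> ~ exists C : seq V, [/\ {subset C <= vs}, pairwise cmp C & (T < size C)%N]).
Proof.
move=> irr; have [ww nE yE] := instance_wf; rewrite nE.
have T0 : 0 < T%:R :> rat by rewrite ltr0n; lia.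
have sumE sel : all (fun a => (a.1 < n)%N && (a.2 < n)%N) sel ->
   \sum_(a <- sel) yof w a a - \sum_(p <- pairs sel) yof w p.1 p.2
   = \sum_(a <- sel) yw a a - \sum_(p <- pairs sel) yw p.1 p.2.
  move/allP=> lts; congr (_ - _).
    by apply: eq_big_seq => a /lts h; rewrite yE // cell_entryE.
  by apply: eq_big_seq => p /mem_pairs/andP[/lts h1 /lts h2]; rewrite yE // cell_entryE.
split=> [H [C [sC pC szC]]|H sel m7 lts u1 u2].
  pose D := map (index^~ vs) C.
  have pD : pairwise adj D.
    rewrite pairwise_map; apply: (@sub_in_pairwise _ (mem vs) cmp _ _ _ _ pC).
      by move=> x y xv yv h; rewrite /relpre /= /adj !nth_index.
    by apply/allP.
  (* Irreflexivity turns compatibility into distinctness of the indices, even if [vs] has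
     repetitions. *)
  have uD : uniq D.
    by apply: (pairwise_uniq _ pD) => i; rewrite /adj irr.
  have ltD : all (fun a => (a.1 < n)%N && (a.2 < n)%N) [seq (i, i) | i <- D].
    rewrite all_map; apply/allP => _ /mapP[v vC ->] /=.
    by rewrite index_mem (sC _ vC).
  have szD : size D = size C by rewrite size_map.
  have := H [seq (i, i) | i <- D]; rewrite size_map szD => /(_ _ ltD) Hs.
  (* The clique has more than T >= 7 vertices, so its length is admissible for m. *)
  have {Hs} := Hs (leq_trans T7 (ltnW szC)).
  have e1 (l : seq nat) : unzip1 [seq (i, i) | i <- l] = l by elim: l => //= i l ->.
  have e2 (l : seq nat) : unzip2 [seq (i, i) | i <- l] = l by elim: l => //= i l ->.
  rewrite e1 e2 => /(_ uD uD).
  rewrite sumE // big_map (eq_bigr (fun=> 1 / T%:R)); last first.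
    by move=> i _; rewrite /yw /= !eqxx.
  rewrite (_ : \sum_(p <- pairs _) _ = 0) ?subr0.
    rewrite big_const_seq count_predT iter_addr_0 -[_ *+ size _]mulr_natl szD.
    by rewrite mulrA mulr1 ler_pdivrMr // mul1r ler_nat leqNgt szC.
  rewrite map_pairs big_map; move: pD uD; elim: (D) => [|d l IH] /=; first by rewrite big_nil.
  case/andP=> al pl /andP[nd ul]; rewrite big_cat /= IH // addr0 big_map /=.
  rewrite big_seq big1 // => b bl; rewrite /yw /= !eqxx /=.
  by rewrite eq_sym (negbTE (memPn nd _ bl)) (allP al _ bl).
rewrite sumE // leNgt; apply/negP => v1; apply: H.
have [C [sC inC pC le]] := greedy_clique u1.
exists (map (nth v0 vs) C); split.
- move=> _ /mapP[c /inC h ->]; apply: mem_nth.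
  by have /andP[] := allP lts _ h.
- by rewrite pairwise_map.
- rewrite size_map -(ltr_nat rat) -[X in X < _]mul1r -ltr_pdivlMr //.
  exact: lt_le_trans v1 le.
Qed.

End Correct.
End CliqueInstance.

(** * Views of a run *)

Definition mvh (d : direction) (h : nat) : nat :=
  match d with MoveLeft => h.-1 | Stay => h | MoveRight => h.+1 end.

Section Cells.
Variable S : Type.

(* The content of absolute position [z] when the head stands at [h]. *)
Definition cell (t : tape S) (h z : nat) : option S :=
  if h <= z then nth None (tcur t :: tright t) (z - h) else nth None (tleft t) (h - z).-1.

Lemma cell_cur t h : cell t h h = tcur t.
Proof. by rewrite /cell leqnn subnn. Qed.

Lemma cell_write a t h z : cell (tape_write a t) h z = if z == h then a else cell t h z.
Proof.
rewrite /cell /=; case: ltngtP => [lt|//|->]; last by rewrite subnn.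
by rewrite -(subnSK lt).
Qed.

Lemma nth_head_behead (s : seq (option S)) i : nth None (head None s :: behead s) i = nth None s i.
Proof. by case: s i => [|a s] [|i] //=; rewrite !nth_nil. Qed.

Lemma cell_move d t h z : 0 < h -> cell (tape_move d t) (mvh d h) z = cell t h z.
Proof.
case: h => // h _; case: d => //=; rewrite /cell /=.
- case: (ltngtP h z) => [lt|lt|->].
  + by rewrite -(subnSK lt).
  + by rewrite nth_behead; congr nth; lia.
  + by rewrite subnn subSnn /= nth0.
- case: (ltngtP h.+1 z) => [lt|lt|<-].
  + by rewrite nth_head_behead -(subnSK lt).
  + by rewrite (_ : (h.+2 - z).-1 = (h.+1 - z).-1.+1) //; lia.
  + by rewrite subnn subSnn.
Qed.

End Cells.

Section RunViews.
Variables (J : finType) (M : TM J) (u : seq J) (T : nat).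
Notation k := (tm_k M).
Notation sym := (tm_symbol M).

Definition view : Type := (tm_state M * {ffun 'I_k.+1 -> option sym})%type.

(** A halted machine idles and rewrites what it scans, so every time up to T has a step. *)
Definition estep (g : view) : tm_state M * {ffun 'I_k.+1 -> option sym * direction} :=
  if tm_halt g.1 then (g.1, [ffun a => (g.2 a, Stay)]) else tm_trans g.1 g.2.

Definition view_at t : view :=
  (cstate (run M u t), [ffun a => tcur (ctapes (run M u t) a)]).

(** Heads start at absolute position [T]. Within [T] steps they stay between 0 and 2T, so natural
    numbers suffice and the predecessor in [mvh] never truncates. *)
Fixpoint hd (a : 'I_k.+1) (t : nat) : nat :=
  if t is t'.+1 then mvh ((estep (view_at t')).2 a).2 (hd a t') else T.

Definition written a t : option sym := ((estep (view_at t)).2 a).1.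

Lemma runS t : cstate (run M u t.+1) = (estep (view_at t)).1 /\
  forall a, ctapes (run M u t.+1) a =
    tape_move ((estep (view_at t)).2 a).2 (tape_write (written a t) (ctapes (run M u t) a)).
Proof.
rewrite /written /run iterS -/(run M u t) /step /estep /= /halted.
case: ifP => h; last by case: (tm_trans _ _) => q act; split=> // a; rewrite ffunE.
by split=> // a; rewrite !ffunE /=; case: (ctapes _ _).
Qed.

Lemma hd_bounds a t : t <= T -> T - t <= hd a t <= T + t.
Proof.
elim: t => [|t IH] lt /=; first by rewrite subn0 addn0 !leqnn.
by have := IH (ltnW lt); case: (_.2) => /=; lia.
Qed.

Definition content a t z := cell (ctapes (run M u t) a) (hd a t) z.

Lemma contentS a t z : t < T ->
  content a t.+1 z = if z == hd a t then written a t else content a t z.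
Proof.
move=> lt; rewrite /content /= (runS t).2 cell_move ?cell_write //.
by have := hd_bounds a (ltnW lt); lia.
Qed.

Lemma read_content a t : (view_at t).2 a = content a t (hd a t).
Proof. by rewrite /content cell_cur ffunE. Qed.

Fixpoint lastv a t p : nat :=
  if t is t'.+1 then if hd a t' == p then t'.+1 else lastv a t' p else 0.

(** Only scanned cells change. Hence a last-visit time gives access to the content of a cell without
    recording the tape. *)
Lemma content_last a t p : t <= T ->
  content a t p = if lastv a t p is s.+1 then written a s else content a 0 p.
Proof.
elim: t => // t IH lt; rewrite contentS // IH 1?ltnW //= eq_sym.
by case: eqP.
Qed.

Lemma lastv_le a t p : lastv a t p <= t.
Proof. by elim: t => //= t IH; case: eqP => // _; apply: leqW. Qed.

Lemma lastv_visit a t p s : lastv a t p = s.+1 -> hd a s = p.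
Proof. by elim: t => //= t IH; case: eqP => // <- [<-]. Qed.

Lemma lastv_after a t p s : lastv a t p <= s -> s < t -> hd a s != p.
Proof.
elim: t => //= t IH; case: eqP => [_|ne]; first by lia.
move=> le; rewrite ltnS leq_eqVlt => /predU1P[->|]; first exact/eqP.
exact: IH.
Qed.

(** Each hypothesis speaks about a single earlier time [s], so it can be guaranteed by comparing two
    vertices. *)
Lemma lastv_unique a t p l : l <= t ->
  (forall s, s < t -> l = s.+1 -> hd a s = p) ->
  (forall s, s < t -> l <= s -> hd a s != p) -> lastv a t p = l.
Proof.
elim: t => [|t IH] le h1 h2; first by move: le; rewrite leqn0 => /eqP.
rewrite /=; move: le; rewrite leq_eqVlt => /predU1P[e|lt].
  by rewrite (h1 t) ?eqxx.
rewrite (negbTE (h2 t _ _)) //; apply: IH => // s ls e.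
  by apply: h1 e; apply: ltnW.
by apply: h2 e; apply: ltnW.
Qed.

Lemma content0 a z : content a 0 z =
  if a == ord0 then if z < T then None else nth None (map (fun x => Some (inl x)) u) (z - T)
  else None.
Proof.
rewrite /content /cell /= ffunE; case: eqP => _ /=; last first.
  by case: ifP => _; [case: (z - T) => // m; rewrite /= nth_nil | rewrite nth_nil].
rewrite leqNgt; case: ltnP => _ /=; first by case: (u) => [|x v] /=; rewrite nth_nil.
case: (u) => [|x v] /=; first by case: (z - T) => // m; rewrite /= nth_nil.
by rewrite -map_comp.
Qed.

Lemma run_halted t t' : halted (run M u t) -> t <= t' -> run M u t' = run M u t.
Proof.
move=> h; elim: t' => [|t' IH]; first by case: t h.
rewrite leq_eqVlt => /predU1P[->//|lt].
by rewrite /run iterS -/(run M u t') IH // /step h.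
Qed.

End RunViews.

(** * The tableau as a clique problem *)

Lemma rk_inj (B : finType) : injective (@rk B).
Proof. by move=> x y /val_inj/enum_rank_inj. Qed.

Lemma rk_surj (B : finType) m : m < #|B| -> exists b : B, m = rk b.
Proof. by move=> lt; exists (enum_val (Ordinal lt)); rewrite /rk enum_valK. Qed.

Lemma nth_map_ord (R : Type) n x0 (f : 'I_n -> R) (a : 'I_n) : nth x0 (map f (enum 'I_n)) a = f a.
Proof. by rewrite (nth_map a) ?size_enum_ord // nth_ord_enum. Qed.

Lemma all_iotaP n (f : pred nat) : reflect (forall a : 'I_n, f a) (all f (iota 0 n)).
Proof.
apply: (iffP allP) => [h a|h m]; first by apply: h; rewrite mem_iota ltn_ord.
by rewrite mem_iota => lt; apply: (h (Ordinal lt)).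
Qed.

Lemma pairwise_mem (T : eqType) (r : rel T) C x y :
  pairwise r C -> x \in C -> y \in C -> x != y -> r x y || r y x.
Proof.
elim: C => //= z C IH /andP[/allP al pC]; rewrite !inE.
case/predU1P=> [->|xC] /predU1P[->|yC] ne.
- by rewrite eqxx in ne.
- by rewrite al.
- by rewrite al ?orbT.
- exact: IH.
Qed.

Definition dcode (d : direction) : nat :=
  match d with MoveLeft => 0 | Stay => 1 | MoveRight => 2 end.

Definition mvn (d p : nat) : nat := if d == 0 then p.-1 else if d == 1 then p else p.+1.

Lemma mvnE d p : mvn (dcode d) p = mvh d p.
Proof. by case: d. Qed.

(* Time, state with scanned symbols, certificate length, and for each tape the
   head position and one plus the time of the last earlier visit of it, or 0. *)
Notation vertex := ((nat * nat) * (nat * seq (nat * nat)))%type.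

Section Tableau.
Variables (A : finType) (M : TM (A + bool)%type).
Notation k := (tm_k M).
Notation sym := ((A + bool) + tm_work M)%type.
Notation G := (tm_state M * {ffun 'I_k.+1 -> option sym})%type.

(** The machine enters the reduction only through constant tables indexed by the ranks of views, so
    its transition function becomes a lookup. *)
Definition tST : seq nat := [seq rk g.1 | g : G <- enum {: G}].
Definition tNX : seq nat := [seq rk (@estep _ M g).1 | g : G <- enum {: G}].
Definition tACC : seq bool := [seq tm_accept g.1 | g : G <- enum {: G}].
Definition tRD : seq (seq nat) :=
  [seq [seq rk (g.2 a : option sym) | a <- enum 'I_k.+1] | g : G <- enum {: G}].
Definition tWR : seq (seq nat) :=
  [seq [seq rk (((@estep _ M g).2 a).1 : option sym) | a <- enum 'I_k.+1] | g : G <- enum {: G}].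
Definition tMV : seq (seq nat) :=
  [seq [seq dcode ((@estep _ M g).2 a).2 | a <- enum 'I_k.+1] | g : G <- enum {: G}].

Definition blank : nat := rk (None : option sym).
Definition bitc (b : bool) : nat := rk (Some (inl (inr b)) : option sym).
Definition symc (a : A) : nat := rk (Some (inl (inl a)) : option sym).

Definition vt (v : vertex) := v.1.1.
Definition vg (v : vertex) := v.1.2.
Definition vL (v : vertex) := v.2.1.
Definition vp (v : vertex) a := (nth (0, 0) v.2.2 a).1.
Definition vl (v : vertex) a := (nth (0, 0) v.2.2 a).2.

Definition rd g a := nth 0 (nth [::] tRD g) a.
Definition wr g a := nth 0 (nth [::] tWR g) a.
Definition mv g a := nth 0 (nth [::] tMV g) a.

(** The symbols that a cell may show at its first visit: the input from position [T] on, then [L]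
    arbitrary bits for the certificate, blanks elsewhere. *)
Definition okinit (T : nat) (ws : seq nat) (L a p r : nat) : bool :=
  if (a == 0) && (T <= p) then
    if p - T < size ws then r == nth 0 ws (p - T)
    else if p - T < size ws + L then (r == bitc false) || (r == bitc true)
    else r == blank
  else r == blank.

Definition okv (T : nat) (ws : seq nat) (v : vertex) : bool :=
  [&& (vt v == 0) ==> ((nth 0 tST (vg v) == rk (tm_start M)) &&
                       all (fun a => vp v a == T) (iota 0 k.+1)),
      (vt v == T) ==> nth false tACC (vg v)
    & all (fun a => (vl v a <= vt v) &&
        ((vl v a == 0) ==> okinit T ws (vL v) a (vp v a) (rd (vg v) a))) (iota 0 k.+1)].

(** [v] is the earlier step. As [vl] is a time plus one, equality with [(vt v).+1] declares [v] the
    last visit: same cell, and the symbol read is the one written there. The case [vl v' a <= vt v]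
    places the last visit strictly before [v], which must then scan another cell. *)
Definition Rv (v v' : vertex) : bool :=
  [&& vL v == vL v',
      (vt v' == (vt v).+1) ==> ((nth 0 tST (vg v') == nth 0 tNX (vg v)) &&
         all (fun a => vp v' a == mvn (mv (vg v) a) (vp v a)) (iota 0 k.+1))
    & all (fun a => if vl v' a == (vt v).+1
                    then (vp v a == vp v' a) && (rd (vg v') a == wr (vg v) a)
                    else (vl v' a <= vt v) ==> (vp v a != vp v' a)) (iota 0 k.+1)].

Definition cmpv (v v' : vertex) : bool :=
  if vt v < vt v' then Rv v v' else (vt v' < vt v) && Rv v' v.

Lemma cmpv_irr : irreflexive cmpv.
Proof. by move=> v; rewrite /cmpv ltnn. Qed.

Definition cands (T : nat) : seq (nat * nat) :=
  [seq (p, l) | p <- iota 0 (T + T).+1, l <- iota 0 T.+1].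

(** The length is exponential in [n] only, and [n] will be the number of tapes, a constant of the
    machine. *)
Fixpoint tapsl (n T : nat) : seq (seq (nat * nat)) :=
  if n is n'.+1 then [seq c :: l | c <- cands T, l <- tapsl n' T] else [:: [::]].

Definition nviews : nat := #|{: G}|.

Definition allv (T P : nat) : seq vertex :=
  [seq (tg, Ltp) | tg <- [seq (t, g) | t <- iota 0 T.+1, g <- iota 0 nviews],
                   Ltp <- [seq (L, tp) | L <- iota 0 P.+1, tp <- tapsl k.+1 T]].

Definition vsof T P ws := [seq v <- allv T P | okv T ws v].

Lemma mem_tapsl n T (l : seq (nat * nat)) : size l = n ->
  all (fun c => (c.1 <= T + T) && (c.2 <= T)) l -> l \in tapsl n T.
Proof.
move=> <- {n}; elim: l => [|[p q] l IH] //; rewrite [all _ _]/= => /andP[/andP[h1 h2] /IH hl].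
apply/allpairsP; exists ((p, q), l); split=> //.
by apply/allpairsP; exists (p, q); split; rewrite ?mem_iota.
Qed.

Lemma mem_allv T P v : v \in allv T P -> [/\ vt v <= T, vg v < nviews & vL v <= P].
Proof.
case/allpairsP=> -[x y] [/allpairsP[[t g] [h1 h2 ex]] /allpairsP[[L tp] [h3 _ ey]] ->].
rewrite [LHS]/= in ex; rewrite [LHS]/= in ey; rewrite ex ey.
by move: h1 h2 h3; rewrite !mem_iota.
Qed.

Section Correct.
Variables (w : seq A) (T P : nat).
Let ws := map symc w.
Let u (c : seq bool) : seq (A + bool) := map inl w ++ map inr c.

Lemma tabE (R : Type) x0 (f : G -> R) (g : G) : nth x0 [seq f g | g : G <- enum {: G}] (rk g) = f g.
Proof. exact: nth_rk. Qed.

Lemma rdE (g : G) (a : 'I_k.+1) : rd (rk g) a = rk (g.2 a : option sym).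
Proof. by rewrite /rd tabE nth_map_ord. Qed.

Lemma wrE (g : G) (a : 'I_k.+1) : wr (rk g) a = rk (((@estep _ M g).2 a).1 : option sym).
Proof. by rewrite /wr tabE nth_map_ord. Qed.

Lemma mvE (g : G) (a : 'I_k.+1) : mv (rk g) a = dcode ((@estep _ M g).2 a).2.
Proof. by rewrite /mv tabE nth_map_ord. Qed.

Lemma okinit_content c (a : 'I_k.+1) p :
  okinit T ws (size c) a p (rk (content (u c) T a 0 p : option sym)).
Proof.
rewrite content0 /okinit -[a == ord0]/(val a == 0).
case: eqP => [_|_] //=; case: (leqP T p) => [le|lt] //=.
rewrite /u map_cat -!map_comp /ws size_map.
case: (ltnP (p - T) (size w)) => h1.
  rewrite nth_cat size_map h1.
  by case: w h1 => // a0 w' h1; rewrite !(nth_map a0).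
rewrite nth_cat size_map [p - T < size w]ltnNge h1 /=; case: (ltnP (p - T) _) => h2.
  rewrite (nth_map false) /=; last by lia.
  by case: (nth _ _ _); rewrite eqxx ?orbT.
by rewrite nth_default // size_map; lia.
Qed.

Definition vert c t : vertex :=
  ((t, rk (view_at M (u c) t : G)),
   (size c, [seq (hd (u c) T a t, lastv (u c) T a t (hd (u c) T a t)) | a <- enum 'I_k.+1])).

Lemma vert_p c t (a : 'I_k.+1) : vp (vert c t) a = hd (u c) T a t.
Proof. by rewrite /vp /= nth_map_ord. Qed.

Lemma vert_l c t (a : 'I_k.+1) : vl (vert c t) a = lastv (u c) T a t (hd (u c) T a t).
Proof. by rewrite /vl /= nth_map_ord. Qed.

Lemma vert_mem c t : size c <= P -> t <= T ->
  tm_accept (cstate (run M (u c) T)) -> vert c t \in vsof T P ws.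
Proof.
move=> leP leT acc; rewrite mem_filter; apply/andP; split.
  rewrite /okv -[vt _]/t -[vg _]/(rk (view_at M (u c) t : G)) -[vL _]/(size c).
  apply/and3P; split.
  - apply/implyP=> /eqP t0; apply/andP; split; first by rewrite tabE t0.
    by apply/all_iotaP => a; rewrite vert_p t0.
  - by apply/implyP=> /eqP ->; rewrite tabE.
  - apply/all_iotaP => a; rewrite vert_l vert_p lastv_le /=; apply/implyP => /eqP l0.
    rewrite rdE (read_content (u c) T) content_last // l0; exact: okinit_content.
apply/allpairsP; exists ((vert c t).1, (vert c t).2); split; last by [].
  apply/allpairsP; exists (vert c t).1; split; last by [].
    by rewrite mem_iota; exact: leT.
  by rewrite mem_iota; exact: rk_lt.
apply/allpairsP; exists (vert c t).2; split; last by [].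
  by rewrite mem_iota; exact: leP.
apply: mem_tapsl; first by rewrite size_map size_enum_ord.
apply/allP => _ /mapP[a _ ->] /=.
have := hd_bounds (u c) a leT; have := lastv_le (u c) T a t (hd (u c) T a t); lia.
Qed.

Lemma vert_R c t t' : t < t' -> t' <= T -> Rv (vert c t) (vert c t').
Proof.
move=> lt leT; have vgE s : vg (vert c s) = rk (view_at M (u c) s : G) by [].
rewrite /Rv; apply/and3P; split; first exact: eqxx.
  apply/implyP=> /eqP et; have {et} -> : t' = t.+1 := et.
  apply/andP; split.
    by rewrite !vgE !tabE; apply/eqP; congr rk; exact: (runS M (u c) t).1.
  by apply/all_iotaP => a; rewrite !vert_p vgE mvE mvnE.
apply/all_iotaP => a; rewrite !vert_p vert_l !vgE; case: eqP => [e|ne].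
  rewrite -(lastv_visit e) rdE wrE (read_content (u c) T) content_last // e.
  by rewrite !eqxx.
by apply/implyP => le; exact: (lastv_after le lt).
Qed.

Lemma tableau_complete c : size c <= P -> tm_accept (cstate (run M (u c) T)) ->
  exists C : seq vertex, [/\ {subset C <= vsof T P ws}, pairwise cmpv C & T < size C].
Proof.
move=> leP acc; exists [seq vert c t | t <- iota 0 T.+1]; split.
- by move=> _ /mapP[t ht ->]; apply: vert_mem => //; move: ht; rewrite mem_iota.
- rewrite pairwise_map.
  have : sorted ltn (iota 0 T.+1) by exact: iota_ltn_sorted.
  rewrite sorted_pairwise; last exact: ltn_trans.
  apply: (@sub_in_pairwise _ (mem (iota 0 T.+1)) ltn); last exact/allP.
  move=> s t; rewrite !mem_iota /= => hs ht lt; rewrite /relpre /= /cmpv.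
  by rewrite -[vt _]/s -[vt (vert c t)]/t lt; apply: vert_R.
- by rewrite size_map size_iota.
Qed.

(** The hypothesis concerns the certificate cells, the only ones whose symbol [okinit] leaves
    open. *)
Lemma okinit_sound c (a : 'I_k.+1) p r :
  (a = 0 :> nat -> T + size w <= p -> p < T + size w + size c ->
     r == bitc false \/ r == bitc true -> r = bitc (nth false c (p - T - size w))) ->
  okinit T ws (size c) a p r -> r = rk (content (u c) T a 0 p : option sym).
Proof.
move=> H; rewrite content0 /okinit -[a == ord0]/(val a == 0).
case: eqP => [a0|_] /=; last by move/eqP.
case: (leqP T p) => [le|lt] /=; last by move/eqP.
rewrite /u map_cat -!map_comp /ws size_map nth_cat size_map.
case: (ltnP (p - T) (size w)) => h1.
  by case: w h1 => // a1 w' h1; rewrite !(nth_map a1) // => /eqP.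
case: (ltnP (p - T) _) => h2.
  move/orP=> hr; rewrite (nth_map false); last by lia.
  by apply: H => //; lia.
by rewrite nth_default; [move/eqP | rewrite size_map; lia].
Qed.

Lemma tableau_sound (C : seq vertex) :
  {subset C <= vsof T P ws} -> pairwise cmpv C -> T < size C ->
  exists2 c, size c <= P & tm_accept (cstate (run M (u c) T)).
Proof.
move=> sC pC szC.
have Cok v : v \in C -> [/\ okv T ws v, vt v <= T, vg v < nviews & vL v <= P].
  by move/sC; rewrite mem_filter => /andP[h /mem_allv[]].
have Rlt v v' : v \in C -> v' \in C -> vt v < vt v' -> Rv v v'.
  move=> hv hv' lt; have ne : v != v' by apply: contraTneq lt => ->; rewrite ltnn.
  have := pairwise_mem pC hv hv' ne; rewrite /cmpv lt.
  by rewrite [vt v' < vt v]ltnNge (ltnW lt) /= orbb.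
have vinj v v' : v \in C -> v' \in C -> vt v = vt v' -> v = v'.
  move=> hv hv' e; apply/eqP; apply/negPn/negP => ne.
  by have := pairwise_mem pC hv hv' ne; rewrite /cmpv e ltnn.
have uT : uniq (map vt C).
  apply: (@pairwise_uniq _ (fun x y => x != y)); first by move=> x; rewrite eqxx.
  by rewrite pairwise_map; apply: sub_pairwise pC => v v'; rewrite /cmpv /=; case: ltngtP.
have allT t : t <= T -> exists2 v, v \in C & vt v = t.
  move=> le; have sub : {subset map vt C <= iota 0 T.+1}.
    by move=> _ /mapP[v /Cok[_ h _ _] ->]; rewrite mem_iota.
  have szl : size (iota 0 T.+1) <= size (map vt C) by rewrite size_iota size_map.
  (* T + 1 distinct times in the range 0, ..., T exhaust it. *)
  have [_ e] := uniq_min_size uT sub szl.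
  have : t \in iota 0 T.+1 by rewrite mem_iota.
  by rewrite -e => /mapP[v hv ->]; exists v.
have [v0 hv0 t0] := allT 0 (leq0n T).
have LE v : v \in C -> vL v = vL v0.
  move=> hv; have [e|gt] := posnP (vt v); first by rewrite (vinj v v0) // t0.
  by have /and3P[/eqP -> _ _] : Rv v0 v by apply: Rlt => //; rewrite t0.
pose c := mkseq (fun z => has (fun v => [&& vl v 0 == 0, vp v 0 == T + size w + z
                                      & rd (vg v) 0 == bitc true]) C) (vL v0).
have szc : size c = vL v0 by rewrite size_mkseq.
exists c; first by rewrite szc; case: (Cok v0 hv0).
(* Positions of the certificate are first read at most once, so these reads define [c]. *)
have first v : v \in C -> vl v 0 = 0 -> T + size w <= vp v 0 ->
    vp v 0 < T + size w + size c -> rd (vg v) 0 == bitc false \/ rd (vg v) 0 == bitc true ->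
    rd (vg v) 0 = bitc (nth false c (vp v 0 - T - size w)).
  move=> hv l0 le lt; rewrite nth_mkseq -?szc; last by lia.
  case=> /eqP e; last first.
    rewrite e; congr bitc; apply/esym/hasP; exists v => //; rewrite l0 e !eqxx /= andbT.
    by apply/eqP; lia.
  rewrite e; congr bitc; apply/esym/hasP => -[v' hv' /and3P[/eqP l0' /eqP p' /eqP e']].
  have pe : vp v 0 = vp v' 0 by rewrite p'; lia.
  (* The later step [y] claims a first visit, so its relation to [x] forbids [x] to scan the same
     cell. *)
  have clash x y : x \in C -> y \in C -> vl y 0 = 0 -> vp x 0 = vp y 0 -> vt x < vt y -> False.
    move=> hx hy ly pxy ltxy; have /and3P[_ _ /all_iotaP/(_ ord0)] := Rlt _ _ hx hy ltxy.
    by rewrite /= ly pxy /= eqxx.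
  case: (ltngtP (vt v) (vt v')) => h.
  - exact: (clash v v').
  - exact: (clash v' v).
  - by move: e'; rewrite -(vinj v v') // e => /rk_inj.
(* Strong induction, since the symbol read goes back to a visit at an arbitrary earlier time. *)
have main t : t <= T -> forall v, v \in C -> vt v = t ->
    vg v = rk (view_at M (u c) t : G) /\ forall a : 'I_k.+1, vp v a = hd (u c) T a t.
  elim/ltn_ind: t => t IH leT v hv tv.
  have [okvv _ ltg _] := Cok v hv.
  have [g gE] := rk_surj ltg.
  case/and3P: okvv => ok0 _ /all_iotaP okl.
  have prev s : s < t -> exists v', [/\ vt v' = s, vg v' = rk (view_at M (u c) s : G),
      forall a : 'I_k.+1, vp v' a = hd (u c) T a s & Rv v' v].
    move=> lt; have [v' hv' tv'] := allT s (leq_trans (ltnW lt) leT); exists v'.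
    have [h1 h2] := IH s lt (leq_trans (ltnW lt) leT) v' hv' tv'; split=> //.
    by apply: Rlt => //; rewrite tv tv'.
  have pos (a : 'I_k.+1) : vp v a = hd (u c) T a t.
    case tE: t => [|s].
      rewrite tv tE in ok0; case/andP: (implyP ok0 (eqxx 0)) => _ /all_iotaP h.
      exact/eqP/h.
    have [|v' [tv' h1 h2 /and3P[_ r2 _]]] := prev s; first by rewrite tE.
    rewrite tv tv' tE in r2; case/andP: (implyP r2 (eqxx _)) => _ /all_iotaP h.
    by rewrite (eqP (h a)) h1 mvE mvnE h2.
  have st : g.1 = cstate (run M (u c) t).
    apply: rk_inj; case tE: t => [|s].
      rewrite tv tE in ok0; case/andP: (implyP ok0 (eqxx 0)) => /eqP h _.
      by rewrite -[LHS](tabE 0 (fun g : G => rk g.1)) -gE -/tST h.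
    have [|v' [tv' h1 h2 /and3P[_ r2 _]]] := prev s; first by rewrite tE.
    rewrite tv tv' tE in r2; case/andP: (implyP r2 (eqxx _)) => /eqP h _.
    rewrite -[LHS](tabE 0 (fun g : G => rk g.1)) -gE -/tST h h1 tabE.
    by rewrite (runS M (u c) s).1.
  (* Every earlier time has a vertex in the clique that was compared with [v]; together these
     comparisons confirm the last-visit time claimed by [v]. *)
  have lst (a : 'I_k.+1) : lastv (u c) T a t (vp v a) = vl v a.
    apply: lastv_unique => [|s lt e|s lt le].
    - by have /andP[] := okl a; rewrite tv.
    - have [v' [tv' _ h2 /and3P[_ _ /all_iotaP/(_ a)]]] := prev s lt.
      by rewrite e tv' eqxx => /andP[/eqP <- _]; rewrite h2.
    - have [v' [tv' _ h2 /and3P[_ _ /all_iotaP/(_ a)]]] := prev s lt.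
      by rewrite tv' (ltn_eqF (le : vl v a < s.+1)) le /= h2.
  have rds (a : 'I_k.+1) : g.2 a = (view_at M (u c) t).2 a.
    rewrite (read_content (u c) T) -pos content_last // lst.
    apply: rk_inj; rewrite -rdE -gE.
    have /andP[ll oki] := okl a; case lE: (vl v a) ll oki => [|s] ll oki.
      apply: okinit_sound; last by rewrite szc -(LE v hv).
      by move=> a0; rewrite a0 in lE *; exact: first.
    have lt : s < t by rewrite -tv.
    have [v' [tv' h1 h2 /and3P[_ _ /all_iotaP/(_ a)]]] := prev s lt.
    by rewrite lE tv' eqxx => /andP[_ /eqP ->]; rewrite h1 wrE.
  split=> //; rewrite gE; congr rk; rewrite [g]surjective_pairing; congr pair => //.
  by apply/ffunP => a; rewrite rds.
have [v hv tv] := allT T (leqnn T).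
have [h1 _] := main T (leqnn T) v hv tv.
have [/and3P[_ acc _] _ _ _] := Cok v hv.
by rewrite tv eqxx h1 tabE in acc.
Qed.

End Correct.
End Tableau.

(** * The reduction *)

Lemma horner_nat (p : {poly nat}) (c n : nat) : ((p * 'X + c%:P).[n])%R = (p.[n])%R * n + c.
Proof. by rewrite hornerMXaddC. Qed.

Lemma horner_mono (p : {poly nat}) m n : m <= n -> (p.[m]%R <= p.[n]%R)%N.
Proof.
move=> le; elim/poly_ind: p => [|p c IH]; first by rewrite !horner0.
by rewrite !horner_nat leq_add2r leq_mul.
Qed.

Lemma pf_horner (I : finType) (p : {poly nat}) : pf I (fun n : nat => (p.[n])%R : nat).
Proof.
elim/poly_ind: p => [|p c IH].
  by apply: (@pf_ext _ _ _ _ _ (fun=> 0)); [move=> n; rewrite horner0 | pf].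
apply: (@pf_ext _ _ _ _ _ (fun n => (p.[n])%R * n + c)).
  by move=> n; rewrite horner_nat.
by apply: pf_addn; [apply: pf_muln; [exact: IH | pf] | pf].
Qed.

Section TableauTime.
Variables (A : finType) (M : TM (A + bool)%type) (I : finType).

Lemma pf_tapsl n : pf I (tapsl n).
Proof.
elim: n => [|n IH]; first by rewrite /=; pf.
by rewrite /= /cands; pf.
Qed.

Hint Resolve pf_tapsl : pf.

Lemma pf_allv : pf I (fun p : nat * nat => allv M p.1 p.2).
Proof. rewrite /allv; pf. Qed.

Lemma pf_cmpv : pf I (fun p : vertex * vertex => cmpv M p.1 p.2).
Proof. rewrite /cmpv /Rv /vt /vg /vL /vp /vl /rd /wr /mv /mvn; pf. Qed.

Lemma pf_okv : pf I (fun p : (nat * seq nat) * vertex => okv M p.1.1 p.1.2 p.2).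
Proof. rewrite /okv /okinit /vt /vg /vL /vp /vl /rd; pf. Qed.

Lemma pf_vsof : pf I (fun p : nat * nat * seq nat => vsof M p.1.1 p.1.2 p.2).
Proof.
rewrite /vsof; apply: pf_filter.
  apply: (@pf_comp _ _ _ _ _ _ _ _
    (fun p : (nat * nat * seq nat) * vertex => ((p.1.1.1, p.1.2), p.2)) pf_okv); pf.
apply: (@pf_comp _ _ _ _ _ _ _ _ (fun p : nat * nat * seq nat => (p.1.1, p.1.2)) pf_allv); pf.
Qed.

End TableauTime.

Section Hardness.
Variables (A : finType) (M : TM (A + bool)%type) (p q : {poly nat}).

Definition cert_bound (n : nat) : nat := p.[n]%R.
(** One time for all certificates: [n + cert_bound n] bounds the length of the verifier's input, and
    the added 8 secures [7 <= T]. *)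
Definition time_bound (n : nat) : nat := q.[n + cert_bound n]%R + 8.

Definition v0 : vertex := ((0, 0), (0, [::])).

Definition graph_word (n : nat) (ws : seq nat) : seq (option bool) :=
  instance v0 (cmpv M) (time_bound n) (vsof M (time_bound n) (cert_bound n) ws).

Definition reduction (w : seq A) : seq (option bool) :=
  graph_word (size w) (map (@symc A M) w).

(** Translates ranks in the alphabet of the reducing machine into ranks of tape symbols of the
    verifier; output letters do not occur in inputs and get a dummy value. *)
Definition in_sym : seq nat :=
  [seq (if s is inl a then @symc A M a else 0) | s <- enum {: A + option bool}].

Definition out_code (o : option bool) : nat :=
  if isSome o then if odflt false o then rk (Some true) else rk (Some false) else rk (None : option bool).

Lemma poly_time_reduction : poly_time reduction.
Proof.
apply: (@poly_time_pf A (option bool) reduction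
  (fun z => map out_code (graph_word (size z) (map (nth 0 in_sym) z)))); last first.
  move=> w; rewrite size_map -map_comp.
  have -> : map (nth 0 in_sym \o (fun a => rk (inl a : A + option bool))) w = map (@symc A M) w.
    by apply: eq_map => a /=; rewrite nth_rk.
  by rewrite -/(reduction w); apply: eq_map => -[[]|].
apply: pf_map; first by rewrite /out_code; pf.
have pc : pf (A + option bool)%type cert_bound by exact: pf_horner.
have pt : pf (A + option bool)%type time_bound.
  rewrite /time_bound; apply: pf_addn; last by pf.
  apply: (@pf_comp _ _ _ _ _ _ _ (fun n : nat => q.[n]%R : nat) (fun n => n + cert_bound n)).
    exact: pf_horner.
  by apply: pf_addn; [pf | exact: pc].
have ps : pf (A + option bool)%type (fun z : seq nat => size z) by pf.
rewrite /graph_word.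
apply: (@pf_comp _ _ _ _ _ _ _ _ (fun z => (time_bound (size z),
   vsof M (time_bound (size z)) (cert_bound (size z)) (map (nth 0 in_sym) z)))
   (pf_instance v0 (pf_cmpv M _))).
have ptz := pf_comp pt ps; have pcz := pf_comp pc ps.
apply: pf_pair; first exact: ptz.
apply: (@pf_comp _ _ _ _ _ _ _ _ (fun z => (time_bound (size z), cert_bound (size z), map (nth 0 in_sym) z))
   (pf_vsof M _)).
apply: pf_pair; last by pf.
by apply: pf_pair; [exact: ptz | exact: pcz].
Qed.

Lemma reductionE w : inequalities_problem (reduction w) <->
  ~ exists2 c, size c <= cert_bound (size w)
      & tm_accept (cstate (run M (map inl w ++ map inr c) (time_bound (size w)))).
Proof.
have T7 : 7 <= time_bound (size w) by rewrite /time_bound; lia.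
have [ww _ _] := instance_wf v0 (cmpv M)
  (vsof M (time_bound (size w)) (cert_bound (size w)) (map (@symc A M) w)) T7.
have sE := satn_instance v0
  (vsof M (time_bound (size w)) (cert_bound (size w)) (map (@symc A M) w)) T7 (@cmpv_irr A M).
rewrite problemE; split=> [[_ /sE H] [c le acc]|H].
  by apply: H; apply: tableau_complete le acc.
split=> //; apply/sE => -[C [sC pC szC]]; apply: H.
exact: tableau_sound sC pC szC.
Qed.

End Hardness.

Theorem inequalities_coNP_hard : coNP_hard inequalities_problem.
Proof.
move=> A L [V [p [[M [q decM]] LE]]].
exists (reduction M p q); split; first exact: poly_time_reduction.
move=> w; rewrite reductionE.
(* Shorter certificates may halt earlier, but the time polynomial is monotone and a halted run no
   longer changes. *)
have accE c : size c <= cert_bound p (size w) ->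
    V (map inl w ++ map inr c) <->
    tm_accept (cstate (run M (map inl w ++ map inr c) (time_bound p q (size w)))).
  move=> le; have [t [let' ha ->]] := decM (map inl w ++ map inr c).
  rewrite (run_halted ha) //; apply: leq_trans let' _.
  apply: leq_trans (leq_addr _ _); apply: horner_mono.
  by rewrite size_cat !size_map leq_add2l.
split=> [Lw [c le /(accE c le) Vc]|H]; first by apply: (proj2 (LE w)) Lw; exists c.
(* Membership in NP is assumed for the complement of [L], so only the double negation of [L w] is
   obtained directly. *)
apply: NNPP => /LE[c [le Vc]]; apply: H; exists c => //.
exact/accE.
Qed.

Theorem theorem5 : coNP_complete inequalities_problem.
Proof.
by split; [exact: inequalities_in_coNP | exact: inequalities_coNP_hard].
Qed.
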